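(* Let $f\in\mathcal A_c$ with primitive $F\in\mathcal B_c$. Then: (a) For each $x\in\mathbb R$ and $t>0$ the integrals $f\ast\Theta_t(x)$, $\Theta_t\ast f(x)$ and $F\ast\Theta_t'(x)=\int_{-\infty}^\infty F(\xi)\Theta_t'(x-\xi)\,d\xi$ exist, and $f\ast\Theta_t(x)=\Theta_t\ast f(x)=F\ast\Theta_t'(x)=[F\ast\Theta_t]'(x)$ (derivative in $x$). (b) $(x,t)\mapsto f\ast\Theta_t(x)$ is $C^\infty$ on $\mathbb R\times(0,\infty)$. (c) For every $t>0$, $\|f\ast\Theta_t\|_\infty\le \|f\|/(2\sqrt{\pi t})$, and this estimate is sharp in the sense that the coefficient $1/(2\sqrt{\pi t})$ of $\|f\|$ cannot be reduced. (d) For $t>0$ define the linear operator $\Phi_t:\mathcal A_c\to C(\overline{\mathbb R})$ by $\Phi_t(g)=g\ast\Theta_t$ (with $\mathcal A_c$ normed by the Alexiewicz norm and $C(\overline{\mathbb R})$ by the supremum norm). Then $\|\Phi_t\|=1/(2\sqrt{\pi t})$. (e) For each $t>0$, $\lim_{|x|\to\infty}f\ast\Theta_t(x)=0$. (f) For each $t>0$, $f\ast\Theta_t\in\mathcal A_c$ and $\|f\ast\Theta_t\|\le\|f\|$, and this inequality is sharp in the sense that the coefficient of $\|f\|$ cannot be reduced. The linear operator $\Psi_t:\mathcal A_c\to\mathcal A_c$, $\Psi_t(g)=g\ast\Theta_t$, has operator norm $\|\Psi_t\|=1$. (g) Let $u(x,t)=f\ast\Theta_t(x)$. Then $u$ is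 twice continuously differentiable in $x$ and continuously differentiable in $t$ on $\mathbb R\times(0,\infty)$, satisfies $\partial_t u-\partial_x^2u=0$ on $\mathbb R\times(0,\infty)$, and $\|u(\cdot,t)-f\|\to0$ as $t\to0^+$. (h) For each $t>0$, $\int_{-\infty}^\infty f\ast\Theta_t=\int_{-\infty}^\infty f$. (i) The convolution need not lie in any $L^p$ space: for each $t>0$ there exists $g\in\mathcal A_c$ such that $g\ast\Theta_t\notin L^p(\mathbb R)$ for every $1\le p<\infty$. (j) For each $t>0$, $x\mapsto f\ast\Theta_t(x)$ is real analytic on $\mathbb R$; for each $x\in\mathbb R$, $t\mapsto f\ast\Theta_t(x)$ is real analytic on $(0,\infty)$.
   Context: Let $\overline{\mathbb R}=[-\infty,\infty]$ and let $C(\overline{\mathbb R})$ be the continuous functions $F:\mathbb R\to\mathbb R$ for which $F(\pm\infty):=\lim_{x\to\pm\infty}F(x)$ exist as real numbers. Let $\mathcal B_c=\{F\in C(\overline{\mathbb R}): F(-\infty)=0\}$. Let $\mathcal A_c$ be the set of Schwartz distributions $f$ on $\mathbb R$ such that $f=F'$ (distributional derivative) for some $F\in\mathcal B_c$; this $F$ is unique and called the primitive of $f$. The continuous primitive integral is $\int_a^b f=F(b)-F(a)$ for $a,b\in\overline{\mathbb R}$, and the Alexiewicz norm is $\|f\|=\sup_{x<y}|F(y)-F(x)|$. Locally (Lebesgue or Henstock–Kurzweil) integrable functions are identified with distributions; a function lies in $\mathcal A_c$ when it is the distributional derivative of an element of $\mathcal B_c$. For $g:\mathbb R\to\mathbb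 R$ of bounded variation (variation $Vg=\sup\sum_i|g(x_i)-g(y_i)|$ over disjoint intervals $(x_i,y_i)\subset\mathbb R$, limits $g(\pm\infty)$), $\int_{-\infty}^\infty fg:=F(\infty)g(\infty)-\int_{-\infty}^\infty F\,dg$ (Henstock–Stieltjes integral). Accordingly the convolution $f\ast g(x)=\int_{-\infty}^\infty f(\xi)g(x-\xi)\,d\xi$ and $g\ast f(x)=\int_{-\infty}^\infty f(x-\xi)g(\xi)\,d\xi$ are defined in this sense. The heat kernel is $\Theta_t(x)=(4\pi t)^{-1/2}e^{-x^2/(4t)}$ for $t>0$, primes denoting $x$-derivatives. $\|\cdot\|_\infty$ is the supremum norm on $\mathbb R$. *)

(* Defs.v *)
From Stdlib Require Import Reals ClassicalEpsilon.
From mathcomp Require Import all_boot all_order all_algebra.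
From mathcomp Require Import all_classical all_reals all_analysis Rstruct Rstruct_topology.

Module LpDef.
Import GRing.Theory Num.Theory.
Local Open Scope ring_scope.
Local Open Scope classical_set_scope.
Definition InLp (p : R) (h : R -> R) : Prop :=
  @measurable_fun _ _ (measurableTypeR R) (measurableTypeR R) [set: R] h /\
  (\int[@lebesgue_measure R]_(x in [set: R]) ((`|h x| `^ p)%:E) < +oo)%E.
End LpDef.

From Coquelicot Require Import Coquelicot.
Open Scope R_scope.

Definition InLp := LpDef.InLp.

Definition in_Cbar (F : R -> R) : Prop :=
  (forall x, Coquelicot.Continuity.continuous F x) /\
  (exists a : R, is_lim F p_infty a) /\ (exists b : R, is_lim F m_infty b).

Definition InBc (F : R -> R) : Prop := in_Cbar F /\ is_lim F m_infty 0.

Definition Finf (F : R -> R) : R := real (Lim F p_infty).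

(* ---------- Alexiewicz norm  ||f|| = sup_{x<y} |F(y)-F(x)| ---------- *)
Definition alex (F : R -> R) : R :=
  real (Lub_Rbar (fun r => exists x y, x < y /\ r = Rabs (F y - F x))).

Definition supnorm (h : R -> R) : R :=
  real (Lub_Rbar (fun r => exists x, r = Rabs (h x))).

(* A tagged partition of [x0,b] is a list of (tag z_i, right endpoint x_i);
   it is delta-fine if x_{i-1} < x_i, z_i ∈ [x_{i-1},x_i], x_i - x_{i-1} < delta z_i. *)
Fixpoint fine_part (delta : R -> R) (x0 : R) (l : list (R * R)) (b : R) : Prop :=
  match l with
  | nil => x0 = b
  | (z, x1) :: l' =>
      x0 < x1 /\ x0 <= z <= x1 /\ x1 - x0 < delta z /\ fine_part delta x1 l' b
  end.

Fixpoint RS_sum (F g : R -> R) (x0 : R) (l : list (R * R)) : R :=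
  match l with
  | nil => 0
  | (z, x1) :: l' => F z * (g x1 - g x0) + RS_sum F g x1 l'
  end.

Definition is_HS_int (F g : R -> R) (a b I : R) : Prop :=
  forall eps, 0 < eps -> exists delta : R -> R, (forall x, 0 < delta x) /\
    forall l, fine_part delta a l b -> Rabs (RS_sum F g a l - I) < eps.

Definition is_HS_int_R (F g : R -> R) (I : R) : Prop :=
  (forall a b, a < b -> exists J, is_HS_int F g a b J) /\
  (forall eps, 0 < eps -> exists M, 0 < M /\
     forall a b J, a <= - M -> M <= b -> is_HS_int F g a b J -> Rabs (J - I) < eps).

(* ∫_{-∞}^{∞} f g = F(∞) g(∞) - ∫ F dg, where f ∈ A_c has primitive F and g is
   of bounded variation (the functions g used below are BV). *)
Definition int_fg (F g : R -> R) (v : R) : Prop :=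
  exists Fi gi I, is_lim F p_infty Fi /\ is_lim g p_infty gi /\
    is_HS_int_R F g I /\ v = Fi * gi - I.

Definition test_fun (phi : R -> R) : Prop :=
  (forall n x, ex_derive_n phi n x) /\ (exists M, forall x, M < Rabs x -> phi x = 0).

Definition dist_deriv (H h : R -> R) : Prop :=
  forall phi, test_fun phi -> forall M, (forall x, M < Rabs x -> phi x = 0) ->
    ex_RInt (fun x => h x * phi x) (- M) M /\
    RInt (fun x => H x * Derive phi x) (- M) M = - RInt (fun x => h x * phi x) (- M) M.

Definition prim_of (h H : R -> R) : Prop := InBc H /\ dist_deriv H h.

Definition fun_in_Ac (h : R -> R) : Prop := exists H, prim_of h H.

(* the primitive of h (unique when it exists) *)
Definition prim (h : R -> R) : R -> R :=
  epsilon (inhabits (fun _ => 0)) (fun H => prim_of h H).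

Definition int_fun (h : R -> R) (v : R) : Prop :=
  exists H, prim_of h H /\ v = Finf H.

Definition heat (t x : R) : R := / sqrt (4 * PI * t) * exp (- x ^ 2 / (4 * t)).

(* f * Θ_t (x) = ∫ f(ξ) Θ_t(x-ξ) dξ, f given by its primitive F *)
Definition conv (F : R -> R) (t x : R) : R :=
  epsilon (inhabits 0) (fun v => int_fg F (fun xi => heat t (x - xi)) v).

(* primitive in B_c of the distribution ξ ↦ f(x-ξ): ξ ↦ F(∞) - F(x-ξ) *)
Definition refl_prim (F : R -> R) (x : R) : R -> R := fun xi => Finf F - F (x - xi).

Definition conv_rev (F : R -> R) (t x : R) : R :=
  epsilon (inhabits 0) (fun v => int_fg (refl_prim F x) (heat t) v).

Definition Fconv (F : R -> R) (t x : R) : R :=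
  epsilon (inhabits 0) (fun v => int_fun (fun xi => F xi * heat t (x - xi)) v).

Definition pd (b : bool) (u : R -> R -> R) : R -> R -> R :=
  if b then fun x t => Derive (fun x' => u x' t) x
  else fun x t => Derive (fun t' => u x t') t.

Fixpoint pdl (l : list bool) (u : R -> R -> R) : R -> R -> R :=
  match l with nil => u | b :: l' => pd b (pdl l' u) end.

Definition ex_pd (b : bool) (u : R -> R -> R) (x t : R) : Prop :=
  if b then ex_derive (fun x' => u x' t) x else ex_derive (fun t' => u x t') t.

Definition cont2 (u : R -> R -> R) (x t : R) : Prop :=
  Coquelicot.Continuity.continuous (fun p : R * R => u (fst p) (snd p)) (x, t).

Definition smooth_on (u : R -> R -> R) (D : R -> R -> Prop) : Prop :=
  forall l x t, D x t -> cont2 (pdl l u) x t /\ forall b, ex_pd b (pdl l u) x t.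

Definition opnorm_Phi (t : R) : R :=
  real (Lub_Rbar (fun r => exists G, InBc G /\ alex G <> 0 /\
                     r = supnorm (conv G t) / alex G)).

Definition opnorm_Psi (t : R) : R :=
  real (Lub_Rbar (fun r => exists G, InBc G /\ alex G <> 0 /\
                     r = alex (prim (conv G t)) / alex G)).

Definition analytic_on (h : R -> R) (D : R -> Prop) : Prop :=
  forall x0, D x0 -> exists (a : nat -> R) (r : R), 0 < r /\
    forall x, D x -> Rabs (x - x0) < r -> is_pseries a (x - x0) (h x).

(* Main.v *)
(** Integrating by parts, [f * Theta_t] is the integral of [F xi * Theta_t' (x - xi)]:
    all derivatives fall on the kernel, and the [n]-th one equals a Hermite-type
    polynomial times [Theta_t], bounded by [C (K sqrt (n / t)) ^ n * Theta_{2t}].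
    Dominated convergence then gives smoothness, the limits at infinity and the heat
    equation, and the growth in [n] gives analyticity in [x] and, since
    [d/dt = d^2/dx^2], in [t].  The primitive of [f * Theta_t] is [F * Theta_t], an
    average of translates of [F], whence the norm bounds; Gaussians attain them in
    the limit.  For the failure of integrability take [F x = sin (w x) / (1 + ln (1 + x^2))]:
    convolution preserves the oscillation up to a constant factor, and the amplitude
    decays more slowly than any power. *)
Require Import Defs.
From Stdlib Require Import Reals Lra Lia ClassicalEpsilon Factorial FunctionalExtensionality.
From Coquelicot Require Import Coquelicot.
Open Scope R_scope.

(** * Integrals over the line *)

(** The convolutions and [prim] are picked by [epsilon], so nothing can be computed before existence
    and uniqueness are known: for Henstock-Stieltjes integrals through Cousin's lemma, for
    distributional primitives through bump test functions. The working notion [lint] can stay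
    elementary because all integrands here are continuous. Comparing integrals becomes comparing
    derivatives, and differentiation under the integral sign needs only a second order Taylor
    remainder bounded by [h ^ 2] times a fixed Gaussian. Doubling the time of these Gaussians pays
    for polynomial factors and for small shifts. The coefficient [1 / (2 sqrt (PI t))] is half the
    integral of [Rabs (Theta_t')]: the derivative kernel is odd, so it only sees differences of [F].
    In the counterexample a large exponent makes each oscillation contribute little, but about
    [M ^ 2] half-periods fit below a distance of order [M ^ 2], and each contributes at least a
    constant over [M], because the amplitude is only logarithmic. *)

Lemma is_lim_pinfty_spec (f : R -> R) (l : R) :
  is_lim f p_infty l <->
  forall eps, 0 < eps -> exists M, forall x, M < x -> Rabs (f x - l) < eps.
Proof.
split.
- intros H eps He; apply is_lim_spec in H.
  destruct (H (mkposreal eps He)) as [M HM]; exists M; exact HM.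
- intros H; apply is_lim_spec; intros [eps He]; exact (H eps He).
Qed.

Lemma is_lim_minfty_spec (f : R -> R) (l : R) :
  is_lim f m_infty l <->
  forall eps, 0 < eps -> exists M, forall x, x < M -> Rabs (f x - l) < eps.
Proof.
split.
- intros H eps He; apply is_lim_spec in H.
  destruct (H (mkposreal eps He)) as [M HM]; exists M; exact HM.
- intros H; apply is_lim_spec; intros [eps He]; exact (H eps He).
Qed.

Lemma is_lim_lin (f g : R -> R) (a b : R) (x : Rbar) (lf lg : R) :
  is_lim f x lf -> is_lim g x lg ->
  is_lim (fun y => a * f y + b * g y) x (a * lf + b * lg).
Proof.
intros Hf Hg.
apply (is_lim_plus _ _ _ (a * lf) (b * lg)).
- exact (is_lim_scal_l f a x lf Hf).
- exact (is_lim_scal_l g b x lg Hg).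
- reflexivity.
Qed.

Lemma is_lim_val (f : R -> R) (x : Rbar) (l l' : R) :
  is_lim f x l -> l = l' -> is_lim f x l'.
Proof. intros H <-; exact H. Qed.

Lemma is_lim_unique_R (f : R -> R) (x : Rbar) (l l' : R) :
  is_lim f x l -> is_lim f x l' -> l = l'.
Proof.
intros H1 H2; apply is_lim_unique in H1; apply is_lim_unique in H2.
rewrite H1 in H2; injection H2; auto.
Qed.

Lemma is_derive_lin (f g : R -> R) (a b x df dg : R) :
  is_derive f x df -> is_derive g x dg ->
  is_derive (fun y => a * f y + b * g y) x (a * df + b * dg).
Proof.
intros Hf Hg.
apply @is_derive_plus; apply is_derive_scal; assumption.
Qed.

Lemma is_derive_val (f : R -> R) (x l l' : R) :
  is_derive f x l -> l = l' -> is_derive f x l'.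
Proof. intros H <-; exact H. Qed.

Lemma is_derive_eq (f g : R -> R) (x l : R) :
  (forall y, f y = g y) -> is_derive f x l -> is_derive g x l.
Proof. intros E; now apply is_derive_ext. Qed.

Lemma mvt (f df : R -> R) (a b : R) :
  (forall x, Rmin a b <= x <= Rmax a b -> is_derive f x (df x)) ->
  exists c, Rmin a b <= c <= Rmax a b /\ f b - f a = df c * (b - a).
Proof.
intros H.
apply (MVT_gen f a b df).
- intros x Hx; apply H; lra.
- intros x Hx; apply derivable_continuous_pt.
  exists (df x); apply is_derive_Reals, H, Hx.
Qed.

Lemma derive_nonneg_incr (f df : R -> R) (a b : R) :
  a <= b -> (forall x, a <= x <= b -> is_derive f x (df x)) ->
  (forall x, a <= x <= b -> 0 <= df x) -> f a <= f b.
Proof.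
intros Hab Hd Hp.
destruct (mvt f df a b) as [c [Hc E]];
  rewrite Rmin_left in * by lra; rewrite Rmax_right in * by lra; auto.
assert (0 <= df c * (b - a)) by (apply Rmult_le_pos; [auto | lra]).
lra.
Qed.

(** Both [g + f] and [g - f] are nondecreasing. This stands in for the comparison of integrals and
    asks for no integrability of [df]. *)
Lemma derive_dominated (f df g dg : R -> R) (a b : R) :
  a <= b ->
  (forall x, a <= x <= b -> is_derive f x (df x)) ->
  (forall x, a <= x <= b -> is_derive g x (dg x)) ->
  (forall x, a <= x <= b -> Rabs (df x) <= dg x) ->
  Rabs (f b - f a) <= g b - g a.
Proof.
intros Hab Hf Hg Hd.
assert (A1 : 1 * g a + 1 * f a <= 1 * g b + 1 * f b).
{ apply (derive_nonneg_incr (fun y => 1 * g y + 1 * f y)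
    (fun y => 1 * dg y + 1 * df y) a b Hab).
  - intros x Hx; apply is_derive_lin; auto.
  - intros x Hx; specialize (Hd x Hx); apply Rabs_le_between in Hd; lra. }
assert (A2 : 1 * g a + (-1) * f a <= 1 * g b + (-1) * f b).
{ apply (derive_nonneg_incr (fun y => 1 * g y + (-1) * f y)
    (fun y => 1 * dg y + (-1) * df y) a b Hab).
  - intros x Hx; apply is_derive_lin; auto.
  - intros x Hx; specialize (Hd x Hx); apply Rabs_le_between in Hd; lra. }
apply Rabs_le; lra.
Qed.

Lemma derive_zero_const (f : R -> R) :
  (forall x, is_derive f x 0) -> forall x y, f x = f y.
Proof.
intros H x y.
destruct (mvt f (fun _ => 0) x y) as [c [_ E]]; auto; lra.
Qed.

(* An absolutely or conditionally convergent integral over the line, read off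
   from the limits of a primitive. *)
Definition lint (h : R -> R) (I : R) : Prop :=
  exists H, (forall x, is_derive H x (h x)) /\ is_lim H m_infty 0 /\ is_lim H p_infty I.

Lemma lint_unique (h : R -> R) (I J : R) : lint h I -> lint h J -> I = J.
Proof.
intros [H [dH [mH pH]]] [K [dK [mK pK]]].
assert (E : forall x y, 1 * H x + (-1) * K x = 1 * H y + (-1) * K y).
{ apply (derive_zero_const (fun x => 1 * H x + (-1) * K x)).
  intros x; eapply is_derive_val; [apply is_derive_lin; auto | ring]. }
assert (E0 : 1 * 0 + (-1) * 0 = 1 * I + (-1) * J).
{ assert (L1 := is_lim_lin H K 1 (-1) m_infty 0 0 mH mK).
  assert (L2 := is_lim_lin H K 1 (-1) p_infty I J pH pK).
  apply (is_lim_ext _ (fun _ => 1 * H 0 + (-1) * K 0)) in L1; [| intros; apply E].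
  apply (is_lim_ext _ (fun _ => 1 * H 0 + (-1) * K 0)) in L2; [| intros; apply E].
  transitivity (1 * H 0 + (-1) * K 0).
  - exact (is_lim_unique_R _ _ _ _ L1 (is_lim_const _ _)).
  - exact (is_lim_unique_R _ _ _ _ (is_lim_const _ _) L2). }
lra.
Qed.

Lemma lint_ext (h k : R -> R) (I : R) :
  (forall x, h x = k x) -> lint h I -> lint k I.
Proof.
intros E [H [dH HH]]; exists H; split; [| exact HH].
intros x; rewrite <- E; auto.
Qed.

Lemma lint_lin (h k : R -> R) (a b I J : R) :
  lint h I -> lint k J -> lint (fun x => a * h x + b * k x) (a * I + b * J).
Proof.
intros [H [dH [mH pH]]] [K [dK [mK pK]]].
exists (fun x => a * H x + b * K x); split; [| split].
- intros x; apply is_derive_lin; auto.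
- eapply is_lim_val; [apply is_lim_lin; eassumption | ring].
- apply is_lim_lin; assumption.
Qed.

Lemma lint_scal (h : R -> R) (a I : R) :
  lint h I -> lint (fun x => a * h x) (a * I).
Proof.
intros H; assert (A := lint_lin h h a 0 I I H H).
replace (a * I) with (a * I + 0 * I) by ring.
revert A; apply lint_ext; intros; ring.
Qed.

Lemma lint_minus (h k : R -> R) (I J : R) :
  lint h I -> lint k J -> lint (fun x => h x - k x) (I - J).
Proof.
intros H K; assert (A := lint_lin h k 1 (-1) I J H K).
replace (I - J) with (1 * I + (-1) * J) by ring.
revert A; apply lint_ext; intros; ring.
Qed.

Lemma is_lim_affine (H : R -> R) (a b l : R) :
  0 < a -> is_lim H p_infty l -> is_lim (fun x => H (a * x + b)) p_infty l.
Proof.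
intros Ha HH; apply is_lim_pinfty_spec; intros eps He.
destruct (proj1 (is_lim_pinfty_spec _ _) HH eps He) as [M HM].
exists ((M - b) / a); intros x Hx; apply HM.
apply (Rmult_lt_compat_l a) in Hx; [| exact Ha].
replace (a * ((M - b) / a)) with (M - b) in Hx by (field; lra); lra.
Qed.

Lemma is_lim_opp_arg (H : R -> R) (l : R) :
  is_lim H p_infty l <-> is_lim (fun x => H (- x)) m_infty l.
Proof.
rewrite is_lim_pinfty_spec, is_lim_minfty_spec; split; intros HH eps He;
  destruct (HH eps He) as [M HM]; exists (- M); intros x Hx.
- apply HM; lra.
- rewrite <- (Ropp_involutive x); apply HM; lra.
Qed.

Lemma is_lim_opp_arg' (H : R -> R) (l : R) :
  is_lim H m_infty l <-> is_lim (fun x => H (- x)) p_infty l.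
Proof.
rewrite (is_lim_opp_arg (fun x => H (- x))).
split; apply is_lim_ext; intros x; now rewrite Ropp_involutive.
Qed.

Lemma is_lim_affine_m (H : R -> R) (a b l : R) :
  0 < a -> is_lim H m_infty l -> is_lim (fun x => H (a * x + b)) m_infty l.
Proof.
intros Ha HH; apply is_lim_opp_arg'.
apply (is_lim_ext (fun x => H (- (a * x + - b)))).
- intros x; f_equal; ring.
- apply (is_lim_affine (fun y => H (- y))); [exact Ha |].
  now apply is_lim_opp_arg'.
Qed.

Lemma is_derive_affine (H : R -> R) (a b x l : R) :
  is_derive H (a * x + b) l -> is_derive (fun x => H (a * x + b)) x (a * l).
Proof.
intros HH.
apply (is_derive_comp H (fun x => a * x + b) x l a HH).
auto_derive; [exact I | ring].
Qed.

Lemma lint_affine (h : R -> R) (a b I : R) :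
  0 < a -> lint h I -> lint (fun x => a * h (a * x + b)) I.
Proof.
intros Ha [H [dH [mH pH]]].
exists (fun x => H (a * x + b)); split; [| split].
- intros x; apply is_derive_affine; auto.
- apply is_lim_affine_m; assumption.
- apply is_lim_affine; assumption.
Qed.

Lemma lint_opp_arg (h : R -> R) (I : R) : lint h I -> lint (fun x => h (- x)) I.
Proof.
intros [H [dH [mH pH]]].
exists (fun x => I - H (- x)); split; [| split].
- intros x.
  apply (is_derive_ext (fun x => 1 * I + (-1) * H ((-1) * x + 0))).
  { intros y; replace (-1 * y + 0) with (- y) by ring; simpl; ring. }
  eapply is_derive_val.
  + apply is_derive_lin; [apply @is_derive_const | apply is_derive_affine; apply dH].
  + replace (-1 * x + 0) with (- x) by ring; unfold zero; simpl; ring.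
- apply (is_lim_ext (fun x => 1 * I + (-1) * H (- x))); [intros; ring |].
  eapply is_lim_val.
  + apply is_lim_lin; [apply is_lim_const | apply -> is_lim_opp_arg; apply pH].
  + ring.
- apply (is_lim_ext (fun x => 1 * I + (-1) * H (- x))); [intros; ring |].
  eapply is_lim_val.
  + apply is_lim_lin; [apply is_lim_const | apply -> is_lim_opp_arg'; apply mH].
  + ring.
Qed.

Lemma lint_reflect (h : R -> R) (x I : R) : lint h I -> lint (fun y => h (x - y)) I.
Proof.
intros HI; apply lint_opp_arg in HI.
apply (lint_affine _ 1 (- x)) in HI; [| lra].
revert HI; apply lint_ext; intros y.
replace (- (1 * y + - x)) with (x - y) by ring; ring.
Qed.

Lemma lint_primitive_bounds (h H : R -> R) (I : R) :
  (forall x, is_derive H x (h x)) -> is_lim H m_infty 0 -> is_lim H p_infty I ->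
  (forall x, 0 <= h x) -> forall x, 0 <= H x <= I.
Proof.
intros dH mH pH Hp x.
assert (Hi : forall a b, a <= b -> H a <= H b).
{ intros a b Hab; apply (derive_nonneg_incr H h a b Hab); auto. }
split.
- apply Rnot_lt_le; intros Hx.
  destruct (proj1 (is_lim_minfty_spec _ _) mH (- H x)) as [M HM]; [lra |].
  assert (A := HM (Rmin (M - 1) x)).
  assert (B := Rmin_l (M - 1) x); assert (C := Rmin_r (M - 1) x).
  specialize (A ltac:(lra)); apply Rabs_def2 in A.
  specialize (Hi _ _ C); lra.
- apply Rnot_lt_le; intros Hx.
  destruct (proj1 (is_lim_pinfty_spec _ _) pH (H x - I)) as [M HM]; [lra |].
  assert (A := HM (Rmax (M + 1) x)).
  assert (B := Rmax_l (M + 1) x); assert (C := Rmax_r (M + 1) x).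
  specialize (A ltac:(lra)); apply Rabs_def2 in A.
  specialize (Hi _ _ C); lra.
Qed.

Lemma lint_nonneg (h : R -> R) (I : R) : lint h I -> (forall x, 0 <= h x) -> 0 <= I.
Proof.
intros [H [dH [mH pH]]] Hp.
assert (A := lint_primitive_bounds h H I dH mH pH Hp 0); lra.
Qed.

Lemma lint_le (h k : R -> R) (I J : R) :
  lint h I -> lint k J -> (forall x, h x <= k x) -> I <= J.
Proof.
intros HI HJ Hle.
assert (A := lint_nonneg _ _ (lint_minus _ _ _ _ HJ HI)).
specialize (A ltac:(intros x; specialize (Hle x); simpl; lra)); lra.
Qed.

Lemma lint_abs_le (h k : R -> R) (I J : R) :
  lint h I -> lint k J -> (forall x, Rabs (h x) <= k x) -> Rabs I <= J.
Proof.
intros HI HJ Hle; apply Rabs_le; split.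
- assert (A := lint_scal _ (-1) _ HI).
  assert (B := lint_le _ _ _ _ A HJ).
  specialize (B ltac:(intros x; specialize (Hle x); apply Rabs_le_between in Hle; simpl; lra)).
  lra.
- apply (lint_le h k); auto; intros x; specialize (Hle x); apply Rabs_le_between in Hle; lra.
Qed.

Lemma continuous_primitive (h : R -> R) :
  (forall x, continuous h x) -> forall x, is_derive (fun y => RInt h 0 y) x (h x).
Proof.
intros Hc x; apply (is_derive_RInt h _ 0 x); [| apply Hc].
apply filter_forall; intros y; apply @RInt_correct.
apply ex_RInt_continuous; auto.
Qed.

(** The Cauchy criterion: increments of [H] are no larger than those of [G], so convergence of [G]
    at [x] passes to [H] with no candidate limit at hand. *)
Lemma cauchy_lim_transfer (G H : R -> R) (x : Rbar) (l : R) :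
  (forall a b, Rabs (H b - H a) <= Rabs (G b - G a)) ->
  is_lim G x l -> exists l', is_lim H x (Finite l').
Proof.
intros Hd HG.
assert (C := proj2 (filterlim_locally_cauchy (F := Rbar_locally' x) G)).
destruct (proj1 (filterlim_locally_cauchy (F := Rbar_locally' x) H)) as [l' Hl'].
- intros eps; destruct (C (ex_intro _ l HG) eps) as [P [HP HP']].
  exists P; split; [exact HP |]; intros u v Hu Hv.
  apply Rle_lt_trans with (1 := Hd u v); exact (HP' u v Hu Hv).
- exists l'; exact Hl'.
Qed.

(** Comparison test. Continuity supplies a primitive based at 0, domination its limits at both ends;
    subtracting the left limit normalises it. *)
Lemma lint_exists (h g : R -> R) (J : R) :
  (forall x, continuous h x) -> lint g J -> (forall x, Rabs (h x) <= g x) ->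
  exists I, lint h I.
Proof.
intros Hc [G [dG [mG pG]]] Hle.
set (H := fun y => RInt h 0 y).
assert (dH : forall x, is_derive H x (h x)) by exact (continuous_primitive h Hc).
assert (Hd : forall a b, Rabs (H b - H a) <= Rabs (G b - G a)).
{ assert (Hd : forall a b, a <= b -> Rabs (H b - H a) <= G b - G a).
  { intros a b Hab; apply (derive_dominated H h G g a b Hab); auto. }
  intros a b; destruct (Rle_dec a b) as [Hab | Hab].
  - apply Rle_trans with (1 := Hd a b Hab); apply Rle_abs.
  - rewrite (Rabs_minus_sym (H b)), (Rabs_minus_sym (G b)).
    apply Rle_trans with (1 := Hd b a ltac:(lra)); apply Rle_abs. }
destruct (cauchy_lim_transfer G H m_infty 0 Hd mG) as [lm Hlm].
destruct (cauchy_lim_transfer G H p_infty J Hd pG) as [lp Hlp].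
exists (1 * lp + (-1) * lm); exists (fun x => 1 * H x + (-1) * lm); split; [| split].
- intros x; eapply is_derive_val.
  + apply is_derive_lin; [apply dH | apply @is_derive_const].
  + unfold zero; simpl; ring.
- eapply is_lim_val; [apply is_lim_lin; [exact Hlm | apply is_lim_const] | ring].
- apply is_lim_lin; [exact Hlp | apply is_lim_const].
Qed.

(* Dominated convergence: [A] depends only on the dominating function [g], so
   [h] may be chosen afterwards, uniformly small relative to [k] on [[-A, A]]. *)
Lemma lint_dominated_small (g k : R -> R) (Jg Jk eps : R) :
  lint g Jg -> lint k Jk -> (forall x, 0 <= k x) -> 0 < eps ->
  exists A, 0 < A /\ forall h I, lint h I ->
    (forall y, Rabs (h y) <= g y) ->
    (forall y, - A <= y <= A -> Rabs (h y) <= k y) ->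
    Rabs I <= Jk + eps.
Proof.
intros [G [dG [mG pG]]] [K [dK [mK pK]]] Hk He.
destruct (proj1 (is_lim_minfty_spec _ _) mG (eps / 4)) as [M1 HM1]; [lra |].
destruct (proj1 (is_lim_pinfty_spec _ _) pG (eps / 4)) as [M2 HM2]; [lra |].
set (A := Rmax 1 (Rmax (1 - M1) (M2 + 1))).
assert (A0 : 1 <= A) by apply Rmax_l.
assert (A1 : 1 - M1 <= A) by (eapply Rle_trans; [apply Rmax_l | apply Rmax_r]).
assert (A2 : M2 + 1 <= A) by (eapply Rle_trans; [apply Rmax_r | apply Rmax_r]).
exists A; split; [lra |].
intros h I [H [dH [mH pH]]] Hg Hk'.
assert (G1 := HM1 (- A) ltac:(lra)); assert (G2 := HM2 A ltac:(lra)).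
apply Rabs_def2 in G1; apply Rabs_def2 in G2.
assert (K1 := lint_primitive_bounds k K Jk dK mK pK Hk (- A)).
assert (K2 := lint_primitive_bounds k K Jk dK mK pK Hk A).
assert (Hmid : Rabs (H A - H (- A)) <= K A - K (- A)).
{ apply (derive_dominated H h K k (- A) A); auto; lra. }
assert (Ht : forall a b, a <= b -> Rabs (H b - H a) <= G b - G a).
{ intros a b Hab; apply (derive_dominated H h G g a b Hab); auto. }
assert (Hr : Rabs I <= Jk + eps).
(* The limits 0 and [I] of [H] are only approached, so an extra [e] is spent at two far points.
   Between these the middle piece costs at most [Jk], and each tail at most [eps / 2], as an
   increment of [G] between two values within [eps / 4] of its limit. *)
{ apply le_epsilon; intros e He'.
  destruct (proj1 (is_lim_minfty_spec _ _) mH (e / 2)) as [N1 HN1]; [lra |].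
  destruct (proj1 (is_lim_pinfty_spec _ _) pH (e / 2)) as [N2 HN2]; [lra |].
  assert (L1 := HN1 (Rmin (- A) (N1 - 1)) ltac:(generalize (Rmin_r (- A) (N1 - 1)); lra)).
  assert (L2 := HN2 (Rmax A (N2 + 1)) ltac:(generalize (Rmax_r A (N2 + 1)); lra)).
  assert (T1 := Ht _ _ (Rmin_l (- A) (N1 - 1))).
  assert (T2 := Ht _ _ (Rmax_l A (N2 + 1))).
  assert (U1 := HM1 (Rmin (- A) (N1 - 1)) ltac:(generalize (Rmin_l (- A) (N1 - 1)); lra)).
  assert (U2 := HM2 (Rmax A (N2 + 1)) ltac:(generalize (Rmax_l A (N2 + 1)); lra)).
  apply Rabs_def2 in L1; apply Rabs_def2 in L2; apply Rabs_le_between in Hmid.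
  apply Rabs_def2 in U1; apply Rabs_def2 in U2.
  apply Rabs_le_between in T1; apply Rabs_le_between in T2.
  apply Rabs_le; lra. }
exact Hr.
Qed.

(** * The heat kernel and its derivatives *)

Definition gauss (s : R) : R := exp (- (s * s)).

Lemma gauss_continuous (s : R) : continuous gauss s.
Proof. apply @ex_derive_continuous; unfold gauss; auto_derive; exact I. Qed.

Definition gauss_prim (x : R) : R := RInt gauss 0 x.

Lemma gauss_prim_derive (x : R) : is_derive gauss_prim x (gauss x).
Proof. apply continuous_primitive, gauss_continuous. Qed.

(* The classical companion of [gauss_prim ^ 2]: their sum has zero derivative. *)
Definition gauss_aux (x : R) : R :=
  RInt (fun s => exp (- (x * x) * (1 + s * s)) / (1 + s * s)) 0 1.

Lemma gauss_aux_integrand_derive (u s : R) :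
  is_derive (fun z => exp (- (z * z) * (1 + s * s)) / (1 + s * s)) u
    (- 2 * u * exp (- (u * u) * (1 + s * s))).
Proof.
assert (H : 0 < 1 + s * s) by nra.
auto_derive; [lra | field; lra].
Qed.

(** Differentiating under the integral sign lets [gauss x] be factored out; the substitution of
    [x * s] for the variable turns what remains into [gauss_prim x]. *)
Lemma gauss_aux_derive (x : R) :
  is_derive gauss_aux x (- 2 * gauss x * gauss_prim x).
Proof.
eapply is_derive_val.
- apply is_derive_RInt_param.
  + apply filter_forall; intros u s _; eexists; apply gauss_aux_integrand_derive.
  + intros s _.
    apply (continuity_2d_pt_ext (fun u v => - 2 * u * exp (- (u * u) * (1 + v * v)))).
    { intros u v; symmetry; apply is_derive_unique, gauss_aux_integrand_derive. }
    apply continuity_2d_pt_mult.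
    { apply continuity_2d_pt_mult; [apply continuity_2d_pt_const | apply continuity_2d_pt_id1]. }
    apply (continuity_1d_2d_pt_comp exp).
    { apply derivable_continuous_pt, derivable_pt_exp. }
    apply continuity_2d_pt_mult.
    { apply continuity_2d_pt_opp, continuity_2d_pt_mult; apply continuity_2d_pt_id1. }
    apply continuity_2d_pt_plus; [apply continuity_2d_pt_const |].
    apply continuity_2d_pt_mult; apply continuity_2d_pt_id2.
  + apply filter_forall; intros u; apply @ex_RInt_continuous; intros s _.
    apply @ex_derive_continuous; auto_derive; nra.
(* The [+ 0] gives the integrand the affine shape that [RInt_comp_lin] expects. *)
- rewrite (RInt_ext _ (fun s => scal (- 2 * gauss x) (x * gauss (x * s + 0)))).
  2: { intros s _; unfold scal; simpl; unfold mult; simpl.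
       transitivity (- 2 * x * exp (- (x * x) * (1 + s * s))).
       { apply is_derive_unique, gauss_aux_integrand_derive. }
       unfold gauss.
       replace (- (x * x) * (1 + s * s)) with (- (x * x) + - ((x * s + 0) * (x * s + 0))) by ring.
       rewrite exp_plus; ring. }
  assert (Hc : ex_RInt gauss (x * 0 + 0) (x * 1 + 0)).
  { apply @ex_RInt_continuous; intros; apply gauss_continuous. }
  transitivity (- 2 * gauss x * RInt (fun s => x * gauss (x * s + 0)) 0 1).
  { apply (RInt_scal (V := R_CompleteNormedModule)).
    apply @ex_RInt_continuous; intros s _.
    apply @ex_derive_continuous; unfold gauss; auto_derive; exact I. }
  f_equal.
  transitivity (RInt gauss (x * 0 + 0) (x * 1 + 0)).
  { exact (RInt_comp_lin gauss x 0 0 1 Hc). }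
  unfold gauss_prim; f_equal; ring.
Qed.

Lemma gauss_aux_0 : gauss_aux 0 = PI / 4.
Proof.
unfold gauss_aux.
rewrite (RInt_ext _ (fun s => / (1 + s ^ 2))).
2: { intros s _; replace (- (0 * 0) * (1 + s * s)) with 0 by ring; rewrite exp_0.
     simpl; rewrite Rmult_1_r; unfold Rdiv; ring. }
apply is_RInt_unique.
replace (PI / 4) with (minus (atan 1) (atan 0)).
2: { rewrite atan_1, atan_0; unfold minus, plus, opp; simpl; ring. }
apply @is_RInt_derive; intros s _.
- apply is_derive_Reals.
  apply derivable_pt_lim_atan.
- apply @ex_derive_continuous; auto_derive; nra.
Qed.

Lemma gauss_prim_sqr (x : R) : gauss_prim x * gauss_prim x + gauss_aux x = PI / 4.
Proof.
assert (D : forall y, is_derive (fun y => gauss_prim y * gauss_prim y + gauss_aux y) y 0).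
{ intros y; eapply is_derive_val.
  - apply @is_derive_plus; [| apply gauss_aux_derive].
    apply @is_derive_mult; [apply gauss_prim_derive | apply gauss_prim_derive |].
    intros n m; apply Rmult_comm.
  - unfold plus, mult; simpl; ring. }
rewrite (derive_zero_const _ D x 0).
replace (gauss_prim 0) with 0.
- rewrite gauss_aux_0; ring.
- unfold gauss_prim; rewrite RInt_point; reflexivity.
Qed.

Lemma gauss_aux_bounds (x : R) : 0 <= gauss_aux x <= gauss x.
Proof.
assert (Hc : forall s, continuous (fun s => exp (- (x * x) * (1 + s * s)) / (1 + s * s)) s).
{ intros s; apply @ex_derive_continuous; auto_derive; nra. }
unfold gauss_aux; split.
- apply RInt_ge_0; [lra | apply @ex_RInt_continuous; intros; apply Hc |].
  intros s _; apply Rlt_le, Rdiv_lt_0_compat; [apply exp_pos | nra].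
- replace (gauss x) with (RInt (fun _ => gauss x) 0 1).
  2: { rewrite RInt_const; unfold scal; simpl; unfold mult; simpl; ring. }
  apply RInt_le; [lra | apply @ex_RInt_continuous; intros; apply Hc
                 | apply ex_RInt_const |].
  intros s _; unfold gauss.
  assert (A : exp (- (x * x) * (1 + s * s)) <= exp (- (x * x))).
  { destruct (Req_dec (x * x * (s * s)) 0) as [E | E].
    - right; f_equal; nra.
    - left; apply exp_increasing.
      assert (0 <= (x * s) * (x * s)) by apply Rle_0_sqr. nra. }
  apply Rle_trans with (2 := A).
  apply Rle_div_l; [nra |].
  assert (B := exp_pos (- (x * x) * (1 + s * s))); nra.
Qed.

Lemma gauss_le_inv (x : R) : gauss x <= / (1 + x * x).
Proof.
unfold gauss; rewrite exp_Ropp; apply Rinv_le_contravar; [nra |].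
assert (A := exp_ineq1_le (x * x)); lra.
Qed.

(** With [P = gauss_prim x], [gauss_prim_sqr] says that [(sqrt PI / 2 - P) * (sqrt PI / 2 + P)] is
    [gauss_aux x], hence at most [gauss x]. The second factor is at least [1 / 2], so the error is
    at most [2 * gauss x]. *)
Lemma gauss_prim_lim : is_lim gauss_prim p_infty (sqrt PI / 2).
Proof.
apply is_lim_pinfty_spec; intros eps He.
exists (Rmax 1 (4 / eps)); intros x Hx.
assert (X1 := Rmax_l 1 (4 / eps)); assert (X2 := Rmax_r 1 (4 / eps)).
assert (HP : 0 <= gauss_prim x).
{ unfold gauss_prim; apply RInt_ge_0; [lra | |].
  - apply @ex_RInt_continuous; intros; apply gauss_continuous.
  - intros; apply Rlt_le, exp_pos. }
assert (HS : 1 <= sqrt PI).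
{ rewrite <- sqrt_1; apply sqrt_le_1_alt; assert (A := PI2_1); lra. }
assert (E := gauss_prim_sqr x); assert (B := gauss_aux_bounds x).
assert (SS : sqrt PI * sqrt PI = PI) by (apply sqrt_sqrt; assert (A := PI_RGT_0); lra).
assert (G : gauss x < eps / 2).
{ apply Rle_lt_trans with (1 := gauss_le_inv x).
  assert (A : 4 < x * eps).
  { replace 4 with (4 / eps * eps) by (field; lra).
    apply Rmult_lt_compat_r; lra. }
  assert (0 < / (1 + x * x)) by (apply Rinv_0_lt_compat; nra).
  apply Rmult_lt_reg_r with (1 + x * x); [nra |].
  rewrite Rinv_l by nra. nra. }
apply Rabs_def1; nra.
Qed.

Lemma lint_gauss : lint gauss (sqrt PI).
Proof.
exists (fun x => gauss_prim x + sqrt PI / 2); split; [| split].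
- intros x; eapply is_derive_val.
  + apply @is_derive_plus; [apply gauss_prim_derive | apply @is_derive_const].
  + unfold plus, zero; simpl; ring.
- assert (Hodd : forall x, gauss_prim (- x) = - gauss_prim x).
  { intros x.
    assert (D : forall y, is_derive (fun y => 1 * gauss_prim y + 1 * gauss_prim (- 1 * y + 0)) y 0).
    { intros y; eapply is_derive_val.
      - apply is_derive_lin; [apply gauss_prim_derive |].
        apply is_derive_affine, gauss_prim_derive.
      - unfold gauss; replace ((-1 * y + 0) * (-1 * y + 0)) with (y * y) by ring; ring. }
    assert (E := derive_zero_const _ D x 0); simpl in E.
    replace (-1 * 0 + 0) with 0 in E by ring.
    replace (-1 * x + 0) with (- x) in E by ring.
    assert (E0 : gauss_prim 0 = 0) by (unfold gauss_prim; rewrite RInt_point; reflexivity).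
    lra. }
  apply is_lim_opp_arg'.
  apply (is_lim_ext (fun x => (-1) * gauss_prim x + 1 * (sqrt PI / 2))).
  { intros x; rewrite Hodd; ring. }
  eapply is_lim_val; [apply is_lim_lin; [apply gauss_prim_lim | apply is_lim_const] | field].
- apply (is_lim_ext (fun x => 1 * gauss_prim x + 1 * (sqrt PI / 2))).
  { intros x; ring. }
  eapply is_lim_val; [apply is_lim_lin; [apply gauss_prim_lim | apply is_lim_const] | field].
Qed.

(** * Normalisation, recurrence and Gaussian bounds for the heat kernel *)

Lemma sqrt_4PIt (t : R) : 0 < t -> sqrt (4 * PI * t) = 2 * sqrt (PI * t).
Proof.
intros Ht; rewrite Rmult_assoc, sqrt_mult_alt by lra.
replace 4 with (2 * 2) by ring; now rewrite sqrt_square by lra.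
Qed.

Lemma sqrt_PIt_pos (t : R) : 0 < t -> 0 < sqrt (PI * t).
Proof. intros Ht; apply sqrt_lt_R0, Rmult_lt_0_compat; [apply PI_RGT_0 | exact Ht]. Qed.

Lemma heat_pos (t x : R) : 0 < t -> 0 < heat t x.
Proof.
intros Ht; unfold heat; apply Rmult_lt_0_compat; [| apply exp_pos].
apply Rinv_0_lt_compat; rewrite sqrt_4PIt by exact Ht.
assert (A := sqrt_PIt_pos t Ht); lra.
Qed.

Lemma lint_heat (t : R) : 0 < t -> lint (heat t) 1.
Proof.
intros Ht.
assert (HP := PI_RGT_0).
assert (S1 : 0 < sqrt t) by now apply sqrt_lt_R0.
assert (S2 : 0 < sqrt PI) by now apply sqrt_lt_R0.
assert (S3 : sqrt t * sqrt t = t) by (apply sqrt_sqrt; lra).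
assert (A := lint_affine gauss (/ (2 * sqrt t)) 0 (sqrt PI)
  ltac:(apply Rinv_0_lt_compat; lra) lint_gauss).
apply (lint_scal _ (/ sqrt PI)) in A.
rewrite Rinv_l in A by lra; revert A; apply lint_ext; intros x.
unfold heat, gauss; rewrite sqrt_4PIt, sqrt_mult by lra.
replace (- ((/ (2 * sqrt t) * x + 0) * (/ (2 * sqrt t) * x + 0)))
  with (- x ^ 2 / (4 * t)).
- field; lra.
- rewrite <- S3 at 1; field; lra.
Qed.

(* [hk n t] is the n-th space derivative of [heat t], generated by the
   three-term recurrence of the Hermite polynomials. *)
Fixpoint hk (n : nat) (t y : R) : R :=
  match n with
  | O => heat t y
  | S m => - (y * hk m t y +
              INR m * match m with O => 0 | S k => hk k t y end) / (2 * t)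
  end.

Lemma hk_SS (n : nat) (t y : R) :
  hk (S (S n)) t y = - (y * hk (S n) t y + INR (S n) * hk n t y) / (2 * t).
Proof. reflexivity. Qed.

Lemma hk_1 (t y : R) : hk 1 t y = - (y * heat t y) / (2 * t).
Proof. simpl; f_equal; ring. Qed.

Lemma nat_ind2 (P : nat -> Prop) :
  P O -> P (S O) -> (forall n, P n -> P (S n) -> P (S (S n))) -> forall n, P n.
Proof.
intros H0 H1 HS n; cut (P n /\ P (S n)); [tauto |].
induction n as [| n [A B]]; auto.
Qed.

Lemma heat_derive_x (t x : R) : 0 < t -> is_derive (heat t) x (hk 1 t x).
Proof.
intros Ht; rewrite hk_1; unfold heat; auto_derive; [exact I |].
assert (A := sqrt_PIt_pos t Ht).
rewrite sqrt_4PIt by exact Ht; unfold Rdiv; simpl pow; field; lra.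
Qed.

(** The product rule on [y * hk (S n) t y] yields one more copy of [hk (S n) t y], which raises the
    coefficient [n + 1] of the recurrence to [n + 2]. *)
Lemma hk_derive_x (n : nat) (t x : R) : 0 < t -> is_derive (hk n t) x (hk (S n) t x).
Proof.
intros Ht; revert n; apply nat_ind2.
- apply heat_derive_x, Ht.
- apply (is_derive_ext (fun y => - (y * heat t y) / (2 * t))).
  { intros y; now rewrite hk_1. }
  assert (D := heat_derive_x t x Ht).
  auto_derive; [repeat split; eexists; exact D |].
  replace (Derive (fun x => heat t x) x) with (hk 1 t x)
    by (symmetry; apply is_derive_unique, D).
  rewrite hk_SS; simpl (hk 0 _ _); simpl INR; field; lra.
- intros n D1 D2.
  apply (is_derive_ext (fun y => - (y * hk (S n) t y + INR (S n) * hk n t y) / (2 * t))).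
  { intros y; now rewrite hk_SS. }
  remember (hk (S n) t) as f; remember (hk n t) as g; remember (INR (S n)) as c.
  auto_derive; [repeat split; eexists; eassumption |].
  replace (Derive (fun x => f x) x) with (hk (S (S n)) t x)
    by (symmetry; apply is_derive_unique, D2).
  replace (Derive (fun x => g x) x) with (f x)
    by (symmetry; apply is_derive_unique, D1).
  rewrite (hk_SS (S n)), (S_INR (S n)), <- Heqf, <- Heqc; field; lra.
Qed.

Lemma hk_continuous (n : nat) (t x : R) : 0 < t -> continuous (hk n t) x.
Proof.
intros Ht; apply @ex_derive_continuous; eexists; now apply hk_derive_x.
Qed.

Lemma hk_derive_t (n : nat) (t x : R) :
  0 < t -> is_derive (fun s => hk n s x) t (hk (S (S n)) t x).
Proof.
intros Ht.
assert (D0 : is_derive (fun s => heat s x) t (hk 2 t x)).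
{ rewrite hk_SS, hk_1; simpl hk; simpl INR; unfold heat.
  assert (A := sqrt_PIt_pos t Ht).
  assert (HP := PI_RGT_0).
  assert (A2 : sqrt (PI * t) * sqrt (PI * t) = PI * t) by (apply sqrt_sqrt; nra).
  auto_derive.
  { rewrite sqrt_4PIt by exact Ht; repeat split; nra. }
  rewrite sqrt_4PIt by exact Ht; unfold Rdiv; simpl pow.
  set (s := sqrt (PI * t)) in *; set (e := exp _).
  replace (2 * s * (2 * s)) with (4 * (PI * t)) by (rewrite <- A2; ring).
  field; lra. }
revert n; apply nat_ind2.
- exact D0.
- apply (is_derive_ext (fun s => - (x * heat s x) / (2 * s))).
  { intros y; now rewrite hk_1. }
  auto_derive; [repeat split; [eexists; exact D0 | lra] |].
  replace (Derive (fun s => heat s x) t) with (hk 2 t x)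
    by (symmetry; apply is_derive_unique, D0).
  rewrite (hk_SS 1), hk_1; simpl INR; field; lra.
- intros n D1 D2.
  apply (is_derive_ext (fun s => - (x * hk (S n) s x + INR (S n) * hk n s x) / (2 * s))).
  { intros y; now rewrite hk_SS. }
  set (f := fun s => hk (S n) s x) in *; set (g := fun s => hk n s x) in *.
  change (is_derive (fun s => - (x * f s + INR (S n) * g s) / (2 * s)) t
    (hk (S (S (S (S n)))) t x)).
  remember (INR (S n)) as c.
  auto_derive; [repeat split; [eexists; exact D2 | eexists; exact D1 | lra] |].
  replace (Derive (fun s => f s) t) with (hk (S (S (S n))) t x)
    by (symmetry; apply is_derive_unique, D2).
  replace (Derive (fun s => g s) t) with (hk (S (S n)) t x)
    by (symmetry; apply is_derive_unique, D1).
  rewrite (hk_SS (S (S n))), (S_INR (S (S n))), (S_INR (S n)), <- Heqc.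
  (* Differentiating the denominator [2 * s] leaves the undifferentiated bracket, which the
     recurrence turns back into a multiple of a kernel. *)
  replace (x * f t + c * g t) with (- (2 * t) * hk (S (S n)) t x).
  2: { rewrite hk_SS, <- Heqc; unfold f, g; field; lra. }
  field; lra.
Qed.

Lemma exp_INR (n : nat) (x : R) : exp x ^ n = exp (INR n * x).
Proof.
induction n as [| n IH].
- now rewrite Rmult_0_l, exp_0.
- rewrite S_INR, Rmult_plus_distr_r, exp_plus, Rmult_1_l, <- IH; simpl; ring.
Qed.

(** [N] is kept apart from [n] so that [q = sqrt (N / (2 t))] stays fixed during the induction. As
    [q ^ 2] dominates every coefficient [(n + 1) / (2 t)] met on the way, the recurrence is
    controlled by [A ^ 2 = Rabs y / (2 t) * A + q * A], where [A = Rabs y / (2 t) + q]. *)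
Lemma hk_poly_bound (N n : nat) (t y : R) : 0 < t -> (n <= N)%nat ->
  Rabs (hk n t y) <= (Rabs y / (2 * t) + sqrt (INR N / (2 * t))) ^ n * heat t y.
Proof.
intros Ht; revert n.
assert (HP := heat_pos t y Ht).
set (q := sqrt (INR N / (2 * t))).
assert (Hq0 : 0 <= q) by apply sqrt_pos.
assert (Hi : 0 < / (2 * t)) by (apply Rinv_0_lt_compat; lra).
assert (Hq : q * q = INR N / (2 * t)).
{ apply sqrt_sqrt, Rmult_le_pos; [apply pos_INR | lra]. }
assert (Hy : 0 <= Rabs y) by apply Rabs_pos.
set (A := Rabs y / (2 * t) + q).
assert (HA : q <= A) by (unfold A, Rdiv; nra).
assert (Habs : forall a b m, Rabs (- (y * a + INR m * b) / (2 * t)) <=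
  Rabs y / (2 * t) * Rabs a + INR m / (2 * t) * Rabs b).
{ intros a b m; unfold Rdiv; rewrite Rabs_mult, Rabs_Ropp, (Rabs_right (/ (2 * t))) by lra.
  replace (Rabs y * / (2 * t) * Rabs a + INR m * / (2 * t) * Rabs b)
    with ((Rabs y * Rabs a + INR m * Rabs b) * / (2 * t)) by ring.
  apply Rmult_le_compat_r; [lra |].
  apply Rle_trans with (1 := Rabs_triang _ _); rewrite !Rabs_mult.
  rewrite (Rabs_right (INR m)); [lra | apply Rle_ge, pos_INR]. }
intros n; pattern n; apply nat_ind2; clear n.
- intros _; simpl; rewrite Rabs_right; lra.
- intros _; simpl hk; apply Rle_trans with (1 := Habs _ _ O); simpl INR.
  rewrite (Rabs_right (heat t y)) by lra; unfold A, Rdiv; simpl; nra.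
- intros n H1 H2 Hn; rewrite hk_SS.
  apply Rle_trans with (1 := Habs _ _ (S n)).
  specialize (H1 ltac:(lia)); specialize (H2 ltac:(lia)).
  assert (Hm : INR (S n) / (2 * t) <= q * A).
  { apply Rle_trans with (q * q); [| nra].
    rewrite Hq; apply Rmult_le_compat_r; [lra | apply le_INR; lia]. }
  assert (Hm0 : 0 <= INR (S n) / (2 * t)) by (apply Rmult_le_pos; [apply pos_INR | lra]).
  assert (Hy' : 0 <= Rabs y / (2 * t)) by (apply Rmult_le_pos; lra).
  assert (Hpow : 0 <= A ^ n) by (apply pow_le; lra).
  simpl pow in *.
  apply Rle_trans with (Rabs y / (2 * t) * (A * A ^ n * heat t y)
                        + q * A * (A ^ n * heat t y)).
  + apply Rplus_le_compat; [apply Rmult_le_compat_l; assumption |].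
    apply Rmult_le_compat; auto; apply Rabs_pos.
  + right; unfold A; ring.
Qed.

(** The factors [exp 1 * exp 1 ^ n] make up [exp (n + 1)], the price of absorbing the polynomial
    into half of the Gaussian exponent; [sqrt 2] is the ratio of the normalisations of [heat t] and
    [heat (2 * t)]. *)
Definition hkM (n : nat) (t : R) : R :=
  sqrt 2 * exp 1 * (exp 1 * sqrt (INR (S n) / (2 * t))) ^ n.

Lemma hkM_pos (n : nat) (t : R) : 0 < t -> 0 < hkM n t.
Proof.
intros Ht; unfold hkM.
assert (A := exp_pos 1).
assert (B : 0 < sqrt 2) by (apply sqrt_lt_R0; lra).
assert (C : 0 < sqrt (INR (S n) / (2 * t))).
{ apply sqrt_lt_R0, Rdiv_lt_0_compat; [apply lt_0_INR; lia | lra]. }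
apply Rmult_lt_0_compat; [nra | apply pow_lt; nra].
Qed.

Lemma hkM_decr (n : nat) (s t : R) : 0 < s -> s <= t -> hkM n t <= hkM n s.
Proof.
intros Hs Hst; unfold hkM.
assert (A := exp_pos 1); assert (B := sqrt_pos 2).
apply Rmult_le_compat_l; [nra |].
apply pow_incr; split; [apply Rmult_le_pos; [lra | apply sqrt_pos] |].
apply Rmult_le_compat_l; [lra |].
apply sqrt_le_1_alt, Rmult_le_compat_l; [apply pos_INR |].
apply Rinv_le_contravar; lra.
Qed.

Lemma heat_double (t y : R) : 0 < t ->
  heat t y * exp (y ^ 2 / (8 * t)) = sqrt 2 * heat (2 * t) y.
Proof.
intros Ht; unfold heat; rewrite Rmult_assoc, <- exp_plus.
assert (HP := PI_RGT_0).
replace (4 * PI * (2 * t)) with (2 * (4 * PI * t)) by ring.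
assert (H2 : 0 < sqrt 2) by (apply sqrt_lt_R0; lra).
assert (H3 : 0 < sqrt (4 * PI * t)) by (apply sqrt_lt_R0; nra).
rewrite (sqrt_mult_alt 2) by lra.
replace (- y ^ 2 / (4 * t) + y ^ 2 / (8 * t)) with (- y ^ 2 / (4 * (2 * t)))
  by (field; lra).
field; lra.
Qed.

(* The polynomial factor is absorbed by AM-GM:
   with [q = sqrt ((n+1)/(2t))], [q |y| <= y^2/(8t) + 2 t q^2]. *)
Lemma hk_bound (n : nat) (t y : R) : 0 < t ->
  Rabs (hk n t y) <= hkM n t * heat (2 * t) y.
Proof.
intros Ht.
apply Rle_trans with (1 := hk_poly_bound (S n) n t y Ht ltac:(lia)).
unfold hkM.
assert (Hi : 0 < / (2 * t)) by (apply Rinv_0_lt_compat; lra).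
assert (Hn : 0 < INR (S n)) by (apply lt_0_INR; lia).
assert (Hq0 : 0 < sqrt (INR (S n) / (2 * t))).
{ apply sqrt_lt_R0, Rdiv_lt_0_compat; lra. }
assert (Hq : sqrt (INR (S n) / (2 * t)) * sqrt (INR (S n) / (2 * t)) = INR (S n) / (2 * t)).
{ apply sqrt_sqrt, Rlt_le, Rdiv_lt_0_compat; lra. }
set (q := sqrt (INR (S n) / (2 * t))) in *.
assert (Hy : 0 <= Rabs y) by apply Rabs_pos.
(* Factoring out [q] and using [1 + z <= exp z] replaces the power by an exponential linear in
   [Rabs y]. *)
assert (H1 : (Rabs y / (2 * t) + q) ^ n <= q ^ n * exp (INR n * (Rabs y / (2 * t * q)))).
{ rewrite <- exp_INR, <- Rpow_mult_distr; apply pow_incr; split.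
  - apply Rplus_le_le_0_compat; [apply Rmult_le_pos |]; lra.
  - replace (Rabs y / (2 * t) + q) with (q * (1 + Rabs y / (2 * t * q))) by (field; lra).
    apply Rmult_le_compat_l; [lra | apply exp_ineq1_le]. }
assert (H2 : INR n * (Rabs y / (2 * t * q)) <= y ^ 2 / (8 * t) + INR (S n)).
{ assert (E : INR (S n) = 2 * t * (q * q)) by (rewrite Hq; field; lra).
  apply Rle_trans with (q * Rabs y).
  - apply Rle_trans with (INR (S n) * (Rabs y / (2 * t * q))).
    + apply Rmult_le_compat_r; [| apply le_INR; lia].
      apply Rmult_le_pos; [lra |]; apply Rlt_le, Rinv_0_lt_compat; nra.
    + rewrite E; right; field; lra.
  - rewrite E, <- (pow2_abs y).
    apply Rmult_le_reg_r with (8 * t); [lra |].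
    replace ((Rabs y ^ 2 / (8 * t) + 2 * t * (q * q)) * (8 * t))
      with (Rabs y ^ 2 + (4 * t * q) ^ 2) by (field; lra).
    assert (A := pow2_ge_0 (Rabs y - 4 * t * q)); nra. }
assert (HT := heat_pos t y Ht).
assert (Hqn : 0 < q ^ n) by now apply pow_lt.
apply Rle_trans with (q ^ n * exp (y ^ 2 / (8 * t) + INR (S n)) * heat t y).
- apply Rmult_le_compat_r; [lra |].
  apply Rle_trans with (1 := H1); apply Rmult_le_compat_l; [lra |].
  destruct H2 as [H2 | ->]; [left; now apply exp_increasing | right; reflexivity].
- right; rewrite exp_plus, Rpow_mult_distr.
  replace (exp (INR (S n))) with (exp 1 * exp 1 ^ n).
  + transitivity (q ^ n * (exp 1 * exp 1 ^ n) * (heat t y * exp (y ^ 2 / (8 * t)))); [ring |].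
    rewrite heat_double by exact Ht; ring.
  + rewrite exp_INR, <- exp_plus; f_equal; rewrite S_INR; ring.
Qed.

(** Completing the square: [2 (y + s) ^ 2 - y ^ 2 = (y + 2 s) ^ 2 - 2 s ^ 2], which is at least
    [- 2]. Gaussians at all points near [y] are thus dominated by a single one at [y], of doubled
    time. *)
Lemma heat_shift_le (t y s : R) : 0 < t -> Rabs s <= 1 ->
  heat (2 * t) (y + s) <= sqrt 2 * exp (/ (8 * t)) * heat (2 * (2 * t)) y.
Proof.
intros Ht Hs; apply Rabs_le_between in Hs.
assert (E := heat_double (2 * t) y ltac:(lra)).
replace (sqrt 2 * exp (/ (8 * t)) * heat (2 * (2 * t)) y)
  with (exp (/ (8 * t)) * (sqrt 2 * heat (2 * (2 * t)) y)) by ring.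
rewrite <- E; unfold heat.
set (c := / sqrt _).
assert (Hc : 0 < c).
{ apply Rinv_0_lt_compat, sqrt_lt_R0; assert (HP := PI_RGT_0); nra. }
replace (exp (/ (8 * t)) * (c * exp (- y ^ 2 / (4 * (2 * t))) * exp (y ^ 2 / (8 * (2 * t)))))
  with (c * (exp (/ (8 * t)) * exp (- y ^ 2 / (4 * (2 * t))) * exp (y ^ 2 / (8 * (2 * t))))) by ring.
apply Rmult_le_compat_l; [lra |].
rewrite <- !exp_plus.
assert (H : - (y + s) ^ 2 / (4 * (2 * t)) <=
  / (8 * t) + - y ^ 2 / (4 * (2 * t)) + y ^ 2 / (8 * (2 * t))).
{ apply Rmult_le_reg_r with (16 * t); [lra |].
  replace (- (y + s) ^ 2 / (4 * (2 * t)) * (16 * t)) with (- 2 * (y + s) ^ 2) by (field; lra).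
  replace ((/ (8 * t) + - y ^ 2 / (4 * (2 * t)) + y ^ 2 / (8 * (2 * t))) * (16 * t))
    with (2 - y ^ 2) by (field; lra).
  assert (A := pow2_ge_0 (y + 2 * s)); nra. }
destruct H as [H | ->]; [left; now apply exp_increasing | right; reflexivity].
Qed.

(** The lower bound on [s] controls the normalising factor and costs the constant 2; the upper bound
    controls the exponent. *)
Lemma heat_time_le (t s y : R) : 0 < t -> t / 2 <= s <= 2 * t ->
  heat (2 * s) y <= 2 * heat (2 * (2 * t)) y.
Proof.
intros Ht Hs; unfold heat.
assert (HP := PI_RGT_0).
replace (2 * (/ sqrt (4 * PI * (2 * (2 * t))) * exp (- y ^ 2 / (4 * (2 * (2 * t))))))
  with ((2 * / sqrt (4 * PI * (2 * (2 * t)))) * exp (- y ^ 2 / (4 * (2 * (2 * t))))) by ring.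
apply Rmult_le_compat.
- apply Rlt_le, Rinv_0_lt_compat, sqrt_lt_R0; nra.
- apply Rlt_le, exp_pos.
- replace (4 * PI * (2 * (2 * t))) with (2 * 2 * (4 * PI * t)) by ring.
  rewrite (sqrt_mult_alt (2 * 2)), sqrt_square by lra.
  replace (2 * / (2 * sqrt (4 * PI * t))) with (/ sqrt (4 * PI * t)).
  + apply Rinv_le_contravar; [apply sqrt_lt_R0; nra |].
    apply sqrt_le_1_alt; nra.
  + field; apply Rgt_not_eq, sqrt_lt_R0; nra.
- assert (H : - y ^ 2 / (4 * (2 * s)) <= - y ^ 2 / (4 * (2 * (2 * t)))).
  { unfold Rdiv; rewrite <- !Ropp_mult_distr_l; apply Ropp_le_contravar.
    apply Rmult_le_compat_l; [apply pow2_ge_0 |].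
    apply Rinv_le_contravar; lra. }
  destruct H as [H | ->]; [left; now apply exp_increasing | right; reflexivity].
Qed.

Lemma taylor2_bound (f f1 f2 : R -> R) (a h M : R) :
  (forall x, Rabs (x - a) <= Rabs h -> is_derive f x (f1 x)) ->
  (forall x, Rabs (x - a) <= Rabs h -> is_derive f1 x (f2 x)) ->
  (forall x, Rabs (x - a) <= Rabs h -> Rabs (f2 x) <= M) ->
  Rabs (f (a + h) - f a - h * f1 a) <= M * h ^ 2.
Proof.
intros D1 D2 HM.
destruct (MVT_cor4 f f1 a (Rabs h) D1 (a + h)) as [c [E1 Hc]].
{ right; f_equal; ring. }
replace (a + h - a) with h in * by ring.
destruct (MVT_cor4 f1 f2 a (Rabs h) D2 c Hc) as [d [E2 Hd]].
rewrite E1.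
replace (f1 c * h - h * f1 a) with ((f1 c - f1 a) * h) by ring.
rewrite E2, !Rabs_mult, <- pow2_abs.
assert (B := HM d ltac:(lra)).
assert (P := Rabs_pos (f2 d)); assert (P1 := Rabs_pos (c - a)); assert (P2 := Rabs_pos h).
apply Rle_trans with (M * Rabs h * Rabs h); [| right; ring].
apply Rmult_le_compat_r; [lra |]; apply Rmult_le_compat; lra.
Qed.

(** The bound is integrable in [y], and [h] enters it only through [h ^ 2]: this is what
    differentiation under the integral sign requires. *)
Lemma hk_taylor_x (n : nat) (t y h : R) : 0 < t -> Rabs h <= 1 ->
  Rabs (hk n t (y + h) - hk n t y - h * hk (S n) t y) <=
  hkM (S (S n)) t * (sqrt 2 * exp (/ (8 * t))) * heat (2 * (2 * t)) y * h ^ 2.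
Proof.
intros Ht Hh; apply (taylor2_bound _ (hk (S n) t) (hk (S (S n)) t)).
- intros; now apply hk_derive_x.
- intros; now apply hk_derive_x.
- intros x Hx; apply Rle_trans with (1 := hk_bound _ _ _ Ht).
  rewrite Rmult_assoc; apply Rmult_le_compat_l; [apply Rlt_le, hkM_pos, Ht |].
  replace x with (y + (x - y)) at 1 by ring; apply heat_shift_le; lra.
Qed.

Lemma hk_taylor_t (n : nat) (t y h : R) : 0 < t -> Rabs h <= t / 2 ->
  Rabs (hk n (t + h) y - hk n t y - h * hk (S (S n)) t y) <=
  hkM (S (S (S (S n)))) (t / 2) * 2 * heat (2 * (2 * t)) y * h ^ 2.
Proof.
intros Ht Hh.
(* Intermediate times stay in a range where one constant and one Gaussian serve for all of them. *)
assert (Hp : forall x, Rabs (x - t) <= Rabs h -> t / 2 <= x <= 2 * t).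
{ intros x Hx; assert (A := Rle_trans _ _ _ Hx Hh); apply Rabs_le_between in A; lra. }
apply (taylor2_bound (fun s => hk n s y) (fun s => hk (S (S n)) s y)
        (fun s => hk (S (S (S (S n)))) s y)).
- intros x Hx; apply Hp in Hx; apply hk_derive_t; lra.
- intros x Hx; apply Hp in Hx; apply hk_derive_t; lra.
- intros x Hx; apply Hp in Hx.
  apply Rle_trans with (1 := hk_bound _ x _ ltac:(lra)).
  rewrite Rmult_assoc; apply Rmult_le_compat.
  + apply Rlt_le, hkM_pos; lra.
  + apply Rlt_le, heat_pos; lra.
  + apply hkM_decr; lra.
  + now apply heat_time_le.
Qed.

(** * Smoothing a bounded continuous function *)

Lemma heat_le_inv (t y : R) : 0 < t -> 1 <= Rabs y ->
  heat t y <= / sqrt (4 * PI * t) * (4 * t) / Rabs y.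
Proof.
intros Ht Hy; unfold heat, Rdiv; rewrite (Rmult_assoc (/ sqrt _)).
assert (HP := PI_RGT_0).
apply Rmult_le_compat_l; [apply Rlt_le, Rinv_0_lt_compat, sqrt_lt_R0; nra |].
replace (- y ^ 2 * / (4 * t)) with (- (y ^ 2 / (4 * t))) by (unfold Rdiv; ring).
rewrite exp_Ropp.
replace (4 * t * / Rabs y) with (/ (Rabs y / (4 * t))) by (field; lra).
apply Rinv_le_contravar; [apply Rdiv_lt_0_compat; lra |].
apply Rle_trans with (y ^ 2 / (4 * t)).
- apply Rmult_le_compat_r; [apply Rlt_le, Rinv_0_lt_compat; lra |].
  rewrite <- pow2_abs; nra.
- assert (A := exp_ineq1_le (y ^ 2 / (4 * t))); lra.
Qed.

Lemma heat_small (t eps : R) : 0 < t -> 0 < eps ->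
  exists M, 0 < M /\ forall y, M < Rabs y -> heat t y < eps.
Proof.
intros Ht He; assert (HP := PI_RGT_0).
set (c := / sqrt (4 * PI * t) * (4 * t)).
assert (Hc : 0 < c).
{ apply Rmult_lt_0_compat; [apply Rinv_0_lt_compat, sqrt_lt_R0; nra | lra]. }
exists (Rmax 1 (c / eps)); split; [apply Rlt_le_trans with (2 := Rmax_l _ _); lra |].
intros y Hy; assert (A := Rmax_l 1 (c / eps)); assert (B := Rmax_r 1 (c / eps)).
apply Rle_lt_trans with (1 := heat_le_inv t y Ht ltac:(lra)); fold c.
apply Rlt_div_l; [lra |].
replace c with (c / eps * eps) by (field; lra).
rewrite (Rmult_comm eps); apply Rmult_lt_compat_r; lra.
Qed.

Lemma hk_small (n : nat) (t eps : R) : 0 < t -> 0 < eps ->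
  exists M, 0 < M /\ forall y, M < Rabs y -> Rabs (hk n t y) < eps.
Proof.
intros Ht He; assert (HM := hkM_pos n t Ht).
destruct (heat_small (2 * t) (eps / hkM n t)) as [M [HM0 HM1]];
  [lra | now apply Rdiv_lt_0_compat |].
exists M; split; [exact HM0 |]; intros y Hy.
apply Rle_lt_trans with (1 := hk_bound n t y Ht).
specialize (HM1 y Hy); apply (Rmult_lt_compat_l (hkM n t)) in HM1; [| exact HM].
replace (hkM n t * (eps / hkM n t)) with eps in HM1 by (field; lra); exact HM1.
Qed.

Lemma hk_lim (n : nat) (t : R) : 0 < t ->
  is_lim (hk n t) p_infty 0 /\ is_lim (hk n t) m_infty 0.
Proof.
intros Ht; rewrite is_lim_pinfty_spec, is_lim_minfty_spec; split; intros eps He;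
  destruct (hk_small n t eps Ht He) as [M [HM0 HM]].
- exists M; intros x Hx; rewrite Rminus_0_r; apply HM; rewrite Rabs_right; lra.
- exists (- M); intros x Hx; rewrite Rminus_0_r; apply HM; rewrite Rabs_left; lra.
Qed.

Lemma lint_hk_S (n : nat) (t : R) : 0 < t -> lint (hk (S n) t) 0.
Proof.
intros Ht; exists (hk n t); destruct (hk_lim n t Ht) as [A B]; split; [| split; assumption].
intros x; now apply hk_derive_x.
Qed.

(** At order 2 the recurrence reads [y ^ 2 * Theta = 4 t ^ 2 * Theta'' + 2 t * Theta], and [Theta'']
    has integral 0. *)
Lemma lint_heat_sqr (t : R) : 0 < t -> lint (fun y => y ^ 2 * heat t y) (2 * t).
Proof.
intros Ht; assert (A := lint_lin _ _ (4 * t ^ 2) (2 * t) _ _ (lint_hk_S 1 t Ht) (lint_heat t Ht)).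
replace (2 * t) with (4 * t ^ 2 * 0 + 2 * t * 1) by ring.
revert A; apply lint_ext; intros y.
rewrite hk_SS, hk_1; simpl hk; simpl INR; field; lra.
Qed.

Lemma heat_even (t y : R) : heat t (- y) = heat t y.
Proof. unfold heat; do 2 f_equal; f_equal; ring. Qed.

Lemma hk1_odd (t y : R) : hk 1 t (- y) = - hk 1 t y.
Proof. rewrite !hk_1, heat_even; unfold Rdiv; ring. Qed.

Lemma heat_0 (t : R) : 0 < t -> heat t 0 = / (2 * sqrt (PI * t)).
Proof.
intros Ht; unfold heat; rewrite sqrt_4PIt by exact Ht.
replace (- 0 ^ 2 / (4 * t)) with 0 by (field; lra); rewrite exp_0; ring.
Qed.

(** This is the total variation of [heat t], twice its peak. The primitive [G] follows [heat t] up
    to 0 and afterwards its mirror image in the level [heat t 0]; the pieces join differentiably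
    because the slope at 0 vanishes. *)
Lemma lint_abs_hk1 (t : R) : 0 < t ->
  lint (fun y => Rabs (hk 1 t y)) (/ sqrt (PI * t)).
Proof.
intros Ht; assert (HS := sqrt_PIt_pos t Ht).
replace (/ sqrt (PI * t)) with (2 * heat t 0) by (rewrite heat_0 by exact Ht; field; lra).
assert (Hi : 0 < / (2 * t)) by (apply Rinv_0_lt_compat; lra).
destruct (hk_lim 0 t Ht) as [Lp Lm].
set (G := fun y => if Rle_dec y 0 then heat t y else 2 * heat t 0 - heat t y).
assert (Gneg : forall y, y <= 0 -> G y = heat t y).
{ intros y Hy; unfold G; destruct (Rle_dec y 0); [reflexivity | lra]. }
assert (Gpos : forall y, 0 <= y -> G y = 2 * heat t 0 - heat t y).
{ intros y Hy; unfold G; destruct (Rle_dec y 0); [| reflexivity].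
  replace y with 0 by lra; ring. }
exists G; split; [| split].
- intros x; assert (HD := hk_derive_x 0 t x Ht).
  assert (Hh := heat_pos t x Ht).
  destruct (Rtotal_order x 0) as [Hx | [-> | Hx]].
  + apply (is_derive_ext_loc (heat t)).
    { apply (filter_imp (fun y => y < 0)); [| now apply locally_interval with m_infty 0].
      intros y Hy; now rewrite Gneg by lra. }
    assert (0 < - x * heat t x * / (2 * t))
      by (apply Rmult_lt_0_compat; [apply Rmult_lt_0_compat; lra | exact Hi]).
    rewrite Rabs_right; [exact HD |]; rewrite hk_1; unfold Rdiv; lra.
  + rewrite hk_1; replace (- (0 * heat t 0) / (2 * t)) with 0 by (field; lra); rewrite Rabs_R0.
    rewrite hk_1 in HD; replace (- (0 * heat t 0) / (2 * t)) with 0 in HD by (field; lra).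
    apply is_derive_Reals; apply is_derive_Reals in HD.
    intros eps He; destruct (HD eps He) as [d Hd]; exists d; intros h Hh0 Hhd.
    specialize (Hd h Hh0 Hhd); rewrite Rplus_0_l, Rminus_0_r in *; simpl hk in Hd.
    rewrite (Gneg 0) by lra.
    destruct (Rle_dec h 0) as [H | H].
    * rewrite Gneg by exact H; exact Hd.
    * rewrite Gpos by lra.
      replace ((2 * heat t 0 - heat t h - heat t 0) / h)
        with (- ((heat t h - heat t 0) / h)) by (field; lra).
      rewrite Rabs_Ropp; exact Hd.
  + apply (is_derive_ext_loc (fun y => 1 * (2 * heat t 0) + (-1) * heat t y)).
    { apply (filter_imp (fun y => 0 < y)); [| now apply locally_interval with 0 p_infty].
      intros y Hy; rewrite Gpos by lra; simpl; lra. }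
    eapply is_derive_val.
    * apply is_derive_lin; [apply @is_derive_const | exact HD].
    * assert (0 < x * heat t x * / (2 * t))
      by (apply Rmult_lt_0_compat; [apply Rmult_lt_0_compat; lra | exact Hi]).
      rewrite Rabs_left; [unfold zero; simpl; ring |].
      rewrite hk_1; unfold Rdiv; lra.
- apply (is_lim_ext_loc (heat t)); [| exact Lm].
  exists 0; intros y Hy; now rewrite Gneg by lra.
- apply (is_lim_ext_loc (fun y => 1 * (2 * heat t 0) + (-1) * heat t y)).
  { exists 0; intros y Hy; rewrite Gpos by lra; ring. }
  eapply is_lim_val; [apply is_lim_lin; [apply is_lim_const | exact Lp] | ring].
Qed.

Lemma quadratic_error_derive (f : R -> R) (x l r C : R) : 0 < r ->
  (forall h, Rabs h <= r -> Rabs (f (x + h) - f x - h * l) <= C * h ^ 2) ->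
  is_derive f x l.
Proof.
intros Hr H; apply is_derive_Reals; intros eps He.
assert (HC := Rabs_pos C).
assert (Hd : 0 < Rmin r (eps / (Rabs C + 1))).
{ apply Rmin_glb_lt; [exact Hr | apply Rdiv_lt_0_compat; lra]. }
exists (mkposreal _ Hd); simpl; intros h Hh0 Hh.
assert (A1 := Rlt_le_trans _ _ _ Hh (Rmin_l _ _)).
assert (A2 := Rlt_le_trans _ _ _ Hh (Rmin_r _ _)).
specialize (H h ltac:(lra)).
assert (Hp : 0 < Rabs h) by now apply Rabs_pos_lt.
replace ((f (x + h) - f x) / h - l) with ((f (x + h) - f x - h * l) / h) by (field; exact Hh0).
unfold Rdiv; rewrite Rabs_mult, Rabs_inv; apply Rlt_div_l; [exact Hp |].
apply Rle_lt_trans with (1 := H); rewrite <- pow2_abs.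
apply Rlt_div_r in A2; [| lra].
assert (C <= Rabs C) by apply Rle_abs.
nra.
Qed.

Definition bounded_continuous (F : R -> R) (B : R) : Prop :=
  (forall x, continuous F x) /\ (forall x, Rabs (F x) <= B).

Lemma bounded_continuous_pos (F : R -> R) (B : R) : bounded_continuous F B -> 0 <= B.
Proof. intros [_ H]; apply Rle_trans with (2 := H 0), Rabs_pos. Qed.

(* [U F n t] is the n-th derivative of [F * Theta_t]; thus [U F 1 t] is [f * Theta_t]
   for the distribution [f] with primitive [F]. *)
Definition U (F : R -> R) (n : nat) (t x : R) : R :=
  epsilon (inhabits 0) (lint (fun xi => F xi * hk n t (x - xi))).

Lemma reflect_continuous (f : R -> R) (x y : R) :
  (forall z, continuous f z) -> continuous (fun y => f (x - y)) y.
Proof.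
intros H; apply (continuous_comp (fun y => x - y) f); [| apply H].
apply @ex_derive_continuous; auto_derive; exact I.
Qed.

Section Smoothing.
Context (F : R -> R) (B : R) (HF : bounded_continuous F B).

Let HB : 0 <= B := bounded_continuous_pos F B HF.

Lemma U_integrand_continuous (n : nat) (t x y : R) : 0 < t ->
  continuous (fun xi => F xi * hk n t (x - xi)) y.
Proof.
intros Ht; apply @continuous_mult; [apply HF |].
apply reflect_continuous; intros z; now apply hk_continuous.
Qed.

Lemma U_spec (n : nat) (t x : R) : 0 < t ->
  lint (fun xi => F xi * hk n t (x - xi)) (U F n t x).
Proof.
intros Ht; unfold U; apply epsilon_spec.
apply (lint_exists _ (fun y => B * hkM n t * heat (2 * t) (x - y)) (B * hkM n t * 1)).
- intros; now apply U_integrand_continuous.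
- apply lint_scal, lint_reflect, lint_heat; lra.
- intros y; rewrite Rabs_mult, Rmult_assoc; apply Rmult_le_compat.
  + apply Rabs_pos. + apply Rabs_pos. + apply HF. + now apply hk_bound.
Qed.

Lemma U_eq (n : nat) (t x v : R) : 0 < t ->
  lint (fun xi => F xi * hk n t (x - xi)) v -> U F n t x = v.
Proof. intros Ht H; exact (lint_unique _ _ _ (U_spec n t x Ht) H). Qed.

Lemma U_spec_translate (n : nat) (t x : R) : 0 < t ->
  lint (fun y => F (x - y) * hk n t y) (U F n t x).
Proof.
intros Ht; assert (A := lint_reflect _ x _ (U_spec n t x Ht)).
revert A; apply lint_ext; intros y; do 2 f_equal; ring.
Qed.

Lemma U_bound (n : nat) (t x : R) : 0 < t -> Rabs (U F n t x) <= B * hkM n t.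
Proof.
intros Ht; rewrite <- (Rmult_1_r (B * hkM n t)).
apply (lint_abs_le _ _ _ _ (U_spec_translate n t x Ht)
        (lint_scal _ (B * hkM n t) _ (lint_heat (2 * t) ltac:(lra)))).
intros y; rewrite Rabs_mult, Rmult_assoc; apply Rmult_le_compat.
+ apply Rabs_pos. + apply Rabs_pos. + apply HF. + now apply hk_bound.
Qed.

Lemma U_derive_x (n : nat) (t x : R) : 0 < t -> is_derive (U F n t) x (U F (S n) t x).
Proof.
intros Ht.
apply (quadratic_error_derive _ _ _ 1
  (B * (hkM (S (S n)) t * (sqrt 2 * exp (/ (8 * t))))) Rlt_0_1); intros h Hh.
assert (L := lint_minus _ _ _ _ (lint_minus _ _ _ _ (U_spec n t (x + h) Ht) (U_spec n t x Ht))
  (lint_scal _ h _ (U_spec (S n) t x Ht))).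
set (M := hkM (S (S n)) t * (sqrt 2 * exp (/ (8 * t)))).
replace (B * M * h ^ 2) with (B * M * h ^ 2 * 1) by ring.
apply (lint_abs_le _ _ _ _ L
  (lint_scal _ _ _ (lint_reflect _ x _ (lint_heat (2 * (2 * t)) ltac:(lra))))).
intros xi.
replace (F xi * hk n t (x + h - xi) - F xi * hk n t (x - xi) - h * (F xi * hk (S n) t (x - xi)))
  with (F xi * (hk n t (x - xi + h) - hk n t (x - xi) - h * hk (S n) t (x - xi)))
  by (replace (x - xi + h) with (x + h - xi) by ring; ring).
rewrite Rabs_mult.
replace (B * M * h ^ 2 * heat (2 * (2 * t)) (x - xi))
  with (B * (M * heat (2 * (2 * t)) (x - xi) * h ^ 2)) by ring.
apply Rmult_le_compat; [apply Rabs_pos | apply Rabs_pos | apply HF | now apply hk_taylor_x].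
Qed.

Lemma U_derive_t (n : nat) (t x : R) : 0 < t ->
  is_derive (fun s => U F n s x) t (U F (S (S n)) t x).
Proof.
intros Ht.
apply (quadratic_error_derive _ _ _ (t / 2)
  (B * (hkM (S (S (S (S n)))) (t / 2) * 2))); [lra |]; intros h Hh.
assert (Hth : 0 < t + h) by (apply Rabs_le_between in Hh; lra).
assert (L := lint_minus _ _ _ _ (lint_minus _ _ _ _ (U_spec n (t + h) x Hth) (U_spec n t x Ht))
  (lint_scal _ h _ (U_spec (S (S n)) t x Ht))).
set (M := hkM (S (S (S (S n)))) (t / 2) * 2).
replace (B * M * h ^ 2) with (B * M * h ^ 2 * 1) by ring.
apply (lint_abs_le _ _ _ _ L
  (lint_scal _ _ _ (lint_reflect _ x _ (lint_heat (2 * (2 * t)) ltac:(lra))))).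
intros xi; set (y := x - xi).
replace (F xi * hk n (t + h) y - F xi * hk n t y - h * (F xi * hk (S (S n)) t y))
  with (F xi * (hk n (t + h) y - hk n t y - h * hk (S (S n)) t y)) by ring.
rewrite Rabs_mult.
replace (B * M * h ^ 2 * heat (2 * (2 * t)) y)
  with (B * (M * heat (2 * (2 * t)) y * h ^ 2)) by ring.
apply Rmult_le_compat; [apply Rabs_pos | apply Rabs_pos | apply HF | now apply hk_taylor_t].
Qed.

Lemma U_continuous_x (n : nat) (t x : R) : 0 < t -> continuous (U F n t) x.
Proof. intros Ht; apply @ex_derive_continuous; eexists; now apply U_derive_x. Qed.

(** Move first in [x] at the new time [t'], then in time. The two Lipschitz constants bound
    [U F (S n)] and [U F (S (S n))] at all times from [t / 2] on, since [hkM] decreases in time. *)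
Lemma U_continuous2 (n : nat) (t x : R) : 0 < t ->
  continuous (fun p : R * R => U F n (snd p) (fst p)) (x, t).
Proof.
intros Ht.
set (L1 := B * hkM (S n) (t / 2)); set (L2 := B * hkM (S (S n)) (t / 2)).
assert (H1 : 0 <= L1) by (apply Rmult_le_pos; [exact HB | apply Rlt_le, hkM_pos; lra]).
assert (H2 : 0 <= L2) by (apply Rmult_le_pos; [exact HB | apply Rlt_le, hkM_pos; lra]).
apply filterlim_locally; intros [eps He].
assert (Hd : 0 < Rmin (t / 2) (eps / (L1 + L2 + 1))).
{ apply Rmin_glb_lt; [lra | apply Rdiv_lt_0_compat; lra]. }
exists (mkposreal _ Hd); intros [x' t'] [Bx Bt]; simpl in *.
unfold ball in *; simpl in *; unfold AbsRing_ball, abs, minus, plus, opp in *; simpl in *.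
set (d := Rmin _ _) in *.
assert (D1 : d <= t / 2) by apply Rmin_l.
assert (D2 : d * (L1 + L2 + 1) <= eps) by (apply Rle_div_r; [lra | apply Rmin_r]).
assert (Ht' : t / 2 <= t') by (apply Rabs_def2 in Bt; lra).
assert (E1 : Rabs (U F n t' x' - U F n t' x) <= L1 * Rabs (x' - x)).
{ destruct (mvt (U F n t') (U F (S n) t') x x') as [c [_ ->]].
  - intros; apply U_derive_x; lra.
  - rewrite Rabs_mult; apply Rmult_le_compat_r; [apply Rabs_pos |].
    apply Rle_trans with (1 := U_bound (S n) t' c ltac:(lra)).
    apply Rmult_le_compat_l; [exact HB | apply hkM_decr; lra]. }
assert (E2 : Rabs (U F n t' x - U F n t x) <= L2 * Rabs (t' - t)).
{ assert (Hm : t / 2 <= Rmin t t') by (apply Rmin_glb; lra).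
  destruct (mvt (fun s => U F n s x) (fun s => U F (S (S n)) s x) t t') as [c [Hc ->]].
  - intros s Hs; apply U_derive_t; lra.
  - rewrite Rabs_mult; apply Rmult_le_compat_r; [apply Rabs_pos |].
    apply Rle_trans with (1 := U_bound (S (S n)) c x ltac:(lra)).
    apply Rmult_le_compat_l; [exact HB | apply hkM_decr; lra]. }
replace (U F n t' x' + - U F n t x)
  with (U F n t' x' - U F n t' x + (U F n t' x - U F n t x)) by ring.
apply Rle_lt_trans with (1 := Rabs_triang _ _).
unfold Rminus in *.
assert (P1 := Rabs_pos (x' + - x)); assert (P2 := Rabs_pos (t' + - t)).
nra.
Qed.

(** [A] and [e] do not depend on [x], so sliding the window around [x] to either end of the line
    gives both limits. In the uses [J] is 1 for the kernel itself and 0 for its derivative. *)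
Lemma U_near (n : nat) (t l J eps : R) : 0 < t -> 0 < eps -> lint (hk n t) J ->
  exists A e, 0 < A /\ 0 < e /\ forall x,
    (forall y, - A <= y <= A -> Rabs (F (x - y) - l) <= e) ->
    Rabs (U F n t x - l * J) < eps.
Proof.
intros Ht He HJ.
assert (HM := hkM_pos n t Ht).
assert (Hl := Rabs_pos l).
set (e := eps / (4 * hkM n t)).
assert (He' : 0 < e) by (apply Rdiv_lt_0_compat; lra).
assert (Hh := lint_heat (2 * t) ltac:(lra)).
destruct (lint_dominated_small _ _ _ _ (eps / 4)
  (lint_scal _ ((B + Rabs l) * hkM n t) _ Hh)
  (lint_scal _ (e * hkM n t) _ Hh)) as [A [HA0 HA]].
{ intros x; apply Rmult_le_pos; [nra | apply Rlt_le, heat_pos; lra]. }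
{ lra. }
exists A, e; split; [exact HA0 |]; split; [exact He' |]; intros x Hx.
assert (L := lint_minus _ _ _ _ (U_spec_translate n t x Ht) (lint_scal _ l _ HJ)).
apply Rle_lt_trans with (e * hkM n t * 1 + eps / 4).
2: { unfold e; replace (eps / (4 * hkM n t) * hkM n t) with (eps / 4) by (field; lra); lra. }
assert (Hf : forall y, F (x - y) * hk n t y - l * hk n t y = (F (x - y) - l) * hk n t y)
  by (intros; ring).
apply (HA _ _ L); intros y; [| intros Hy]; rewrite Hf, Rabs_mult, Rmult_assoc;
  apply Rmult_le_compat; try apply Rabs_pos; try (now apply hk_bound).
- apply Rle_trans with (1 := Rabs_triang _ _); rewrite Rabs_Ropp.
  apply Rplus_le_compat_r, HF.
- now apply Hx.
Qed.

Lemma U_lim_pinfty (n : nat) (t l J : R) : 0 < t -> lint (hk n t) J ->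
  is_lim F p_infty l -> is_lim (U F n t) p_infty (l * J).
Proof.
intros Ht HJ Hl; apply is_lim_pinfty_spec; intros eps He.
destruct (U_near n t l J eps Ht He HJ) as [A [e [HA [He' H]]]].
destruct (proj1 (is_lim_pinfty_spec _ _) Hl e He') as [M HM].
exists (M + A); intros x Hx; apply H; intros y Hy.
apply Rlt_le, HM; lra.
Qed.

Lemma U_lim_minfty (n : nat) (t l J : R) : 0 < t -> lint (hk n t) J ->
  is_lim F m_infty l -> is_lim (U F n t) m_infty (l * J).
Proof.
intros Ht HJ Hl; apply is_lim_minfty_spec; intros eps He.
destruct (U_near n t l J eps Ht He HJ) as [A [e [HA [He' H]]]].
destruct (proj1 (is_lim_minfty_spec _ _) Hl e He') as [M HM].
exists (M - A); intros x Hx; apply H; intros y Hy.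
apply Rlt_le, HM; lra.
Qed.

(* Symmetrising in [y] replaces [F] by its oscillation, which gains the factor 2
   over the crude bound. *)
Lemma U1_osc_bound (D t x : R) : 0 < t -> (forall a b, Rabs (F b - F a) <= D) ->
  Rabs (U F 1 t x) <= D / (2 * sqrt (PI * t)).
Proof.
intros Ht HD; assert (HS := sqrt_PIt_pos t Ht).
assert (L := U_spec_translate 1 t x Ht).
assert (L' := lint_opp_arg _ _ L).
assert (LL := lint_lin _ _ (/ 2) (/ 2) _ _ L L').
replace (/ 2 * U F 1 t x + / 2 * U F 1 t x) with (U F 1 t x) in LL by field.
replace (D / (2 * sqrt (PI * t))) with (D / 2 * / sqrt (PI * t)) by (field; lra).
apply (lint_abs_le _ _ _ _ LL (lint_scal _ (D / 2) _ (lint_abs_hk1 t Ht))).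
intros y; rewrite hk1_odd.
replace (/ 2 * (F (x - y) * hk 1 t y) + / 2 * (F (x - - y) * - hk 1 t y))
  with ((F (x - y) - F (x - - y)) / 2 * hk 1 t y) by field.
rewrite Rabs_mult; apply Rmult_le_compat_r; [apply Rabs_pos |].
unfold Rdiv; rewrite Rabs_mult, (Rabs_right (/ 2)) by lra.
apply Rmult_le_compat_r; [lra | apply HD].
Qed.

Lemma U0_osc_bound (D t x y : R) : 0 < t -> (forall a b, Rabs (F b - F a) <= D) ->
  Rabs (U F 0 t y - U F 0 t x) <= D.
Proof.
intros Ht HD.
assert (L := lint_minus _ _ _ _ (U_spec_translate 0 t y Ht) (U_spec_translate 0 t x Ht)).
rewrite <- (Rmult_1_r D).
apply (lint_abs_le _ _ _ _ L (lint_scal _ D _ (lint_heat t Ht))); intros z; simpl hk.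
assert (Hh := heat_pos t z Ht).
rewrite <- Rmult_minus_distr_r, Rabs_mult, (Rabs_right (heat t z)) by lra.
apply Rmult_le_compat_r; [lra | apply HD].
Qed.

(** Chebyshev's argument: where [d <= Rabs y], the crude bound [2 B] is at most
    [2 B * y ^ 2 / d ^ 2], and the second moment of the kernel is [2 t]. *)
Lemma U0_approx (t x eps d : R) : 0 < t -> 0 < d -> 0 <= eps ->
  (forall y, Rabs y < d -> Rabs (F (x - y) - F x) <= eps) ->
  Rabs (U F 0 t x - F x) <= eps + 2 * B / d ^ 2 * (2 * t).
Proof.
intros Ht Hd He H.
assert (L := lint_minus _ _ _ _ (U_spec_translate 0 t x Ht) (lint_scal _ (F x) _ (lint_heat t Ht))).
rewrite Rmult_1_r in L; rewrite <- (Rmult_1_r eps).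
apply (lint_abs_le _ _ _ _ L
  (lint_lin _ _ eps (2 * B / d ^ 2) _ _ (lint_heat t Ht) (lint_heat_sqr t Ht))).
intros y; simpl hk.
assert (Hh := heat_pos t y Ht).
rewrite <- Rmult_minus_distr_r, Rabs_mult, (Rabs_right (heat t y)) by lra.
rewrite <- Rmult_assoc, <- Rmult_plus_distr_r; apply Rmult_le_compat_r; [lra |].
assert (Hd2 : 0 < d ^ 2) by now apply pow_lt.
assert (Hq : 0 <= 2 * B / d ^ 2).
{ apply Rmult_le_pos; [lra | apply Rlt_le, Rinv_0_lt_compat, Hd2]. }
destruct (Rlt_dec (Rabs y) d) as [Hy | Hy].
- specialize (H y Hy); assert (P := pow2_ge_0 y); nra.
- apply Rle_trans with (2 * B).
  + apply Rle_trans with (1 := Rabs_triang _ _); rewrite Rabs_Ropp.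
    assert (P1 := proj2 HF (x - y)); assert (P2 := proj2 HF x); lra.
  + apply Rle_trans with (2 * B / d ^ 2 * y ^ 2); [| lra].
    apply Rle_trans with (2 * B / d ^ 2 * d ^ 2); [right; field; lra |].
    apply Rmult_le_compat_l; [exact Hq |].
    rewrite <- (pow2_abs y); apply pow_incr; lra.
Qed.

End Smoothing.

(** * Real analyticity *)

Lemma INR_S_le_pow2 (n : nat) : INR (S n) <= 2 ^ n.
Proof.
induction n as [| n IH]; [simpl; lra |].
rewrite S_INR; simpl pow; assert (1 <= 2 ^ n) by (apply pow_R1_Rle; lra); lra.
Qed.

(** When the centre [s] moves, the terms from differentiating [f k] and those from differentiating
    the power cancel between consecutive orders; only the last one survives. *)
Lemma taylor_moving_center (f : nat -> R -> R) (y s : R) (n : nat) :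
  (forall k, (k <= n)%nat -> is_derive (f k) s (f (S k) s)) ->
  is_derive (fun s => sum_f_R0 (fun k => f k s * (y - s) ^ k / INR (fact k)) n) s
    (f (S n) s * (y - s) ^ n / INR (fact n)).
Proof.
induction n as [| n IH]; intros H.
- simpl; assert (D := H O (le_n _)).
  apply (is_derive_eq (f O)); [intros; simpl; field |].
  eapply is_derive_val; [exact D | simpl; field].
- assert (D := H (S n) (le_n _)); simpl sum_f_R0.
  assert (N := INR_fact_neq_0 n); assert (N' := INR_fact_neq_0 (S n)).
  eapply is_derive_val.
  + apply @is_derive_plus; [apply IH; intros k Hk; apply H; lia |].
    apply (is_derive_eq (fun s => / INR (fact (S n)) * (f (S n) s * (y - s) ^ S n))).
    { intros; unfold Rdiv; apply Rmult_comm. }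
    apply is_derive_scal, @is_derive_mult; [exact D | | intros; apply Rmult_comm].
    apply is_derive_pow, @is_derive_minus; [apply @is_derive_const | apply @is_derive_id].
  + unfold plus, mult, minus, plus, opp, zero, one; simpl plus; simpl.
    change (match n with O => 1 | S _ => INR n + 1 end) with (INR (S n)).
    change (fact n + n * fact n)%nat with (S n * fact n)%nat.
    rewrite mult_INR, S_INR; assert (0 <= INR n) by apply pos_INR; field; lra.
Qed.

(* The Cauchy form of the remainder comes from the mean value theorem applied to
   the centre of expansion. *)
Lemma pseries_of_derivative_bounds (f : nat -> R -> R) (x0 r C K : R) :
  0 < r -> 0 < K ->
  (forall n y, Rabs (y - x0) < r -> is_derive (f n) y (f (S n) y)) ->
  (forall n y, Rabs (y - x0) < r -> Rabs (f n y) <= C * K ^ n * INR (fact n)) ->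
  exists a r', 0 < r' <= r /\
    forall y, Rabs (y - x0) < r' -> is_pseries a (y - x0) (f O y).
Proof.
intros Hr HK Hd Hb.
(* The remainder contains [INR (S n)], at most [2 ^ n], and [(K * Rabs (y - c)) ^ n]; the radius
   [1 / (4 K)] makes their product at most [(1 / 2) ^ n]. *)
set (r' := Rmin r (/ (4 * K))).
assert (Hr'0 : 0 < r') by (apply Rmin_glb_lt; [exact Hr | apply Rinv_0_lt_compat; lra]).
assert (Hr'1 : r' <= r) by apply Rmin_l.
assert (Hr'2 : K * r' <= / 4).
{ apply Rle_trans with (K * / (4 * K)); [apply Rmult_le_compat_l; [lra | apply Rmin_r] |].
  right; field; lra. }
assert (HC : 0 <= C).
{ assert (A := Hb O x0); rewrite Rminus_diag, Rabs_R0 in A; specialize (A Hr); simpl in A.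
  assert (B := Rabs_pos (f O x0)); lra. }
exists (fun n => f n x0 / INR (fact n)), r'; split; [lra |]; intros y Hy.
apply is_pseries_R.
change (is_lim_seq (sum_n (fun k => f k x0 / INR (fact k) * (y - x0) ^ k)) (f O y)).
apply (is_lim_seq_ext (fun n => sum_f_R0 (fun k => f k x0 * (y - x0) ^ k / INR (fact k)) n)).
{ intros n; rewrite sum_n_Reals; apply sum_eq; intros i _; unfold Rdiv; ring. }
apply is_lim_seq_spec; intros [eps He]; simpl.
set (D := C * K * r').
assert (HD : 0 <= D) by (apply Rmult_le_pos; [apply Rmult_le_pos |]; lra).
assert (G : is_lim_seq (fun n => (/ 2) ^ n) 0) by (apply is_lim_seq_geom; rewrite Rabs_right; lra).
apply is_lim_seq_spec in G.
assert (Hq : 0 < eps / (D + 1)) by (apply Rdiv_lt_0_compat; lra).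
destruct (G (mkposreal _ Hq)) as [N HN]; exists N; intros n Hn.
specialize (HN n Hn); simpl in HN; rewrite Rminus_0_r in HN.
rewrite Rabs_right in HN by (apply Rle_ge, pow_le; lra).
destruct (mvt (fun s => sum_f_R0 (fun k => f k s * (y - s) ^ k / INR (fact k)) n)
  (fun s => f (S n) s * (y - s) ^ n / INR (fact n)) x0 y) as [c [Hc E]].
{ intros s Hs; apply taylor_moving_center; intros k _; apply Hd.
  apply Rle_lt_trans with (Rabs (y - x0)); [| lra].
  revert Hs; unfold Rmin, Rmax, Rabs; destruct (Rle_dec x0 y);
    destruct (Rcase_abs (s - x0)); destruct (Rcase_abs (y - x0)); lra. }
assert (Hcx : Rabs (c - x0) < r' /\ Rabs (y - c) < r').
{ split; (apply Rle_lt_trans with (Rabs (y - x0)); [| exact Hy]);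
  revert Hc; unfold Rmin, Rmax, Rabs; destruct (Rle_dec x0 y);
    destruct (Rcase_abs (c - x0)); destruct (Rcase_abs (y - c));
    destruct (Rcase_abs (y - x0)); lra. }
assert (Ey : sum_f_R0 (fun k => f k y * (y - y) ^ k / INR (fact k)) n = f O y).
{ clear; induction n as [| n IH]; simpl sum_f_R0; [simpl; field |].
  rewrite IH; simpl pow; rewrite Rminus_diag; unfold Rdiv; ring. }
rewrite Ey in E; rewrite Rabs_minus_sym, E.
unfold Rdiv; rewrite !Rabs_mult, <- RPow_abs.
rewrite (Rabs_right (/ INR (fact n))) by (apply Rle_ge, Rlt_le, Rinv_0_lt_compat, INR_fact_lt_0).
assert (B := Hb (S n) c ltac:(lra)).
assert (Hn2 := INR_S_le_pow2 n).
assert (Hpow : (K * Rabs (y - c)) ^ n <= (/ 4) ^ n).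
{ apply pow_incr; split; [apply Rmult_le_pos; [lra | apply Rabs_pos] |].
  apply Rle_trans with (2 := Hr'2); apply Rmult_le_compat_l; lra. }
apply Rle_lt_trans with (D * (/ 2) ^ n).
- apply Rle_trans with (C * K ^ S n * INR (fact (S n)) * Rabs (y - c) ^ n * / INR (fact n) * r').
  + apply Rmult_le_compat; [| apply Rabs_pos | | lra].
    * apply Rmult_le_pos; [apply Rmult_le_pos; [apply Rabs_pos | apply pow_le, Rabs_pos] |].
      apply Rlt_le, Rinv_0_lt_compat, INR_fact_lt_0.
    * apply Rmult_le_compat_r; [apply Rlt_le, Rinv_0_lt_compat, INR_fact_lt_0 |].
      apply Rmult_le_compat_r; [apply pow_le, Rabs_pos | exact B].
  + change (fact (S n)) with (S n * fact n)%nat; rewrite mult_INR.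
    replace (C * K ^ S n * (INR (S n) * INR (fact n)) * Rabs (y - c) ^ n * / INR (fact n) * r')
      with (D * (INR (S n) * (K * Rabs (y - c)) ^ n)).
    2: { unfold D; rewrite Rpow_mult_distr; simpl pow; field; apply INR_fact_neq_0. }
    apply Rmult_le_compat_l; [exact HD |].
    apply Rle_trans with (2 ^ n * (/ 4) ^ n).
    * apply Rmult_le_compat; [apply pos_INR | | exact Hn2 | exact Hpow].
      apply pow_le, Rmult_le_pos; [lra | apply Rabs_pos].
    * rewrite <- Rpow_mult_distr; right; f_equal; field.
- assert (P : 0 < (/ 2) ^ n) by (apply pow_lt; lra).
  apply (Rmult_lt_compat_l (D + 1)) in HN; [| lra].
  replace ((D + 1) * (eps / (D + 1))) with eps in HN by (field; lra); nra.
Qed.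

(** * Factorial growth of the kernel constants *)

Lemma pow_le_fact_exp (n : nat) (x : R) : 0 <= x -> x ^ n <= INR (fact n) * exp x.
Proof.
intros Hx; assert (P := INR_fact_lt_0 n).
rewrite Rmult_comm; apply Rle_div_l; [exact P |].
apply Rle_trans with (2 := exp_ge_taylor x n Hx); clear P.
destruct n as [| n]; [simpl; lra |]; simpl sum_f_R0.
rewrite <- (Rplus_0_l (x ^ S n / _)) at 1.
apply Rplus_le_compat_r, cond_pos_sum; intros k.
apply Rmult_le_pos; [apply pow_le, Hx | apply Rlt_le, Rinv_0_lt_compat, INR_fact_lt_0].
Qed.

(** A weak form of Stirling's formula: [n ^ n / n!] is a single term of the series of [exp n]. *)
Lemma pow_self_le_fact (n : nat) : INR n ^ n <= exp 1 ^ n * INR (fact n).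
Proof.
rewrite exp_INR, Rmult_1_r, Rmult_comm; apply pow_le_fact_exp, pos_INR.
Qed.

Lemma pow_self_S_le_fact (n : nat) :
  INR (S n) ^ S n <= exp 1 * (2 * exp 1) ^ n * INR (fact n).
Proof.
apply Rle_trans with (1 := pow_self_le_fact (S n)).
change (fact (S n)) with (S n * fact n)%nat; rewrite mult_INR, Rpow_mult_distr; simpl pow.
assert (P := INR_fact_lt_0 n); assert (Q := exp_pos 1).
assert (Q' : 0 < exp 1 ^ n) by now apply pow_lt.
assert (Hn2 := INR_S_le_pow2 n).
apply Rle_trans with (exp 1 * exp 1 ^ n * (2 ^ n * INR (fact n))); [| right; ring].
apply Rmult_le_compat_l; [nra | apply Rmult_le_compat_r; lra].
Qed.

Lemma sqrt_le_1_plus (x : R) : 0 <= x -> sqrt x <= 1 + x.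
Proof. intros H; assert (A := sqrt_sqrt x H); assert (B := sqrt_pos x); nra. Qed.

(** The true growth is like [n ^ (n / 2)]. Bounding the square root by [(1 + 1 / t) * (n + 1)] is
    wasteful, but factorial growth is enough for a positive radius of convergence. *)
Lemma hkM_space_factorial (t : R) : 0 < t ->
  exists C K, 0 < K /\ forall n, hkM (S n) t <= C * K ^ n * INR (fact n).
Proof.
intros Ht; assert (Q := exp_pos 1).
assert (Hi : 0 < / t) by now apply Rinv_0_lt_compat.
set (b := exp 1 * (1 + / t)).
assert (Hb : 0 < b) by (apply Rmult_lt_0_compat; lra).
assert (S2 : 0 <= sqrt 2) by apply sqrt_pos.
exists (sqrt 2 * exp 1 * (b * exp 1)), (b * (2 * exp 1)); split; [apply Rmult_lt_0_compat; lra |].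
intros n; unfold hkM.
assert (H1 : (exp 1 * sqrt (INR (S (S n)) / (2 * t))) ^ S n <= (b * INR (S n)) ^ S n).
{ apply pow_incr; split; [apply Rmult_le_pos; [lra | apply sqrt_pos] |].
  unfold b; rewrite Rmult_assoc; apply Rmult_le_compat_l; [lra |].
  apply Rle_trans with (1 + INR (S (S n)) / (2 * t)).
  - apply sqrt_le_1_plus, Rmult_le_pos; [apply pos_INR | apply Rlt_le, Rinv_0_lt_compat; lra].
  - rewrite !S_INR; assert (P := pos_INR n).
    replace ((INR n + 1 + 1) / (2 * t)) with ((INR n + 2) / 2 * / t) by (field; lra); nra. }
apply Rle_trans with (sqrt 2 * exp 1 * (b ^ S n * (exp 1 * (2 * exp 1) ^ n * INR (fact n)))).
- apply Rmult_le_compat_l; [nra |].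
  apply Rle_trans with (1 := H1); rewrite Rpow_mult_distr.
  apply Rmult_le_compat_l; [apply pow_le; lra | apply pow_self_S_le_fact].
- right; rewrite (Rpow_mult_distr b); simpl pow; ring.
Qed.

(** There is no slack to waste here: [n] time derivatives cost [2 n] space derivatives, and [2 n] of
    the square roots combine to [((n + 1) / t) ^ n] exactly. The one left over, [w], is absorbed by
    [(1 + 1 / t) * (n + 1)]. *)
Lemma hkM_time_factorial (t : R) : 0 < t ->
  exists C K, 0 < K /\ forall n, hkM (S (2 * n)) t <= C * K ^ n * INR (fact n).
Proof.
intros Ht; assert (Q := exp_pos 1).
assert (Hi : 0 < / t) by now apply Rinv_0_lt_compat.
assert (S2 : 0 <= sqrt 2) by apply sqrt_pos.
exists (sqrt 2 * exp 1 * (exp 1 * (1 + / t) * exp 1)), (exp 1 * exp 1 * / t * (2 * exp 1)).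
split; [repeat apply Rmult_lt_0_compat; lra |].
intros n; unfold hkM.
replace (INR (S (S (2 * n))) / (2 * t)) with (INR (S n) * / t).
2: { rewrite !S_INR, mult_INR; simpl (INR 2); field; lra. }
set (w := sqrt (INR (S n) * / t)).
assert (Hn : 1 <= INR (S n)) by (rewrite S_INR; assert (P := pos_INR n); lra).
assert (Hw2 : w * w = INR (S n) * / t) by (apply sqrt_sqrt; nra).
assert (Hw : w <= (1 + / t) * INR (S n)).
{ apply Rle_trans with (1 + INR (S n) * / t); [apply sqrt_le_1_plus; nra | nra]. }
assert (Hw0 : 0 <= w) by apply sqrt_pos.
apply Rle_trans with (sqrt 2 * exp 1 *
  (exp 1 * (1 + / t) * (exp 1 * exp 1 * / t) ^ n * INR (S n) ^ S n)).
- apply Rmult_le_compat_l; [nra |].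
  rewrite Rpow_mult_distr, <- !tech_pow_Rmult, !pow_mult.
  replace (w ^ 2) with (INR (S n) * / t) by (rewrite <- Hw2; ring).
  replace (exp 1 ^ 2) with (exp 1 * exp 1) by ring.
  rewrite !Rpow_mult_distr.
  replace (exp 1 * (exp 1 ^ n * exp 1 ^ n) * (w * (INR (S n) ^ n * (/ t) ^ n)))
    with (exp 1 * (exp 1 ^ n * exp 1 ^ n) * (INR (S n) ^ n * (/ t) ^ n) * w) by ring.
  replace (exp 1 * (1 + / t) * (exp 1 ^ n * exp 1 ^ n * (/ t) ^ n) * (INR (S n) * INR (S n) ^ n))
    with (exp 1 * (exp 1 ^ n * exp 1 ^ n) * (INR (S n) ^ n * (/ t) ^ n) * ((1 + / t) * INR (S n))) by ring.
  apply Rmult_le_compat_l; [| exact Hw].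
  assert (0 < exp 1 ^ n) by now apply pow_lt.
  apply Rmult_le_pos; [apply Rmult_le_pos; nra |].
  apply Rmult_le_pos; apply pow_le; lra.
- apply Rle_trans with (sqrt 2 * exp 1 *
    (exp 1 * (1 + / t) * (exp 1 * exp 1 * / t) ^ n * (exp 1 * (2 * exp 1) ^ n * INR (fact n)))).
  + apply Rmult_le_compat_l; [nra |]; apply Rmult_le_compat_l; [| apply pow_self_S_le_fact].
    apply Rmult_le_pos; [nra |]; apply pow_le; apply Rmult_le_pos; nra.
  + right; rewrite (Rpow_mult_distr _ (2 * exp 1)); ring.
Qed.

Lemma U1_analytic_x (F : R -> R) (B t x0 : R) : bounded_continuous F B -> 0 < t ->
  exists a r, 0 < r /\ forall x, Rabs (x - x0) < r -> is_pseries a (x - x0) (U F 1 t x).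
Proof.
intros HF Ht; destruct (hkM_space_factorial t Ht) as [C [K [HK HC]]].
assert (HB := bounded_continuous_pos F B HF).
destruct (pseries_of_derivative_bounds (fun n => U F (S n) t) x0 1 (B * C) K)
  as [a [r [Hr H]]]; [lra | exact HK | | |].
- intros n y _; now apply (U_derive_x F B HF).
- intros n y _; apply Rle_trans with (1 := U_bound F B HF (S n) t y Ht).
  rewrite !Rmult_assoc, <- (Rmult_assoc C); apply Rmult_le_compat_l; auto.
- exists a, r; split; [lra | exact H].
Qed.

Lemma U1_analytic_t (F : R -> R) (B t0 x : R) : bounded_continuous F B -> 0 < t0 ->
  exists a r, 0 < r /\ forall t, Rabs (t - t0) < r -> is_pseries a (t - t0) (U F 1 t x).
Proof.
intros HF Ht; destruct (hkM_time_factorial (t0 / 2) ltac:(lra)) as [C [K [HK HC]]].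
assert (HB := bounded_continuous_pos F B HF).
destruct (pseries_of_derivative_bounds (fun n t => U F (S (2 * n)) t x) t0 (t0 / 2) (B * C) K)
  as [a [r [Hr H]]]; [lra | exact HK | | |].
- intros n t Hb; apply Rabs_def2 in Hb.
  replace (S (2 * S n))%nat with (S (S (S (2 * n)))) by lia.
  apply (U_derive_t F B HF); lra.
- intros n t Hb; apply Rabs_def2 in Hb.
  apply Rle_trans with (1 := U_bound F B HF (S (2 * n)) t x ltac:(lra)).
  rewrite !Rmult_assoc, <- (Rmult_assoc C); apply Rmult_le_compat_l; [exact HB |].
  apply Rle_trans with (2 := HC n); apply hkM_decr; lra.
- exists a, r; split; [lra | exact H].
Qed.

(** * Henstock-Stieltjes integrals *)

Lemma fine_part_snoc (delta : R -> R) (l : list (R * R)) (a c z d : R) :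
  fine_part delta a l c -> c < d -> c <= z <= d -> d - c < delta z ->
  exists l', fine_part delta a l' d.
Proof.
intros H Hcd Hz Hd; exists (app l (cons (z, d) nil)); revert a H.
induction l as [| [w x1] l IH]; simpl; intros a H.
- subst c; auto.
- destruct H as [A1 [A2 [A3 A4]]]; auto.
Qed.

(** Let [s] be the supremum of the points reachable from [a]. A reachable point within [delta s / 2]
    of [s] extends by one interval tagged [s] as far as [s + delta s / 4] or [b], so [b] itself is
    reached. The existence of fine partitions is what makes Henstock-Stieltjes integrals unique. *)
Lemma cousin (delta : R -> R) (a b : R) : a <= b -> (forall x, 0 < delta x) ->
  exists l, fine_part delta a l b.
Proof.
intros Hab Hd.
set (E := fun c => a <= c <= b /\ exists l, fine_part delta a l c).
assert (Ea : E a) by (split; [lra | exists nil; reflexivity]).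
destruct (completeness E) as [s [Hub Hlub]].
{ exists b; intros c [Hc _]; lra. }
{ exists a; exact Ea. }
assert (Has : a <= s) by (apply Hub; exact Ea).
assert (Hsb : s <= b) by (apply Hlub; intros c [Hc _]; lra).
assert (Hds := Hd s).
destruct (classic (exists c, E c /\ s - delta s / 2 < c)) as [[c [Ec Hc]] | Hn].
- assert (Hcs : c <= s) by (apply Hub; exact Ec).
  destruct Ec as [Hc' [l Hl]].
  set (d := Rmin b (s + delta s / 4)).
  assert (Hd1 : d <= b) by apply Rmin_l.
  assert (Hd2 : d <= s + delta s / 4) by apply Rmin_r.
  assert (Hd3 : s <= d) by (apply Rmin_glb; lra).
  destruct (Req_dec c d) as [Ecd | Ncd].
  + assert (Hbd : d = b).
    { unfold d, Rmin; destruct (Rle_dec b (s + delta s / 4)); [reflexivity |].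
      unfold d, Rmin in Hd3, Ecd; destruct (Rle_dec b (s + delta s / 4)); lra. }
    exists l; now rewrite <- Hbd, <- Ecd.
  + destruct (fine_part_snoc delta l a c s d Hl) as [l' Hl']; try lra.
    assert (Ed : E d) by (split; [lra | exists l'; exact Hl']).
    assert (Hds' := Hub d Ed).
    assert (Hbd : d = b).
    { revert Hds' Hd3; unfold d, Rmin; destruct (Rle_dec b (s + delta s / 4)); lra. }
    exists l'; now rewrite <- Hbd.
- exfalso.
  assert (A : s <= s - delta s / 2); [| lra].
  apply Hlub; intros c Ec; apply Rnot_lt_le; intros Hc; apply Hn; now exists c.
Qed.

Lemma fine_part_mono (d1 d2 : R -> R) (l : list (R * R)) (a b : R) :
  (forall x, d1 x <= d2 x) -> fine_part d1 a l b -> fine_part d2 a l b.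
Proof.
intros Hd; revert a; induction l as [| [z x1] l IH]; simpl; intros a H; [exact H |].
destruct H as [A1 [A2 [A3 A4]]]; specialize (Hd z); repeat split; try lra; auto.
Qed.

Lemma HS_int_unique (F g : R -> R) (a b I J : R) : a <= b ->
  is_HS_int F g a b I -> is_HS_int F g a b J -> I = J.
Proof.
intros Hab HI HJ; apply cond_eq; intros eps He.
destruct (HI (eps / 2) ltac:(lra)) as [d1 [P1 H1]].
destruct (HJ (eps / 2) ltac:(lra)) as [d2 [P2 H2]].
destruct (cousin (fun x => Rmin (d1 x) (d2 x)) a b Hab) as [l Hl].
{ intros x; apply Rmin_glb_lt; auto. }
specialize (H1 l (fine_part_mono _ _ _ _ _ (fun x => Rmin_l _ _) Hl)).
specialize (H2 l (fine_part_mono _ _ _ _ _ (fun x => Rmin_r _ _) Hl)).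
apply Rabs_def2 in H1; apply Rabs_def2 in H2; apply Rabs_def1; lra.
Qed.

(** With [z] between [u] and [v], the distances to [z] add up to [v - u], and so do the two
    one-sided errors up to the factor [eps]. *)
Lemma straddle (f : R -> R) (z eps : R) : is_derive f z 0 -> 0 < eps ->
  exists d, 0 < d /\ forall u v, u <= z <= v -> v - u < d ->
    Rabs (f v - f u) <= eps * (v - u).
Proof.
intros Hf He; apply is_derive_Reals in Hf; destruct (Hf eps He) as [d Hd].
assert (H : forall y, Rabs (y - z) < d -> Rabs (f y - f z) <= eps * Rabs (y - z)).
{ intros y Hy; destruct (Req_dec y z) as [-> | N].
  - rewrite !Rminus_diag, Rabs_R0; lra.
  - specialize (Hd (y - z) ltac:(lra) Hy).
    replace (z + (y - z)) with y in Hd by ring; rewrite Rminus_0_r in Hd.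
    unfold Rdiv in Hd; rewrite Rabs_mult, Rabs_inv in Hd.
    assert (P : 0 < Rabs (y - z)) by (apply Rabs_pos_lt; lra).
    apply Rlt_le, (Rmult_lt_reg_r (/ Rabs (y - z))); [now apply Rinv_0_lt_compat |].
    rewrite (Rmult_assoc eps), Rinv_r, Rmult_1_r by lra; exact Hd. }
exists d; split; [apply cond_pos |]; intros u v Huv Hd'.
assert (Hv := H v); assert (Hu := H u).
rewrite (Rabs_right (v - z)) in Hv by lra; rewrite (Rabs_left1 (u - z)) in Hu by lra.
specialize (Hv ltac:(lra)); specialize (Hu ltac:(lra)).
apply Rabs_le_between in Hv; apply Rabs_le_between in Hu; apply Rabs_le; lra.
Qed.

(* At a tag [z] the function [F z * g - P] has zero derivative. *)
Lemma HS_int_derive (F g dg P : R -> R) (a b : R) : a <= b ->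
  (forall x, is_derive g x (dg x)) -> (forall x, is_derive P x (F x * dg x)) ->
  is_HS_int F g a b (P b - P a).
Proof.
intros Hab Hg HP eps He.
set (e := eps / (b - a + 1)).
assert (He' : 0 < e) by (apply Rdiv_lt_0_compat; lra).
assert (Hz : forall z, exists d, 0 < d /\ forall u v, u <= z <= v -> v - u < d ->
    Rabs ((F z * g v + (-1) * P v) - (F z * g u + (-1) * P u)) <= e * (v - u)).
{ intros z; apply (straddle (fun y => F z * g y + (-1) * P y) z e); [| exact He'].
  eapply is_derive_val; [apply is_derive_lin; [apply Hg | apply HP] | ring]. }
set (delta := fun z => proj1_sig (constructive_indefinite_description _ (Hz z))).
assert (Hdelta : forall z, 0 < delta z /\ forall u v, u <= z <= v -> v - u < delta z ->
    Rabs ((F z * g v + (-1) * P v) - (F z * g u + (-1) * P u)) <= e * (v - u)).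
{ intros z; exact (proj2_sig (constructive_indefinite_description _ (Hz z))). }
exists delta; split; [intros z; apply Hdelta |].
intros l Hl.
(* The left end is general so that the induction can drop the first interval; increments of [P]
   telescope and the errors sum to [e] times the length. *)
assert (S : forall a', fine_part delta a' l b -> Rabs (RS_sum F g a' l - (P b - P a')) <= e * (b - a')).
{ clear Hl; induction l as [| [z x1] l IH]; intros a' Hl; simpl in *.
  - rewrite Hl, !Rminus_diag, Rabs_R0, Rmult_0_r; apply Rle_refl.
  - destruct Hl as [A1 [A2 [A3 A4]]]; specialize (IH x1 A4).
    assert (Hd := proj2 (Hdelta z) a' x1 A2 A3).
    apply Rabs_le_between in IH; apply Rabs_le_between in Hd; apply Rabs_le; lra. }
apply Rle_lt_trans with (1 := S a Hl); unfold e.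
apply Rmult_lt_reg_r with (b - a + 1); [lra |].
replace (eps / (b - a + 1) * (b - a) * (b - a + 1)) with (eps * (b - a)) by (field; lra).
nra.
Qed.

Lemma is_HS_int_R_lint (F g dg : R -> R) (I : R) :
  (forall x, is_derive g x (dg x)) -> lint (fun x => F x * dg x) I ->
  is_HS_int_R F g I.
Proof.
intros Hg [P [dP [mP pP]]]; split.
- intros a b Hab; exists (P b - P a); apply (HS_int_derive F g dg P); auto; lra.
- intros eps He.
  destruct (proj1 (is_lim_minfty_spec _ _) mP (eps / 2)) as [M1 H1]; [lra |].
  destruct (proj1 (is_lim_pinfty_spec _ _) pP (eps / 2)) as [M2 H2]; [lra |].
  set (M := Rmax 1 (Rmax (1 - M1) (1 + M2))).
  assert (A0 : 1 <= M) by apply Rmax_l.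
  assert (A1 : 1 - M1 <= M) by (eapply Rle_trans; [apply Rmax_l | apply Rmax_r]).
  assert (A2 : 1 + M2 <= M) by (eapply Rle_trans; [apply Rmax_r | apply Rmax_r]).
  exists M; split; [lra |]; intros a b J Ha Hb HJ.
  rewrite (HS_int_unique F g a b J (P b - P a) ltac:(lra) HJ).
  2: { apply (HS_int_derive F g dg P); auto; lra. }
  specialize (H1 a ltac:(lra)); specialize (H2 b ltac:(lra)).
  apply Rabs_def2 in H1; apply Rabs_def2 in H2; apply Rabs_def1; lra.
Qed.

Lemma is_HS_int_R_unique (F g : R -> R) (I J : R) :
  is_HS_int_R F g I -> is_HS_int_R F g J -> I = J.
Proof.
intros [HE HI] [_ HJ]; apply cond_eq; intros eps He.
destruct (HI (eps / 2) ltac:(lra)) as [M1 [P1 H1]].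
destruct (HJ (eps / 2) ltac:(lra)) as [M2 [P2 H2]].
assert (B1 := Rmax_l M1 M2); assert (B2 := Rmax_r M1 M2).
destruct (HE (- Rmax M1 M2) (Rmax M1 M2)) as [K HK]; [lra |].
specialize (H1 (- Rmax M1 M2) _ K ltac:(lra) B1 HK).
specialize (H2 (- Rmax M1 M2) _ K ltac:(lra) B2 HK).
apply Rabs_def2 in H1; apply Rabs_def2 in H2; apply Rabs_def1; lra.
Qed.

Lemma int_fg_lint (F g dg : R -> R) (Fi gi I : R) :
  is_lim F p_infty Fi -> is_lim g p_infty gi ->
  (forall x, is_derive g x (dg x)) -> lint (fun x => F x * dg x) I ->
  int_fg F g (Fi * gi - I).
Proof.
intros HF Hg dHg HI; exists Fi, gi, I; repeat split; auto;
  now apply (is_HS_int_R_lint F g dg I).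
Qed.

Lemma int_fg_unique (F g : R -> R) (v w : R) : int_fg F g v -> int_fg F g w -> v = w.
Proof.
intros [Fi [gi [I [A1 [A2 [A3 ->]]]]]] [Fi' [gi' [I' [B1 [B2 [B3 ->]]]]]].
apply is_lim_unique in A1; apply is_lim_unique in A2.
apply is_lim_unique in B1; apply is_lim_unique in B2.
rewrite <- A1, <- A2, <- B1, <- B2.
now rewrite (is_HS_int_R_unique _ _ _ _ A3 B3).
Qed.

(** * Distributional primitives *)

Lemma dist_deriv_classical (H h : R -> R) :
  (forall x, is_derive H x (h x)) -> (forall x, continuous h x) -> dist_deriv H h.
Proof.
intros dH Hc phi [Hs _] M Hphi.
assert (cH : forall x, continuous H x).
{ intros x; apply @ex_derive_continuous; eexists; apply dH. }
assert (dphi : forall x, is_derive phi x (Derive phi x)).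
{ intros x; apply Derive_correct, (Hs 1%nat). }
assert (cphi : forall x, continuous phi x).
{ intros x; apply @ex_derive_continuous; eexists; apply dphi. }
assert (cdphi : forall x, continuous (Derive phi) x).
{ intros x; apply @ex_derive_continuous, (Hs 2%nat). }
assert (E1 : ex_RInt (fun x => h x * phi x) (- M) M).
{ apply @ex_RInt_continuous; intros x _; apply @continuous_mult; auto. }
assert (E2 : ex_RInt (fun x => H x * Derive phi x) (- M) M).
{ apply @ex_RInt_continuous; intros x _; apply @continuous_mult; auto. }
split; [exact E1 |].
(* The support condition on [phi] is strict, so the boundary values come from continuity, through a
   point [y] slightly further out. *)
assert (Z : forall x, M <= Rabs x -> phi x = 0).
{ intros x Hx; destruct (Rle_lt_or_eq_dec _ _ Hx) as [Hx' | Hx']; [now apply Hphi |].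
  apply cond_eq; intros eps He.
  destruct (proj1 (filterlim_locally _ _) (cphi x) (mkposreal eps He)) as [d Hd].
  assert (Hd0 := cond_pos d).
  set (y := if Rle_dec 0 x then x + d / 2 else x - d / 2).
  assert (Hy : Rabs x < Rabs y /\ Rabs (y - x) < d).
  { unfold y; destruct (Rle_dec 0 x); split;
      unfold Rabs; repeat destruct Rcase_abs; lra. }
  specialize (Hd y (proj2 Hy)).
  rewrite (Hphi y ltac:(lra)) in Hd.
  rewrite Rabs_minus_sym; exact Hd. }
assert (I : is_RInt (fun x => h x * phi x + H x * Derive phi x) (- M) M
              (minus (H M * phi M) (H (- M) * phi (- M)))).
{ apply (is_RInt_derive (fun x => H x * phi x)).
  - intros x _; apply @is_derive_mult; [apply dH | apply dphi | intros; apply Rmult_comm].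
  - intros x _; apply @continuous_plus; apply @continuous_mult; auto. }
rewrite (Z M), (Z (- M)) in I by (rewrite ?Rabs_Ropp; apply Rle_abs).
apply (is_RInt_unique (V := R_CompleteNormedModule)) in I.
assert (P := RInt_plus (V := R_CompleteNormedModule) _ _ _ _ E1 E2).
unfold plus, minus, opp, plus in *; simpl in *.
lra.
Qed.

(** * Bump functions and uniqueness of distributional primitives *)

Lemma pow_exp_opp_le (n : nat) (z : R) : 0 <= z -> z ^ n * exp (- z) <= INR (fact n).
Proof.
intros Hz; rewrite exp_Ropp; apply Rle_div_l; [apply exp_pos | now apply pow_le_fact_exp].
Qed.

(* [bump r 0] is the usual bump function supported in [[-r, r]]; the powers of
   [1 / (r^2 - x^2)] make the family closed under differentiation. *)
Definition bump (r : R) (k : nat) (x : R) : R :=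
  if Rlt_dec 0 (r * r - x * x)
  then (/ (r * r - x * x)) ^ k * exp (- / (r * r - x * x)) else 0.

Lemma bump_out (r : R) (k : nat) (x : R) : r * r - x * x <= 0 -> bump r k x = 0.
Proof. intros H; unfold bump; destruct Rlt_dec; [lra | reflexivity]. Qed.

Lemma bump_in (r : R) (k : nat) (x : R) : 0 < r * r - x * x ->
  bump r k x = (/ (r * r - x * x)) ^ k * exp (- / (r * r - x * x)).
Proof. intros H; unfold bump; destruct Rlt_dec; [reflexivity | lra]. Qed.

(** Apply [pow_exp_opp_le] at order [k + 2] to the reciprocal of [r ^ 2 - x ^ 2]. The quadratic
    vanishing at the edge makes the glued function differentiable there, with derivative 0. *)
Lemma bump_flat (r : R) (k : nat) (x : R) :
  Rabs (bump r k x) <= INR (fact (S (S k))) * (r * r - x * x) ^ 2.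
Proof.
assert (P := INR_fact_lt_0 (S (S k))).
destruct (Rlt_dec 0 (r * r - x * x)) as [H | H].
- rewrite bump_in by exact H; set (w := r * r - x * x) in *.
  assert (Hw : 0 < / w) by now apply Rinv_0_lt_compat.
  rewrite Rabs_right.
  2: { apply Rle_ge, Rmult_le_pos; [apply pow_le; lra | apply Rlt_le, exp_pos]. }
  assert (A := pow_exp_opp_le (S (S k)) (/ w) ltac:(lra)).
  apply (Rmult_le_compat_r (w ^ 2)) in A; [| apply pow2_ge_0].
  apply Rle_trans with (2 := A); right; simpl pow; field; lra.
- rewrite bump_out, Rabs_R0 by lra.
  apply Rmult_le_pos; [lra | apply pow2_ge_0].
Qed.

Lemma bump_derive (r : R) (k : nat) (x : R) :
  is_derive (bump r k) x (- 2 * x * (bump r (S (S k)) x - INR k * bump r (S k) x)).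
Proof.
assert (Hcw : forall y, continuous (fun y => r * r - y * y) y).
{ intros y; apply @ex_derive_continuous; auto_derive; exact I. }
destruct (Rtotal_order (r * r - x * x) 0) as [H | [H | H]].
- rewrite !bump_out by lra.
  apply (is_derive_ext_loc (fun _ => 0)).
  { apply (filter_imp (fun y => r * r - y * y < 0)); [intros y Hy; symmetry; apply bump_out; lra |].
    apply (Hcw x (fun z => z < 0)), open_lt, H. }
  eapply is_derive_val; [apply @is_derive_const | unfold zero; simpl; ring].
- rewrite !(bump_out r _ x) by lra.
  replace (-2 * x * (0 - INR k * 0)) with 0 by ring.
  apply (quadratic_error_derive _ _ _ 1 (INR (fact (S (S k))) * (2 * Rabs x + 1) ^ 2) Rlt_0_1).
  intros h Hh; rewrite (bump_out r k x) by lra; rewrite Rmult_0_r, !Rminus_0_r.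
  apply Rle_trans with (1 := bump_flat r k (x + h)).
  rewrite Rmult_assoc; apply Rmult_le_compat_l; [apply Rlt_le, INR_fact_lt_0 |].
  rewrite <- (pow2_abs (r * r - _)), <- (pow2_abs h), <- Rpow_mult_distr.
  apply pow_incr; split; [apply Rabs_pos |].
  replace (r * r - (x + h) * (x + h)) with (- (2 * x + h) * h) by nra.
  rewrite Rabs_mult, Rabs_Ropp; apply Rmult_le_compat_r; [apply Rabs_pos |].
  apply Rle_trans with (1 := Rabs_triang _ _).
  rewrite Rabs_mult, (Rabs_right 2) by lra; lra.
- rewrite !bump_in by exact H.
  apply (is_derive_ext_loc
    (fun y => (/ (r * r - y * y)) ^ k * exp (- / (r * r - y * y)))).
  { apply (filter_imp (fun y => 0 < r * r - y * y)); [intros y Hy; symmetry; now apply bump_in |].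
    apply (Hcw x (fun z => 0 < z)), open_gt, H. }
  auto_derive; [split; lra |].
  unfold Rminus in *; set (w := r * r + - (x * x)) in *; generalize (exp (- / w)); intros e.
  destruct k as [| k]; simpl Init.Nat.pred; rewrite <- !tech_pow_Rmult.
  + simpl INR; simpl pow; field; lra.
  + generalize (INR (S k)) ((/ w) ^ k); intros c p; field; lra.
Qed.

Lemma bump_continuous (r : R) (k : nat) (x : R) : continuous (bump r k) x.
Proof. apply @ex_derive_continuous; eexists; apply bump_derive. Qed.

(** A class closed under differentiation, so smoothness follows by induction without formulas for
    higher derivatives. [ba_id] provides the factor [x] in [bump_derive]; [ba_prim] admits the
    antiderivatives of bumps from which the test functions are made. *)
Inductive bump_alg : (R -> R) -> Prop :=
| ba_bump r k a : bump_alg (fun x => bump r k (x - a))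
| ba_lin f g a b : bump_alg f -> bump_alg g -> bump_alg (fun x => a * f x + b * g x)
| ba_id f : bump_alg f -> bump_alg (fun x => x * f x)
| ba_prim f f' : bump_alg f' -> (forall x, is_derive f x (f' x)) -> bump_alg f.

Lemma bump_alg_derive (f : R -> R) : bump_alg f ->
  exists f', bump_alg f' /\ forall x, is_derive f x (f' x).
Proof.
induction 1 as [r k a | f g a b Hf [f' [Af Df]] Hg [g' [Ag Dg]] | f Hf [f' [Af Df]] | f f' Hf' IH Df].
- assert (A2 := ba_bump r (S (S k)) a); assert (A1 := ba_bump r (S k) a).
  assert (AL := ba_lin _ _ 1 (- INR k) A2 A1).
  eexists; split; [exact (ba_lin _ _ (- 2) (2 * a) (ba_id _ AL) AL) |].
  intros x; apply (is_derive_eq (fun x => bump r k (1 * x + - a))).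
  { intros y; f_equal; ring. }
  eapply is_derive_val; [apply is_derive_affine, bump_derive |].
  replace (1 * x + - a) with (x - a) by ring; simpl; ring.
- eexists; split; [exact (ba_lin _ _ a b Af Ag) |]; intros x; now apply is_derive_lin.
- eexists; split; [exact (ba_lin _ _ 1 1 Hf (ba_id _ Af)) |]; intros x.
  eapply is_derive_val.
  + apply @is_derive_mult; [apply @is_derive_id | apply Df | intros; apply Rmult_comm].
  + unfold plus, mult, one; simpl; ring.
- exists f'; auto.
Qed.

Lemma bump_alg_Derive_n (n : nat) (f : R -> R) : bump_alg f ->
  exists g, bump_alg g /\ forall x, Derive_n f n x = g x.
Proof.
intros Hf; induction n as [| n [g [Hg E]]].
- exists f; auto.
- destruct (bump_alg_derive g Hg) as [g' [Hg' D]]; exists g'; split; [exact Hg' |].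
  intros x; simpl; rewrite (Derive_ext _ g) by exact E; now apply is_derive_unique.
Qed.

Lemma bump_alg_smooth (f : R -> R) : bump_alg f -> forall n x, ex_derive_n f n x.
Proof.
intros Hf [| n] x; [exact I |]; simpl.
destruct (bump_alg_Derive_n n f Hf) as [g [Hg E]].
apply (ex_derive_ext g); [intros; now rewrite E |].
destruct (bump_alg_derive g Hg) as [g' [_ D]]; eexists; apply D.
Qed.

Lemma RInt_support (f : R -> R) (r u v : R) : 0 <= r ->
  (forall x, continuous f x) -> (forall x, r <= Rabs x -> f x = 0) ->
  u <= - r -> r <= v -> RInt f u v = RInt f (- r) r.
Proof.
intros Hr Hc Hz Hu Hv.
assert (Ex : forall a b, ex_RInt f a b).
{ intros a b; apply @ex_RInt_continuous; auto. }
assert (Z : forall a b, (forall x, Rmin a b < x < Rmax a b -> r <= Rabs x) -> RInt f a b = 0).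
{ intros a b H; rewrite (RInt_ext _ (fun _ => 0)).
  - rewrite RInt_const; unfold scal; simpl; unfold mult; simpl; ring.
  - intros x Hx; apply Hz, H, Hx. }
assert (C1 := RInt_Chasles f u (- r) v (Ex _ _) (Ex _ _)).
assert (C2 := RInt_Chasles f (- r) r v (Ex _ _) (Ex _ _)).
rewrite (Z u (- r)) in C1; [rewrite (Z r v) in C2 |].
- unfold plus in *; simpl in *; lra.
- intros x; rewrite Rmin_left, Rmax_right by lra; intros Hx; rewrite Rabs_right; lra.
- intros x; rewrite Rmin_left, Rmax_right by lra; intros Hx; rewrite Rabs_left1; lra.
Qed.

Lemma bump_zero_outside (r : R) (x : R) : 0 < r -> r <= Rabs x -> bump r 0 x = 0.
Proof.
intros Hr Hx; apply bump_out.
assert (E : x * x = Rabs x * Rabs x) by (rewrite <- Rabs_mult, Rabs_right; nra); nra.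
Qed.

Lemma RInt_bump_translate (D : R -> R) (r a M : R) : 0 < r ->
  (forall x, continuous D x) -> Rabs a + r <= M ->
  RInt (fun x => D x * bump r 0 (x - a)) (- M) M =
  RInt (fun s => D (s + a) * bump r 0 s) (- r) r.
Proof.
intros Hr Hc HM.
assert (Ha := Rle_abs a); assert (Ha' := Rle_abs (- a)); rewrite Rabs_Ropp in Ha'.
assert (Ct : forall s, continuous (fun s => D (s + a)) s).
{ intros s; apply (continuous_comp (fun s => s + a) D); [| apply Hc].
  apply @ex_derive_continuous; auto_derive; exact I. }
assert (Cb : forall s, continuous (fun s => bump r 0 (s - a)) s).
{ intros s; apply (continuous_comp (fun s => s - a) (bump r 0)); [| apply bump_continuous].
  apply @ex_derive_continuous; auto_derive; exact I. }
rewrite <- (RInt_support (fun s => D (s + a) * bump r 0 s) r (- M - a) (M - a)); try lra.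
- assert (E := RInt_comp_lin (fun x => D x * bump r 0 (x - a)) 1 a (- M - a) (M - a)).
  replace (1 * (- M - a) + a) with (- M) in E by ring.
  replace (1 * (M - a) + a) with M in E by ring.
  rewrite <- E.
  + apply RInt_ext; intros s _; unfold scal; simpl; unfold mult; simpl.
    replace (1 * s + a - a) with s by ring; replace (1 * s + a) with (s + a) by ring; ring.
  + apply @ex_RInt_continuous; intros s _; apply @continuous_mult; [apply Hc | apply Cb].
- intros s; apply @continuous_mult; [apply Ct | apply bump_continuous].
- intros s Hs; rewrite bump_zero_outside by assumption; ring.
Qed.

Definition bump_prim (r x : R) : R := RInt (bump r 0) (- r) x.

Lemma bump_prim_derive (r x : R) : is_derive (bump_prim r) x (bump r 0 x).
Proof.
apply (is_derive_RInt (bump r 0) _ (- r) x); [| apply bump_continuous].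
apply filter_forall; intros y; apply @RInt_correct.
apply @ex_RInt_continuous; intros; apply bump_continuous.
Qed.

Lemma bump_prim_out (r x : R) : 0 < r -> r <= Rabs x ->
  bump_prim r x = if Rle_dec 0 x then bump_prim r r else 0.
Proof.
intros Hr Hx; unfold bump_prim; destruct (Rle_dec 0 x) as [H | H].
- apply RInt_support; try lra.
  + intros; apply bump_continuous.
  + intros; now apply bump_zero_outside.
  + rewrite Rabs_right in Hx; lra.
- rewrite Rabs_left in Hx by lra.
  rewrite (RInt_ext _ (fun _ => 0)).
  + rewrite RInt_const; unfold scal; simpl; unfold mult; simpl; ring.
  + intros y; rewrite Rmin_right, Rmax_left by lra; intros Hy.
    apply bump_zero_outside; [exact Hr | rewrite Rabs_left; lra].
Qed.

(* The difference of two translates of [bump_prim] is a test function whose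
   derivative compares the averages of [D] near [a] and near [b]. *)
Lemma test_fun_bump_difference (r a b M : R) : 0 < r -> Rabs a + r <= M -> Rabs b + r <= M ->
  test_fun (fun x => 1 * bump_prim r (x - a) + (-1) * bump_prim r (x - b)) /\
  forall x, M < Rabs x -> 1 * bump_prim r (x - a) + (-1) * bump_prim r (x - b) = 0.
Proof.
intros Hr Ha Hb.
assert (T : forall c, bump_alg (fun x => bump_prim r (x - c))).
{ intros c; apply (ba_prim _ _ (ba_bump r 0 c)); intros x.
  apply (is_derive_eq (fun x => bump_prim r (1 * x + - c))).
  { intros y; f_equal; ring. }
  eapply is_derive_val; [apply is_derive_affine, bump_prim_derive |].
  replace (1 * x + - c) with (x - c) by ring; ring. }
assert (Z : forall x, M < Rabs x -> 1 * bump_prim r (x - a) + (-1) * bump_prim r (x - b) = 0).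
{ intros x Hx.
  assert (A1 := Rle_abs a); assert (A2 := Rle_abs (- a)); rewrite Rabs_Ropp in A2.
  assert (B1 := Rle_abs b); assert (B2 := Rle_abs (- b)); rewrite Rabs_Ropp in B2.
  destruct (Rle_dec 0 x) as [Hx0 | Hx0].
  - rewrite Rabs_right in Hx by lra.
    rewrite (bump_prim_out r (x - a)), (bump_prim_out r (x - b));
      try (rewrite Rabs_right; lra); try exact Hr.
    destruct (Rle_dec 0 (x - a)); destruct (Rle_dec 0 (x - b)); lra.
  - rewrite Rabs_left in Hx by lra.
    rewrite (bump_prim_out r (x - a)), (bump_prim_out r (x - b));
      try (rewrite Rabs_left; lra); try exact Hr.
    destruct (Rle_dec 0 (x - a)); destruct (Rle_dec 0 (x - b)); lra. }
split; [split |]; [| exists M; exact Z | exact Z].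
apply bump_alg_smooth; exact (ba_lin _ _ 1 (-1) (T a) (T b)).
Qed.

Lemma continuous_lower (K : R -> R) : continuous K 0 -> 0 < K 0 ->
  exists r, 0 < r /\ forall s, Rabs s < r -> 0 < K s.
Proof.
intros Hc HK.
destruct (Hc (fun z => 0 < z) (open_gt 0 (K 0) HK)) as [d Hd].
exists d; split; [apply cond_pos |]; intros s Hs; apply Hd.
unfold ball; simpl; unfold AbsRing_ball, abs, minus, plus, opp; simpl.
replace (s + - 0) with s by ring; exact Hs.
Qed.

(** If the difference [D] had [D b < D a], then [D (s + a)] would exceed [D (s + b)] for all small
    [s]. Testing against a function whose derivative is a bump at [a] minus a bump at [b] shows that
    this gap has integral 0 against the bump, although the integrand is positive. Exchanging [a] and
    [b] gives equality. *)
Lemma dist_deriv_unique (H1 H2 h : R -> R) :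
  (forall x, continuous H1 x) -> (forall x, continuous H2 x) ->
  dist_deriv H1 h -> dist_deriv H2 h -> forall a b, H1 a - H2 a = H1 b - H2 b.
Proof.
intros C1 C2 D1 D2.
set (D := fun x => H1 x - H2 x).
assert (CD : forall x, continuous D x) by (intros x; apply @continuous_minus; auto).
assert (Main : forall a b, D a <= D b).
{ intros a b; apply Rnot_lt_le; intros Hab.
  set (K := fun s => D (s + a) - D (s + b)).
  assert (Ct : forall c s, continuous (fun s => D (s + c)) s).
  { intros c s; apply (continuous_comp (fun s => s + c) D); [| apply CD].
    apply @ex_derive_continuous; auto_derive; exact I. }
  assert (CK : forall s, continuous K s) by (intros s; apply @continuous_minus; apply Ct).
  destruct (continuous_lower K (CK 0)) as [r [Hr HK]].
  { unfold K; rewrite !Rplus_0_l; lra. }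
  set (M := Rabs a + Rabs b + r).
  assert (Pa := Rabs_pos a); assert (Pb := Rabs_pos b).
  destruct (test_fun_bump_difference r a b M Hr) as [T Z]; [unfold M; lra | unfold M; lra |].
  set (phi := fun x => 1 * bump_prim r (x - a) + (-1) * bump_prim r (x - b)) in *.
  assert (Dphi : forall x, Derive phi x = bump r 0 (x - a) - bump r 0 (x - b)).
  { intros x; apply is_derive_unique; eapply is_derive_val.
    - apply is_derive_lin.
      + apply (is_derive_eq (fun x => bump_prim r (1 * x + - a))); [intros; f_equal; ring |].
        apply is_derive_affine, bump_prim_derive.
      + apply (is_derive_eq (fun x => bump_prim r (1 * x + - b))); [intros; f_equal; ring |].
        apply is_derive_affine, bump_prim_derive.
    - replace (1 * x + - a) with (x - a) by ring; replace (1 * x + - b) with (x - b) by ring; ring. }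
  destruct (D1 phi T M Z) as [_ E1]; destruct (D2 phi T M Z) as [_ E2].
  assert (Cd : forall x, continuous (Derive phi) x).
  { intros x; apply @ex_derive_continuous, (proj1 T 2%nat). }
  assert (E : RInt (fun x => D x * Derive phi x) (- M) M = 0).
  { transitivity (RInt (fun x => minus (H1 x * Derive phi x) (H2 x * Derive phi x)) (- M) M).
    - apply RInt_ext; intros x _; unfold D, minus, plus, opp; simpl; ring.
    - rewrite (RInt_minus (V := R_CompleteNormedModule)).
      + unfold minus, plus, opp; simpl; rewrite E1, E2; ring.
      + apply @ex_RInt_continuous; intros x _; apply @continuous_mult; auto.
      + apply @ex_RInt_continuous; intros x _; apply @continuous_mult; auto. }
  assert (Cb : forall c x, continuous (fun x => D x * bump r 0 (x - c)) x).
  { intros c x; apply @continuous_mult; [apply CD |].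
    apply (continuous_comp (fun s => s - c) (bump r 0)); [| apply bump_continuous].
    apply @ex_derive_continuous; auto_derive; exact I. }
  assert (E' : RInt (fun s => K s * bump r 0 s) (- r) r = 0).
  { rewrite <- E.
    transitivity (RInt (fun x => minus (D x * bump r 0 (x - a)) (D x * bump r 0 (x - b))) (- M) M).
    - rewrite (RInt_minus (V := R_CompleteNormedModule)).
      + rewrite !RInt_bump_translate by (auto; unfold M; lra).
        rewrite <- (RInt_minus (V := R_CompleteNormedModule)).
        * apply RInt_ext; intros s _; unfold K, minus, plus, opp; simpl; ring.
        * apply @ex_RInt_continuous; intros s _; apply @continuous_mult; [apply Ct | apply bump_continuous].
        * apply @ex_RInt_continuous; intros s _; apply @continuous_mult; [apply Ct | apply bump_continuous].
      + apply @ex_RInt_continuous; intros; apply Cb.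
      + apply @ex_RInt_continuous; intros; apply Cb.
    - apply RInt_ext; intros x _; rewrite Dphi; unfold minus, plus, opp; simpl; ring. }
  assert (P : 0 < RInt (fun s => K s * bump r 0 s) (- r) r); [| lra].
  apply RInt_gt_0; [lra | |].
  - intros s Hs; apply Rmult_lt_0_compat; [apply HK, Rabs_def1; lra |].
    assert (Hw : 0 < r * r - s * s) by nra.
    rewrite bump_in by exact Hw; simpl; rewrite Rmult_1_l; apply exp_pos.
  - intros s _; apply @continuous_mult; [apply CK | apply bump_continuous]. }
intros a b; apply Rle_antisym; apply Main.
Qed.

Lemma prim_of_unique (h H1 H2 : R -> R) :
  prim_of h H1 -> prim_of h H2 -> forall x, H1 x = H2 x.
Proof.
intros [[[C1 _] L1] D1] [[[C2 _] L2] D2] x.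
assert (E := dist_deriv_unique H1 H2 h C1 C2 D1 D2).
assert (L : is_lim (fun y => 1 * H1 y + (-1) * H2 y) m_infty (1 * 0 + (-1) * 0)).
{ now apply is_lim_lin. }
apply (is_lim_ext _ (fun _ => H1 x - H2 x)) in L.
- assert (A := is_lim_unique_R _ _ _ _ (is_lim_const _ _) L); lra.
- intros y; rewrite <- (E y x); ring.
Qed.

Lemma prim_of_classical (h H : R -> R) (I : R) :
  (forall x, is_derive H x (h x)) -> (forall x, continuous h x) ->
  is_lim H m_infty 0 -> is_lim H p_infty I -> prim_of h H.
Proof.
intros dH Hc mH pH; split; [| now apply dist_deriv_classical].
split; [| exact mH]; split; [| split; eexists; eassumption].
intros x; apply @ex_derive_continuous; eexists; apply dH.
Qed.

Lemma prim_eq (h H : R -> R) : prim_of h H -> forall x, prim h x = H x.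
Proof.
intros HH; apply (prim_of_unique h); [| exact HH].
unfold prim; apply epsilon_spec; now exists H.
Qed.

Lemma Finf_lim (H : R -> R) (I : R) : is_lim H p_infty I -> Finf H = I.
Proof. intros HI; unfold Finf; apply is_lim_unique in HI; now rewrite HI. Qed.

Lemma int_fun_lint (h : R -> R) (I : R) :
  (forall x, continuous h x) -> lint h I -> int_fun h I.
Proof.
intros Hc [H [dH [mH pH]]]; exists H; split.
- now apply (prim_of_classical h H I).
- symmetry; now apply Finf_lim.
Qed.

Lemma int_fun_unique (h : R -> R) (v w : R) : int_fun h v -> int_fun h w -> v = w.
Proof.
intros [H [PH ->]] [K [PK ->]]; unfold Finf; f_equal.
apply Lim_ext; now apply (prim_of_unique h).
Qed.

(** * A convolution outside every Lebesgue space *)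

Definition slow (x : R) : R := / (1 + ln (1 + x * x)).

Lemma slow_den_ge_1 (x : R) : 1 <= 1 + ln (1 + x * x).
Proof.
assert (A : 0 <= ln (1 + x * x)); [| lra].
rewrite <- ln_1; apply ln_le; nra.
Qed.

Lemma slow_bounds (x : R) : 0 < slow x <= 1.
Proof.
assert (A := slow_den_ge_1 x); unfold slow; split; [apply Rinv_0_lt_compat; lra |].
apply Rle_trans with (/ 1); [apply Rinv_le_contravar; lra | lra].
Qed.

Lemma ln_1_sqr_derive (x : R) : is_derive (fun y => ln (1 + y * y)) x (2 * x / (1 + x * x)).
Proof. auto_derive; [nra | field; nra]. Qed.

Lemma slow_continuous (x : R) : continuous slow x.
Proof.
assert (A := slow_den_ge_1 x).
apply @ex_derive_continuous; unfold slow; auto_derive; split; [nra | lra].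
Qed.

(** The reciprocal of [slow] is 1-Lipschitz, as [2 c / (1 + c ^ 2)] lies between -1 and 1. The
    factor [slow z] is kept on purpose: after division by [slow x] it still tends to 0, so [slow]
    has negligible relative variation over bounded distances. *)
Lemma slow_diff (x z : R) : Rabs (slow z - slow x) <= slow x * slow z * Rabs (x - z).
Proof.
assert (Ax := slow_den_ge_1 x); assert (Az := slow_den_ge_1 z).
assert (Bx := slow_bounds x); assert (Bz := slow_bounds z).
replace (slow z - slow x) with (slow x * slow z * (ln (1 + x * x) - ln (1 + z * z)))
  by (unfold slow; field; lra).
rewrite Rabs_mult, (Rabs_right (slow x * slow z)) by nra.
apply Rmult_le_compat_l; [nra |].
destruct (mvt (fun y => ln (1 + y * y)) (fun y => 2 * y / (1 + y * y)) z x) as [c [_ ->]].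
{ intros; apply ln_1_sqr_derive. }
rewrite Rabs_mult; apply Rle_trans with (1 * Rabs (x - z)); [| lra].
apply Rmult_le_compat_r; [apply Rabs_pos |].
assert (Q1 := pow2_ge_0 (c + 1)); assert (Q2 := pow2_ge_0 (c - 1)).
apply Rabs_le; split; [apply Rle_div_r | apply Rle_div_l]; nra.
Qed.

Lemma slow_small (eps : R) : 0 < eps -> exists X, 1 <= X /\ forall x, X <= Rabs x -> slow x <= eps.
Proof.
intros He; exists (1 + exp (/ eps)).
assert (P := exp_pos (/ eps)); assert (Pe : 0 < / eps) by now apply Rinv_0_lt_compat.
split; [lra |]; intros x Hx.
assert (E : x * x = Rabs x * Rabs x) by (rewrite <- Rabs_mult, Rabs_right; nra).
unfold slow; rewrite <- (Rinv_inv eps); apply Rinv_le_contravar; [exact Pe |].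
rewrite <- (ln_exp (/ eps)) at 1.
assert (A : ln (exp (/ eps)) <= ln (1 + x * x)); [| lra].
apply ln_le; [exact P | rewrite E; nra].
Qed.

Lemma sin_bounded_continuous (w : R) : bounded_continuous (fun x => sin (w * x)) 1.
Proof.
split; intros x; [apply @ex_derive_continuous; auto_derive; exact I |].
apply Rabs_le, SIN_bound.
Qed.

Lemma lint_bounded_heat (f : R -> R) (t : R) : 0 < t -> bounded_continuous f 1 ->
  exists I, lint (fun y => f y * heat t y) I.
Proof.
intros Ht [Hc Hb]; apply (lint_exists _ (heat t) 1); [| now apply lint_heat |].
- intros x; apply @continuous_mult; [apply Hc | apply (hk_continuous 0), Ht].
- intros x; assert (P := heat_pos t x Ht).
  rewrite Rabs_mult, (Rabs_right (heat t x)) by lra.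
  apply Rle_trans with (1 * heat t x); [| lra].
  apply Rmult_le_compat_r; [lra | apply Hb].
Qed.

Lemma sin_le_id (y : R) : 0 <= y -> sin y <= y.
Proof.
intros Hy; assert (B : 0 - sin 0 <= y - sin y); [| rewrite sin_0 in B; lra].
apply (derive_nonneg_incr (fun y => y - sin y) (fun y => 1 - cos y) 0 y Hy).
- intros z _; auto_derive; [exact I | ring].
- intros z _; assert (C := COS_bound z); lra.
Qed.

Lemma cos_ge_quadratic (x : R) : 1 - x * x / 2 <= cos x.
Proof.
assert (H : forall x, 0 <= x -> 1 - x * x / 2 <= cos x).
{ clear x; intros x H.
  assert (A : cos 0 - (1 - 0 * 0 / 2) <= cos x - (1 - x * x / 2)); [| rewrite cos_0 in A; lra].
  apply (derive_nonneg_incr (fun x => cos x - (1 - x * x / 2)) (fun x => x - sin x) 0 x H).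
  - intros z _; auto_derive; [exact I | field].
  - intros z Hz; assert (C := sin_le_id z ltac:(lra)); lra. }
destruct (Rle_dec 0 x) as [Hx | Hx]; [now apply H |].
rewrite <- cos_neg; replace (x * x) with (- x * - x) by ring; apply H; lra.
Qed.

(* [sin (w x)] is an eigenfunction of the smoothing operator; the eigenvalue
   is only bounded from below. *)
Lemma U1_sin (w t : R) : 0 < t -> w * w * t <= / 2 ->
  exists kappa, / 2 <= kappa /\
    forall x, U (fun x => sin (w * x)) 1 t x = w * kappa * cos (w * x).
Proof.
intros Ht Hw; assert (HS := sin_bounded_continuous w).
destruct (lint_bounded_heat (fun y => cos (w * y)) t Ht) as [kappa Hk].
{ split; intros x; [apply @ex_derive_continuous; auto_derive; exact I |].
  apply Rabs_le, COS_bound. }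
destruct (lint_bounded_heat (fun y => sin (w * y)) t Ht HS) as [z Hz].
assert (Z : z = 0).
{ assert (A := lint_opp_arg _ _ Hz); apply (lint_scal _ (- 1)) in A.
  assert (E : z = -1 * z); [| lra].
  apply (lint_unique _ _ _ Hz); revert A; apply lint_ext; intros y.
  rewrite heat_even; replace (w * - y) with (- (w * y)) by ring; rewrite sin_neg; ring. }
subst z; exists kappa; split.
(* The quadratic lower bound for the cosine and the second moment [2 t] give
   [kappa >= 1 - w ^ 2 * t]; this is where the hypothesis on [w] comes from. *)
- assert (A := lint_le _ _ _ _
    (lint_lin _ _ 1 (- (w * w / 2)) _ _ (lint_heat t Ht) (lint_heat_sqr t Ht)) Hk).
  apply Rle_trans with (1 * 1 + - (w * w / 2) * (2 * t)); [lra |]; apply A; intros y.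
  assert (P := heat_pos t y Ht); assert (C := cos_ge_quadratic (w * y)).
  apply Rle_trans with ((1 - w * y * (w * y) / 2) * heat t y); [right; field |].
  apply Rmult_le_compat_r; lra.
- intros x.
  assert (E : forall x, U (fun x => sin (w * x)) 0 t x = kappa * sin (w * x)).
  { clear x; intros x.
    apply (lint_unique _ _ _ (U_spec_translate _ _ HS 0 t x Ht)).
    assert (A := lint_lin _ _ (sin (w * x)) (- cos (w * x)) _ _ Hk Hz).
    replace (sin (w * x) * kappa + - cos (w * x) * 0) with (kappa * sin (w * x)) in A by ring.
    revert A; apply lint_ext; intros y; simpl hk.
    replace (w * (x - y)) with (w * x - w * y) by ring; rewrite sin_minus; ring. }
  assert (D := U_derive_x _ _ HS 0 t x Ht).
  apply is_derive_unique in D; rewrite <- D.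
  rewrite (Derive_ext _ (fun x => kappa * sin (w * x))) by exact E.
  apply is_derive_unique; auto_derive; [exact I | ring].
Qed.

Definition slow_sin (w x : R) : R := slow x * sin (w * x).

Lemma slow_sin_bounded_continuous (w : R) : bounded_continuous (slow_sin w) 1.
Proof.
split; intros x; unfold slow_sin.
- apply @continuous_mult; [apply slow_continuous | apply sin_bounded_continuous].
- rewrite Rabs_mult; assert (A := slow_bounds x); rewrite Rabs_right by lra.
  rewrite <- (Rmult_1_l 1); apply Rmult_le_compat; try lra; [apply Rabs_pos |].
  apply sin_bounded_continuous.
Qed.

Lemma slow_sin_small (w eps : R) : 0 < eps ->
  exists X, forall x, X <= Rabs x -> Rabs (slow_sin w x) <= eps.
Proof.
intros He; destruct (slow_small eps He) as [X [_ HX]]; exists X; intros x Hx.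
unfold slow_sin; rewrite Rabs_mult; specialize (HX x Hx).
assert (A := slow_bounds x); rewrite Rabs_right by lra.
rewrite <- (Rmult_1_r eps); apply Rmult_le_compat; try lra; [apply Rabs_pos |].
apply sin_bounded_continuous.
Qed.

Lemma slow_sin_InBc (w : R) : InBc (slow_sin w).
Proof.
assert (Lp : is_lim (slow_sin w) p_infty 0).
{ apply is_lim_pinfty_spec; intros eps He.
  destruct (slow_sin_small w (eps / 2)) as [X HX]; [lra |].
  exists X; intros x Hx; rewrite Rminus_0_r.
  apply Rle_lt_trans with (eps / 2); [apply HX | lra].
  assert (B := Rle_abs x); lra. }
assert (Lm : is_lim (slow_sin w) m_infty 0).
{ apply is_lim_minfty_spec; intros eps He.
  destruct (slow_sin_small w (eps / 2)) as [X HX]; [lra |].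
  exists (- X); intros x Hx; rewrite Rminus_0_r.
  apply Rle_lt_trans with (eps / 2); [apply HX | lra].
  assert (B := Rle_abs (- x)); rewrite Rabs_Ropp in B; lra. }
split; [split; [apply slow_sin_bounded_continuous |] | exact Lm].
split; eexists; eassumption.
Qed.

(* [slow] varies so slowly that smoothing [slow_sin] amounts, to leading order,
   to multiplying [slow] by the smoothed sine. *)
Lemma U1_slow_sin_lower (w t : R) : 0 < t -> 0 < w -> w * w * t <= / 2 ->
  exists X, forall x, X <= x -> / 2 <= Rabs (cos (w * x)) ->
    w / 8 * slow x <= Rabs (U (slow_sin w) 1 t x).
Proof.
intros Ht Hw Hwt.
destruct (U1_sin w t Ht Hwt) as [kappa [Hk HS]].
assert (Hg : lint (fun y => / (2 * t) * (y ^ 2 * heat t y)) 1).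
{ replace 1 with (/ (2 * t) * (2 * t)) by (field; lra).
  apply lint_scal, lint_heat_sqr, Ht. }
(* [g y] equals [Rabs (y * hk 1 t y)] and has mass 1: one factor [y] comes from [slow_diff], the
   other from the kernel. *)
set (g := fun y => / (2 * t) * (y ^ 2 * heat t y)) in *.
assert (Hi : 0 < / (2 * t)) by (apply Rinv_0_lt_compat; lra).
assert (g0 : forall y, 0 <= g y).
{ intros y; apply Rmult_le_pos; [lra |]; apply Rmult_le_pos; [apply pow2_ge_0 |].
  apply Rlt_le, heat_pos, Ht. }
(* The main term is at least [w * / 2 * / 2 = w / 4] and the error at most [2 e = w / 8], which
   leaves [w / 8]. *)
set (e := w / 16).
assert (He : 0 < e) by (unfold e; lra).
destruct (lint_dominated_small g (fun y => e * g y) 1 (e * 1) e Hg) as [A [HA0 HA]].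
{ now apply lint_scal. } { intros y; apply Rmult_le_pos; [lra | apply g0]. } { exact He. }
destruct (slow_small e He) as [X [HX1 HX]].
exists (X + A); intros x Hx Hcos.
assert (B := slow_bounds x).
assert (L1 := U_spec_translate _ _ (slow_sin_bounded_continuous w) 1 t x Ht).
assert (L2 := U_spec_translate _ _ (sin_bounded_continuous w) 1 t x Ht).
assert (L := lint_lin _ _ (/ slow x) (-1) _ _ L1 L2).
assert (Hh : forall y, / slow x * (slow_sin w (x - y) * hk 1 t y) +
    -1 * (sin (w * (x - y)) * hk 1 t y) =
    (/ slow x * (slow (x - y) - slow x)) * (sin (w * (x - y)) * hk 1 t y)).
{ intros y; unfold slow_sin; field; lra. }
assert (Hd : forall y, Rabs ((/ slow x * (slow (x - y) - slow x)) * (sin (w * (x - y)) * hk 1 t y))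
    <= slow (x - y) * g y).
{ intros y; rewrite !Rabs_mult, hk_1.
  assert (D := slow_diff x (x - y)); replace (x - (x - y)) with y in D by ring.
  assert (P := heat_pos t y Ht).
  assert (Sb := proj2 (sin_bounded_continuous w) (x - y)); simpl in Sb.
  rewrite (Rabs_right (/ slow x)) by (apply Rle_ge, Rlt_le, Rinv_0_lt_compat; lra).
  unfold Rdiv; rewrite Rabs_mult, Rabs_Ropp, Rabs_mult, (Rabs_right (heat t y)),
    (Rabs_right (/ (2 * t))) by lra.
  apply Rle_trans with (slow (x - y) * Rabs y * (1 * (Rabs y * heat t y * / (2 * t)))).
  - assert (Py := Rabs_pos y).
    apply Rmult_le_compat.
    + apply Rmult_le_pos; [apply Rlt_le, Rinv_0_lt_compat; lra | apply Rabs_pos].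
    + apply Rmult_le_pos; [apply Rabs_pos |]; apply Rmult_le_pos; [apply Rmult_le_pos |]; lra.
    + apply (Rmult_le_compat_l (/ slow x)) in D; [| apply Rlt_le, Rinv_0_lt_compat; lra].
      apply Rle_trans with (1 := D); right; field; lra.
    + apply Rmult_le_compat_r; [| exact Sb].
      apply Rmult_le_pos; [apply Rmult_le_pos |]; lra.
  - unfold g; rewrite <- (pow2_abs y); right; ring. }
assert (Hfar : Rabs (/ slow x * U (slow_sin w) 1 t x + -1 * U (fun x => sin (w * x)) 1 t x)
    <= e * 1 + e).
{ apply (HA _ _ L); intros y; [| intros Hy]; rewrite Hh; apply Rle_trans with (1 := Hd y).
  - rewrite <- (Rmult_1_l (g y)) at 2; apply Rmult_le_compat_r; [apply g0 | apply slow_bounds].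
  - apply Rmult_le_compat_r; [apply g0 |]; apply HX; rewrite Rabs_right; lra. }
rewrite HS in Hfar.
assert (Hmain : w / 4 <= Rabs (w * kappa * cos (w * x))).
{ rewrite Rabs_mult, (Rabs_right (w * kappa)) by nra.
  assert (w / 2 <= w * kappa) by nra; nra. }
set (u := U (slow_sin w) 1 t x) in *.
assert (Htri : Rabs (w * kappa * cos (w * x)) <=
  Rabs (/ slow x * u) + Rabs (/ slow x * u + -1 * (w * kappa * cos (w * x)))).
{ replace (w * kappa * cos (w * x)) with
    (/ slow x * u + - (/ slow x * u + -1 * (w * kappa * cos (w * x)))) at 1 by ring.
  apply Rle_trans with (1 := Rabs_triang _ _); rewrite Rabs_Ropp; lra. }
assert (Hu : w / 8 <= Rabs (/ slow x * u)) by (unfold e in *; lra).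
rewrite Rabs_mult, Rabs_right in Hu by (apply Rle_ge, Rlt_le, Rinv_0_lt_compat; lra).
apply (Rmult_le_compat_r (slow x)) in Hu; [| lra].
replace (/ slow x * Rabs u * slow x) with (Rabs u) in Hu by (field; lra); exact Hu.
Qed.

Lemma cos_half (j : nat) (x : R) :
  INR j * PI <= x <= INR j * PI + PI / 3 -> / 2 <= Rabs (cos x).
Proof.
revert x; induction j as [| j IH]; intros x Hx.
- simpl in Hx; assert (HP := PI_RGT_0).
  apply Rle_trans with (2 := Rle_abs _); replace (/ 2) with (1 / 2) by field.
  rewrite <- cos_PI3; apply cos_decr_1; lra.
- rewrite S_INR in Hx; replace x with (x - PI + PI) by ring.
  rewrite neg_cos, Rabs_Ropp; apply IH; lra.
Qed.

(** Let [L] be the reciprocal of [slow z] at [z = a * m ^ 2]. Then [L ^ (4 n)] is at most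
    [(4 n)! * exp L], which is of order [z ^ 2], that is [m ^ 4]; the exponent [4 n] is chosen so
    that the fourth root is linear in [m]. *)
Lemma slow_pow_growth (n : nat) (a : R) : 0 < a ->
  exists C, 0 < C /\ forall m : nat, (1 <= m)%nat ->
    (/ slow (a * (INR m * INR m))) ^ n <= C * INR m.
Proof.
intros Ha.
set (C1 := exp 1 * INR (fact (4 * n)) * (1 + a * a)).
assert (P1 := exp_pos 1); assert (P2 := INR_fact_lt_0 (4 * n)).
assert (HC1 : 0 < C1) by (apply Rmult_lt_0_compat; nra).
exists (1 + C1); split; [lra |]; intros m Hm.
assert (Hm1 : 1 <= INR m) by (apply (le_INR 1), Hm).
set (z := a * (INR m * INR m)).
assert (HL := slow_den_ge_1 z); unfold slow; rewrite Rinv_inv.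
set (L := 1 + ln (1 + z * z)) in *.
assert (HE : exp L = exp 1 * (1 + z * z)) by (unfold L; rewrite exp_plus, exp_ln by nra; ring).
assert (T : L ^ (4 * n) <= INR (fact (4 * n)) * exp L).
{ apply pow_le_fact_exp; lra. }
rewrite HE in T.
assert (T2 : L ^ (4 * n) <= C1 * INR m ^ 4).
{ apply Rle_trans with (1 := T); unfold C1.
  replace (INR (fact (4 * n)) * (exp 1 * (1 + z * z)))
    with (exp 1 * INR (fact (4 * n)) * (1 + z * z)) by ring.
  rewrite (Rmult_assoc (exp 1 * INR (fact (4 * n))) (1 + a * a)).
  apply Rmult_le_compat_l; [nra |].
  assert (1 <= INR m ^ 4) by now apply pow_R1_Rle.
  unfold z; nra. }
rewrite Nat.mul_comm, pow_mult in T2.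
apply Rnot_lt_le; intros Hc.
assert (P : 0 < (1 + C1) * INR m) by nra.
assert (Q : ((1 + C1) * INR m) ^ 4 <= (L ^ n) ^ 4) by (apply pow_incr; lra).
rewrite Rpow_mult_distr in Q.
assert (1 + C1 <= (1 + C1) ^ 4).
{ rewrite <- (pow_1 (1 + C1)) at 1.
  apply Rle_pow; [lra | lia]. }
assert (0 < INR m ^ 4) by (apply pow_lt; lra).
nra.
Qed.

Lemma slow_decr (x y : R) : 0 <= x <= y -> slow y <= slow x.
Proof.
intros H; assert (A := slow_den_ge_1 x); unfold slow; apply Rinv_le_contravar; [lra |].
apply Rplus_le_compat_l, ln_le; nra.
Qed.

(** The blocks are the first thirds of the half-periods of length [PI / w], where the cosine is at
    least [1 / 2] in size. Up to [s * M ^ 2] there are [M ^ 2] of them, and by [slow_pow_growth]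
    each weighs at least a constant over [M], so the total grows like [M]. *)
Lemma U1_slow_sin_blocks (w t : R) (n : nat) : 0 < t -> 0 < w -> w * w * t <= / 2 ->
  forall B : R, exists (c d s a : R) (N : nat), (0 < c <= 1) /\ 0 < d /\ d < s /\
    (forall (j : nat) x, (j < N)%nat -> a + INR j * s <= x <= a + INR j * s + d ->
       c <= Rabs (U (slow_sin w) 1 t x)) /\
    B < INR N * (d * c ^ n).
Proof.
intros Ht Hw Hwt B.
destruct (U1_slow_sin_lower w t Ht Hw Hwt) as [X HX].
assert (HP := PI_RGT_0).
assert (Hs : 0 < PI / w) by now apply Rdiv_lt_0_compat.
set (s := PI / w) in *; set (d := s / 3).
destruct (slow_pow_growth n s Hs) as [C [HC HG]].
destruct (INR_unbounded (X / s)) as [J HJ].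
assert (HJX : X <= INR J * s) by (apply Rle_div_l; lra).
(* The cap at 1 ensures [c <= 1], so that later [c ^ n] is a lower bound for the real power of
   exponent [p <= n]. *)
set (v := Rmin (w / 8) 1).
assert (Hv : 0 < v) by (apply Rmin_glb_lt; lra).
set (K := d * v ^ n / C).
assert (Hvn : 0 < v ^ n) by now apply pow_lt.
assert (Hd : 0 < d) by (unfold d; lra).
assert (HK : 0 < K) by (apply Rdiv_lt_0_compat; [apply Rmult_lt_0_compat |]; lra).
(* The [J] half-periods where the lower bound is not yet valid are discarded; the remaining total is
   at least [(M - J / M) * K], which exceeds [Rabs B] for this [M]. *)
destruct (INR_unbounded (INR J + 1 + Rabs B / K)) as [M HM].
assert (HBK : 0 <= Rabs B / K) by (apply Rmult_le_pos; [apply Rabs_pos | apply Rlt_le, Rinv_0_lt_compat, HK]).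
assert (PJ := pos_INR J).
assert (HMJ : (J < M)%nat) by (apply INR_lt; lra).
assert (HM1 : 1 <= INR M) by lra.
set (z := s * (INR M * INR M)).
assert (Sz := slow_bounds z).
assert (HN : INR (M * M - J) = INR M * INR M - INR J).
{ rewrite minus_INR, mult_INR by nia; reflexivity. }
exists (v * slow z), d, s, (INR J * s), (M * M - J)%nat.
assert (Hv1 : v <= 1) by apply Rmin_r.
assert (Hv2 : v <= w / 8) by apply Rmin_l.
split; [nra |]; split; [exact Hd |]; split; [unfold d; lra |]; split.
- intros j x Hj Hx.
  assert (Hjr : INR j + 1 <= INR (M * M - J)) by (rewrite <- S_INR; apply le_INR; lia).
  assert (Pj := pos_INR j).
  assert (Hxz : 0 <= x <= z) by (unfold z, d in *; nra).
  apply Rle_trans with (w / 8 * slow x).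
  + apply Rmult_le_compat; try lra; now apply slow_decr.
  + apply HX; [nra |].
    apply (cos_half (J + j)); rewrite plus_INR.
    assert (Ew : PI = w * s) by (unfold s; field; lra).
    rewrite Ew; unfold d in Hx; nra.
- rewrite HN, Rpow_mult_distr.
  assert (G := HG M ltac:(lia)); fold z in G.
  rewrite pow_inv in G.
  assert (Szn : 0 < slow z ^ n) by (apply pow_lt; lra).
  assert (G' : / (C * INR M) <= slow z ^ n).
  { rewrite <- (Rinv_inv (slow z ^ n)); apply Rinv_le_contravar; [now apply Rinv_0_lt_compat | exact G]. }
  assert (Hpos : 0 <= INR M * INR M - INR J) by nra.
  apply Rlt_le_trans with ((INR M * INR M - INR J) * (d * (v ^ n * / (C * INR M)))).
  + replace ((INR M * INR M - INR J) * (d * (v ^ n * / (C * INR M))))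
      with ((INR M - INR J / INR M) * K) by (unfold K; field; lra).
    assert (HJM : INR J / INR M <= INR J) by (apply Rle_div_l; nra).
    apply Rle_lt_trans with (1 := Rle_abs B).
    replace (Rabs B) with (Rabs B / K * K) by (field; lra).
    apply Rmult_lt_compat_r; lra.
  + apply Rmult_le_compat_l; [exact Hpos |]; apply Rmult_le_compat_l; [lra |].
    apply Rmult_le_compat_l; [lra | exact G'].
Qed.

(** * Lower bounds for Lebesgue integrals from equally spaced blocks *)

Module LpBlocks.
From mathcomp Require Import all_boot all_order all_algebra.
From mathcomp Require Import all_classical all_reals all_analysis Rstruct Rstruct_topology.
From mathcomp Require Import measurable_realfun.

Module Blocks.
Import Order.TTheory GRing.Theory Num.Theory.
Local Open Scope ring_scope.
Local Open Scope classical_set_scope.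

(** Induction on the number of blocks, with [a] general: the first block is disjoint from the
    half-line starting at [a + s] because [d < s], and the other blocks lie in that half-line. *)
Lemma integral_blocks_ge (R : realType) (f : measurableTypeR R -> \bar R) (c d s : R) (N : nat) (a : R) :
  measurable_fun [set: measurableTypeR R] f -> (forall x, (0 <= f x)%E) -> 0 <= c -> 0 < d -> d < s ->
  (forall (j : nat) x, (j < N)%N -> a + j%:R * s <= x <= a + j%:R * s + d -> (c%:E <= f x)%E) ->
  ((N%:R * (d * c))%:E <= \int[@lebesgue_measure R]_(x in `[a, +oo[) f x)%E.
Proof.
move=> mf f0 c0 d0 ds; elim: N a => [|N IH] a H.
  by rewrite mul0r; apply: integral_ge0.
have mfD (D : set (measurableTypeR R)) : measurable_fun D f by apply: measurable_funS mf.
pose E1 : set (measurableTypeR R) := `[a, a + d].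
pose E2 : set (measurableTypeR R) := `[a + s, +oo[.
have E1P (x : R) : E1 x -> a <= x <= a + d by rewrite /E1 /= in_itv.
have E2P (x : R) : E2 x -> a + s <= x by rewrite /E2 /= in_itv /= andbT.
have mE1 : measurable E1 by exact: measurable_itv.
have mE2 : measurable E2 by exact: measurable_itv.
have sub : E1 `|` E2 `<=` `[a, +oo[.
  move=> x [/E1P/andP[ax _] | /E2P ax]; rewrite /= in_itv /= andbT //.
  by apply: le_trans ax; rewrite lerDl; apply/ltW/(lt_trans d0).
have dj : [disjoint E1 & E2].
  apply/disj_setPS => x [/E1P/andP[_ h1] /E2P h2].
  by move: (le_trans h2 h1); rewrite lerD2l leNgt ds.
apply: (@le_trans _ _
    (\int[@lebesgue_measure R]_(x in E1 `|` E2) f x)%E); last first.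
  by apply: ge0_subset_integral => //; exact: measurableU.
rewrite ge0_integral_setU //.
rewrite -[N.+1]add1n natrD mulrDl mul1r EFinD; apply: leeD.
  apply: (@le_trans _ _ (\int[@lebesgue_measure R]_(x in E1) (cst c%:E) x)%E).
    rewrite integral_cst //= lebesgue_measure_itv /= lte_fin ltrDl d0.
    by rewrite -EFinB -EFinM lee_fin addrAC subrr add0r mulrC.
  apply: ge0_le_integral => //= x /E1P xa.
  by apply: (H 0%N) => //; rewrite mul0r addr0.
apply: IH => j x jN xa; apply: (H j.+1) => //.
by rewrite -[j.+1]add1n natrD mulrDl mul1r addrA.
Qed.

(** [B] is taken to be the value of the supposedly finite integral. As [c <= 1] and [p <= n], the
    integrand is at least [c ^+ n] on every block, so an integer exponent serves for real [p]. *)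
Lemma not_integrable_blocks (R : realType) (h : measurableTypeR R -> measurableTypeR R) (p : R) (n : nat) :
  measurable_fun [set: measurableTypeR R] h -> 0 <= p <= n%:R ->
  (forall B : R, exists (c d s a : R) (N : nat), [/\ 0 < c <= 1, 0 < d, d < s,
    forall (j : nat) x, (j < N)%N -> a + j%:R * s <= x <= a + j%:R * s + d -> c <= `|h x|
    & B < N%:R * (d * c ^+ n)]) ->
  ~ (\int[@lebesgue_measure R]_(x in [set: R]) ((`|h x| `^ p)%:E) < +oo)%E.
Proof.
move=> mh /andP[p0 pn] H fin.
pose f (x : measurableTypeR R) : \bar R := (`|h x| `^ p)%:E.
have f0 x : (0 <= f x)%E by rewrite lee_fin powR_ge0.
have mf : measurable_fun [set: measurableTypeR R] f.
  apply/measurable_EFinP; apply: (measurableT_comp (measurable_powR p)).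
  exact: (measurableT_comp (@normr_measurable R setT)).
have I0 : (0 <= \int[@lebesgue_measure R]_(x in [set: R]) f x)%E by apply: integral_ge0.
have [c [d [s [a [N [/andP[c0 c1] d0 ds Hc HB]]]]]] :=
  H (fine (\int[@lebesgue_measure R]_(x in [set: R]) f x)%E).
have := @integral_blocks_ge R f (c ^+ n) d s N a mf f0 (exprn_ge0 _ (ltW c0)) d0 ds.
have Hf (j : nat) x : (j < N)%N -> a + j%:R * s <= x <= a + j%:R * s + d -> ((c ^+ n)%:E <= f x)%E.
  move=> jN xa; rewrite /f lee_fin -powR_mulrn; last exact: ltW.
  apply: (@le_trans _ _ (c `^ p)); first by apply: ger_powR => //; rewrite c0.
  apply: ge0_ler_powR => //; last exact: (Hc j x jN xa).
  by rewrite nnegrE ltW.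
move=> /(_ Hf) L.
have : ((N%:R * (d * c ^+ n))%:E <= \int[@lebesgue_measure R]_(x in [set: R]) f x)%E.
  apply: le_trans L _; apply: ge0_subset_integral => //.
rewrite -[X in (_ <= X)%E]fineK ?ge0_fin_numE // lee_fin leNgt.
by rewrite HB.
Qed.
End Blocks.

Local Open Scope R_scope.

(** A translation between the two formalisations of the reals. Measurability of [h] is supplied by
    the membership that is being refuted. *)
Lemma not_InLp_blocks (h : R -> R) (p : R) (n : nat) : 0 <= p <= INR n ->
  (forall B : R, exists (c d s a : R) (N : nat), (0 < c <= 1) /\ 0 < d /\ d < s /\
    (forall (j : nat) x, (j < N)%coq_nat ->
       a + INR j * s <= x <= a + INR j * s + d -> c <= Rabs (h x)) /\
    B < INR N * (d * c ^ n)) ->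
  ~ InLp p h.
Proof.
move=> [p0 pn] H [mh].
apply: (@Blocks.not_integrable_blocks R h p n mh).
  by apply/andP; split; [apply/RleP | rewrite -INRE; apply/RleP].
move=> B; have [c [d [s [a [N [[c0 c1] [d0 [ds [Hc HB]]]]]]]]] := H B.
exists c, d, s, a, N; split.
- by apply/andP; split; [apply/RltP | apply/RleP].
- exact/RltP.
- exact/RltP.
- move=> j x /ltP jN /andP[/RleP x1 /RleP x2].
  apply/RleP; apply: (Hc j x jN); rewrite INRE; split; assumption.
- by rewrite -INRE -RpowE; apply/RltP.
Qed.
End LpBlocks.

(** * Convolution with elements of the Alexiewicz space *)

Lemma InBc_lim (F : R -> R) : InBc F -> is_lim F p_infty (Finf F).
Proof. intros [[_ [[a Ha] _]] _]; now rewrite (Finf_lim F a Ha). Qed.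

Lemma InBc_tails (F : R -> R) (eps : R) : InBc F -> 0 < eps ->
  exists M, 0 < M /\ forall x, (M < x -> Rabs (F x - Finf F) < eps) /\
                               (x < - M -> Rabs (F x) < eps).
Proof.
intros HF He; assert (Lp := InBc_lim F HF); destruct HF as [_ Lm].
destruct (proj1 (is_lim_pinfty_spec _ _) Lp eps He) as [M1 H1].
destruct (proj1 (is_lim_minfty_spec _ _) Lm eps He) as [M2 H2].
exists (Rmax 1 (Rmax M1 (- M2))).
assert (A0 := Rmax_l 1 (Rmax M1 (- M2))); assert (A1 := Rmax_r 1 (Rmax M1 (- M2))).
assert (A2 := Rmax_l M1 (- M2)); assert (A3 := Rmax_r M1 (- M2)).
split; [lra |]; intros x; split; intros Hx.
- apply H1; lra.
- rewrite <- (Rminus_0_r (F x)); apply H2; lra.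
Qed.

Lemma InBc_continuity_pt (F : R -> R) (x : R) : InBc F -> continuity_pt F x.
Proof. intros [[Hc _] _]; apply continuity_pt_filterlim, Hc. Qed.

Lemma InBc_bounded (F : R -> R) : InBc F -> exists B, bounded_continuous F B.
Proof.
intros HF; destruct (InBc_tails F 1 HF Rlt_0_1) as [M [HM HT]].
destruct (continuity_ab_maj F (- M) M) as [xM [HxM _]]; [lra | |].
{ intros; now apply InBc_continuity_pt. }
destruct (continuity_ab_min F (- M) M) as [xm [Hxm _]]; [lra | |].
{ intros; now apply InBc_continuity_pt. }
exists (Rabs (Finf F) + 1 + Rabs (F xM) + Rabs (F xm)); split; [apply HF |]; intros x.
assert (P1 := Rabs_pos (Finf F)); assert (P2 := Rabs_pos (F xM)); assert (P3 := Rabs_pos (F xm)).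
destruct (Rlt_dec x (- M)) as [H1 | H1]; [apply HT in H1; lra |].
destruct (Rlt_dec M x) as [H2 | H2].
- apply HT in H2; assert (A := Rabs_triang_inv (F x) (Finf F)); lra.
- specialize (HxM x ltac:(lra)); specialize (Hxm x ltac:(lra)).
  assert (A := Rle_abs (F xM)); assert (A' := Rle_abs (- F xm)); rewrite Rabs_Ropp in A'.
  apply Rabs_le; lra.
Qed.

(** Heine's theorem on [[- M - 1, M + 1]] and the limits on the tails. The regions overlap by a
    width of 1, so two points closer than 1 always share one of them. *)
Lemma InBc_uniformly_continuous (F : R -> R) (eps : R) : InBc F -> 0 < eps ->
  exists d, 0 < d /\ forall x y, Rabs (x - y) < d -> Rabs (F x - F y) < eps.
Proof.
intros HF He; destruct (InBc_tails F (eps / 2) HF ltac:(lra)) as [M [HM HT]].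
assert (HC : forall x, - M - 1 <= x <= M + 1 -> continuity_pt F x).
{ intros; now apply InBc_continuity_pt. }
destruct (Heine_cor2 HC (mkposreal eps He)) as [d Hd].
simpl in Hd; assert (Hd0 := cond_pos d).
exists (Rmin 1 d); split; [apply Rmin_glb_lt; lra |]; intros x y Hxy.
assert (A1 := Rmin_l 1 d); assert (A2 := Rmin_r 1 d).
assert (Hxy' : Rabs (x - y) < d) by lra.
assert (Hxy1 : Rabs (x - y) < 1) by lra.
apply Rabs_def2 in Hxy1.
destruct (Rle_dec (- M - 1) x) as [x1 | x1]; [destruct (Rle_dec (- M - 1) y) as [y1 | y1] |].
- destruct (Rle_dec x (M + 1)) as [x2 | x2]; [destruct (Rle_dec y (M + 1)) as [y2 | y2] |].
  + now apply Hd.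
  + assert (B1 := proj1 (HT x) ltac:(lra)); assert (B2 := proj1 (HT y) ltac:(lra)).
    apply Rabs_def2 in B1; apply Rabs_def2 in B2; apply Rabs_def1; lra.
  + assert (B1 := proj1 (HT x) ltac:(lra)); assert (B2 := proj1 (HT y) ltac:(lra)).
    apply Rabs_def2 in B1; apply Rabs_def2 in B2; apply Rabs_def1; lra.
- assert (B1 := proj2 (HT x) ltac:(lra)); assert (B2 := proj2 (HT y) ltac:(lra)).
  apply Rabs_def2 in B1; apply Rabs_def2 in B2; apply Rabs_def1; lra.
- assert (B1 := proj2 (HT x) ltac:(lra)); assert (B2 := proj2 (HT y) ltac:(lra)).
  apply Rabs_def2 in B1; apply Rabs_def2 in B2; apply Rabs_def1; lra.
Qed.

Lemma InBc_lin (F G : R -> R) (a b : R) : InBc F -> InBc G -> InBc (fun y => a * F y + b * G y).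
Proof.
intros HF HG.
assert (Lm : is_lim (fun y => a * F y + b * G y) m_infty 0).
{ eapply is_lim_val; [apply is_lim_lin; [apply HF | apply HG] | ring]. }
split; [split; [| split] | exact Lm].
- intros x; apply @continuous_plus; apply @continuous_scal_r; [apply HF | apply HG].
- eexists; apply is_lim_lin; apply InBc_lim; assumption.
- eexists; exact Lm.
Qed.

(** [real] sends an infinite supremum to 0. The element [r0] excludes minus infinity and the bound
    [c] excludes plus infinity. *)
Lemma real_lub_bounds (E : R -> Prop) (r0 c : R) : E r0 -> (forall r, E r -> r <= c) ->
  (forall r, E r -> r <= real (Lub_Rbar E)) /\ real (Lub_Rbar E) <= c.
Proof.
intros H0 Hc; destruct (Lub_Rbar_correct E) as [Hub Hlub].
assert (A := Hub r0 H0); assert (B := Hlub (Finite c) (fun r Hr => Hc r Hr)).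
destruct (Lub_Rbar E) as [l | |]; simpl in *; try contradiction.
split; [intros r Hr; exact (Hub r Hr) | exact B].
Qed.

Lemma real_lub_eq (E : R -> Prop) (l : R) : (forall r, E r -> r <= l) ->
  (forall c, c < l -> exists r, E r /\ c < r) -> real (Lub_Rbar E) = l.
Proof.
intros Hub Hl.
destruct (Hl (l - 1) ltac:(lra)) as [r0 [H0 _]].
destruct (real_lub_bounds E r0 l H0 Hub) as [A B].
apply Rle_antisym; [exact B |]; apply Rnot_lt_le; intros H.
destruct (Hl _ H) as [r [Hr Hr']]; specialize (A r Hr); lra.
Qed.

Lemma alex_le (F : R -> R) (c : R) : (forall x y, x < y -> Rabs (F y - F x) <= c) -> alex F <= c.
Proof.
intros H; apply (real_lub_bounds _ (Rabs (F 1 - F 0)) c).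
- exists 0, 1; split; [lra | reflexivity].
- intros r [x [y [Hxy ->]]]; now apply H.
Qed.

Lemma alex_ub (F : R -> R) (B : R) : bounded_continuous F B ->
  forall x y, Rabs (F y - F x) <= alex F.
Proof.
intros [_ HB].
destruct (real_lub_bounds (fun r => exists x y, x < y /\ r = Rabs (F y - F x))
  (Rabs (F 1 - F 0)) (2 * B)) as [H _].
- exists 0, 1; split; [lra | reflexivity].
- intros r [x [y [_ ->]]]; apply Rle_trans with (1 := Rabs_triang _ _); rewrite Rabs_Ropp.
  assert (A1 := HB x); assert (A2 := HB y); lra.
- assert (H' : forall x y, x < y -> Rabs (F y - F x) <= alex F).
  { intros x y Hxy; apply H; now exists x, y. }
  intros x y; destruct (Rtotal_order x y) as [Hxy | [-> | Hxy]].
  + now apply H'.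
  + rewrite Rminus_diag, Rabs_R0; apply Rle_trans with (2 := H' 0 1 Rlt_0_1), Rabs_pos.
  + rewrite Rabs_minus_sym; now apply H'.
Qed.

Lemma alex_nonneg (F : R -> R) (B : R) : bounded_continuous F B -> 0 <= alex F.
Proof. intros HF; apply Rle_trans with (2 := alex_ub F B HF 0 0), Rabs_pos. Qed.

Lemma supnorm_le (h : R -> R) (c : R) : (forall x, Rabs (h x) <= c) ->
  (forall x, Rabs (h x) <= supnorm h) /\ supnorm h <= c.
Proof.
intros H; destruct (real_lub_bounds (fun r => exists x, r = Rabs (h x)) (Rabs (h 0)) c) as [A B].
- now exists 0.
- intros r [x ->]; apply H.
- split; [intros x; apply A; now exists x | exact B].
Qed.

Section Convolution.
Context (F : R -> R) (HF : InBc F).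

(** The kernel vanishes at infinity, so the boundary term drops out; the minus sign of the
    definition cancels the one from differentiating [heat t (x - xi)] in [xi]. *)
Lemma conv_int_fg (t x : R) : 0 < t ->
  int_fg F (fun xi => heat t (x - xi)) (U F 1 t x).
Proof.
intros Ht; destruct (InBc_bounded F HF) as [B HB].
assert (L : is_lim (fun xi => heat t (x - xi)) p_infty 0).
{ apply (is_lim_ext (fun xi => heat t (1 * xi + - x))).
  { intros y; rewrite <- heat_even; f_equal; ring. }
  apply is_lim_affine; [lra | apply (hk_lim 0 t Ht)]. }
replace (U F 1 t x) with (Finf F * 0 - -1 * U F 1 t x) by ring.
apply (int_fg_lint F _ (fun xi => - hk 1 t (x - xi))); [now apply InBc_lim | exact L | |].
- intros xi; apply (is_derive_eq (fun xi => heat t (1 * xi + - x))).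
  { intros y; rewrite <- heat_even; f_equal; ring. }
  eapply is_derive_val; [apply is_derive_affine, (hk_derive_x 0), Ht |].
  rewrite <- hk1_odd; replace (- (x - xi)) with (1 * xi + - x) by ring; ring.
- assert (A := lint_scal _ (-1) _ (U_spec F B HB 1 t x Ht)).
  revert A; apply lint_ext; intros; ring.
Qed.

(** The constant [Finf F] in the reflected primitive contributes only [Finf F] times the integral of
    [hk 1 t], which is 0. *)
Lemma conv_rev_int_fg (t x : R) : 0 < t -> int_fg (refl_prim F x) (heat t) (U F 1 t x).
Proof.
intros Ht; destruct (InBc_bounded F HF) as [B HB].
replace (U F 1 t x) with (Finf F * 0 - (Finf F * 0 - U F 1 t x)) by ring.
apply (int_fg_lint _ _ (hk 1 t)).
- apply (is_lim_ext (fun xi => 1 * Finf F + (-1) * F (- (1 * xi + - x)))).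
  { intros xi; unfold refl_prim; replace (- (1 * xi + - x)) with (x - xi) by ring; ring. }
  eapply is_lim_val.
  + apply is_lim_lin; [apply is_lim_const |].
    apply (is_lim_affine (fun y => F (- y)) 1 (- x) 0); [lra |].
    apply -> is_lim_opp_arg'; apply HF.
  + ring.
- apply (hk_lim 0 t Ht).
- intros y; apply (hk_derive_x 0), Ht.
- assert (A := lint_minus _ _ _ _ (lint_scal _ (Finf F) _ (lint_hk_S 0 t Ht))
    (U_spec_translate F B HB 1 t x Ht)).
  revert A; apply lint_ext; intros y; unfold refl_prim; ring.
Qed.

Lemma conv_U (t : R) : 0 < t -> conv F t = U F 1 t.
Proof.
intros Ht; apply functional_extensionality; intros x.
apply (int_fg_unique F (fun xi => heat t (x - xi))); [| now apply conv_int_fg].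
unfold conv; apply epsilon_spec; eexists; now apply conv_int_fg.
Qed.

Lemma conv_rev_U (t x : R) : 0 < t -> conv_rev F t x = U F 1 t x.
Proof.
intros Ht.
apply (int_fg_unique (refl_prim F x) (heat t)); [| now apply conv_rev_int_fg].
unfold conv_rev; apply epsilon_spec; eexists; now apply conv_rev_int_fg.
Qed.

Lemma int_fun_U (n : nat) (t x : R) : 0 < t ->
  int_fun (fun xi => F xi * hk n t (x - xi)) (U F n t x).
Proof.
intros Ht; destruct (InBc_bounded F HF) as [B HB]; apply int_fun_lint.
- intros y; now apply (U_integrand_continuous F B HB).
- now apply (U_spec F B HB).
Qed.

Lemma Fconv_U (t : R) : 0 < t -> Fconv F t = U F 0 t.
Proof.
intros Ht; apply functional_extensionality; intros x.
apply (int_fun_unique (fun xi => F xi * heat t (x - xi))); [| now apply (int_fun_U 0)].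
unfold Fconv; apply epsilon_spec; eexists; now apply (int_fun_U 0).
Qed.

Lemma U0_lim (t : R) : 0 < t ->
  is_lim (U F 0 t) p_infty (Finf F) /\ is_lim (U F 0 t) m_infty 0.
Proof.
intros Ht; destruct (InBc_bounded F HF) as [B HB]; split.
- replace (Finf F) with (Finf F * 1) by ring.
  apply (U_lim_pinfty F B HB); [exact Ht | now apply lint_heat | now apply InBc_lim].
- replace 0 with (0 * 1) by ring.
  apply (U_lim_minfty F B HB); [exact Ht | now apply lint_heat | apply HF].
Qed.

Lemma U1_lim (t : R) : 0 < t -> is_lim (U F 1 t) p_infty 0 /\ is_lim (U F 1 t) m_infty 0.
Proof.
intros Ht; destruct (InBc_bounded F HF) as [B HB]; split.
- replace 0 with (Finf F * 0) by ring.
  apply (U_lim_pinfty F B HB); [exact Ht | now apply lint_hk_S | now apply InBc_lim].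
- replace 0 with (0 * 0) by ring.
  apply (U_lim_minfty F B HB); [exact Ht | now apply lint_hk_S | apply HF].
Qed.

Lemma prim_of_conv (t : R) : 0 < t -> prim_of (conv F t) (U F 0 t).
Proof.
intros Ht; destruct (InBc_bounded F HF) as [B HB]; rewrite conv_U by exact Ht.
destruct (U0_lim t Ht) as [Lp Lm]; apply (prim_of_classical _ _ (Finf F)); auto.
- intros x; now apply (U_derive_x F B HB).
- intros x; now apply (U_continuous_x F B HB).
Qed.

Lemma prim_conv (t : R) : 0 < t -> prim (conv F t) = U F 0 t.
Proof. intros Ht; apply functional_extensionality, prim_eq, prim_of_conv, Ht. Qed.

Lemma conv_in_Cbar (t : R) : 0 < t -> in_Cbar (conv F t).
Proof.
intros Ht; destruct (InBc_bounded F HF) as [B HB]; rewrite conv_U by exact Ht.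
destruct (U1_lim t Ht) as [Lp Lm]; split; [| split; eexists; eassumption].
intros x; now apply (U_continuous_x F B HB).
Qed.

Lemma conv_bound (t x : R) : 0 < t -> Rabs (conv F t x) <= alex F / (2 * sqrt (PI * t)).
Proof.
intros Ht; destruct (InBc_bounded F HF) as [B HB]; rewrite conv_U by exact Ht.
apply (U1_osc_bound F B HB); [exact Ht |]; intros a b; now apply (alex_ub F B).
Qed.

Lemma alex_U0_le (t : R) : 0 < t -> alex (U F 0 t) <= alex F.
Proof.
intros Ht; destruct (InBc_bounded F HF) as [B HB]; apply alex_le; intros x y _.
apply (U0_osc_bound F B HB); [exact Ht |]; intros a b; now apply (alex_ub F B).
Qed.

(** A space derivative raises the index of [U] by one and a time derivative by two, so every mixed
    partial derivative is again some [U F n]. *)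
Lemma conv_pdl (l : list bool) :
  exists n, forall x t, 0 < t -> pdl l (fun x t => conv F t x) x t = U F n t x.
Proof.
destruct (InBc_bounded F HF) as [B HB].
induction l as [| b l [n IH]].
- exists 1%nat; intros x t Ht; simpl; now rewrite conv_U.
- destruct b; simpl.
  + exists (S n); intros x t Ht.
    rewrite (Derive_ext _ (U F n t)) by (intros; now apply IH).
    now apply is_derive_unique, (U_derive_x F B HB).
  + exists (S (S n)); intros x t Ht.
    (* The identification with [U] holds for positive times only, so equality is available near [t]
       but not globally. *)
    rewrite (Derive_ext_loc _ (fun s => U F n s x)).
    * now apply is_derive_unique, (U_derive_t F B HB).
    * apply (filter_imp (fun s => 0 < s)); [intros s Hs; now apply IH |].
      now apply (open_gt 0 t).
Qed.

Lemma smooth_pointwise (v : R -> R -> R) (n : nat) (x t : R) :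
  (forall x t, 0 < t -> v x t = U F n t x) -> 0 < t ->
  cont2 v x t /\ forall b, ex_pd b v x t.
Proof.
intros E Ht; destruct (InBc_bounded F HF) as [B HB].
assert (Loc : locally t (fun s => 0 < s)) by now apply (open_gt 0 t).
split; [| intros [|]; simpl].
- apply (continuous_ext_loc _ (fun p : R * R => U F n (snd p) (fst p))).
  + destruct Loc as [d Hd]; exists d; intros [x' t'] [_ Ht']; simpl in *.
    symmetry; apply E, Hd, Ht'.
  + now apply (U_continuous2 F B HB).
- apply (ex_derive_ext (U F n t)); [intros; symmetry; now apply E |].
  eexists; now apply (U_derive_x F B HB).
- apply (ex_derive_ext_loc (fun s => U F n s x)).
  + apply (filter_imp (fun s => 0 < s)); [| exact Loc]; intros s Hs; symmetry; now apply E.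
  + eexists; now apply (U_derive_t F B HB).
Qed.

Lemma conv_smooth : smooth_on (fun x t => conv F t x) (fun _ t => 0 < t).
Proof.
intros l x t Ht; destruct (conv_pdl l) as [n E]; now apply (smooth_pointwise _ n).
Qed.

Lemma conv_heat_equation (x t : R) : 0 < t ->
  pd false (fun x t => conv F t x) x t
    - pd true (pd true (fun x t => conv F t x)) x t = 0.
Proof.
intros Ht; destruct (InBc_bounded F HF) as [B HB].
assert (D1 : forall y, pd true (fun x t => conv F t x) y t = U F 2 t y).
{ intros y; simpl; rewrite (Derive_ext _ (U F 1 t)) by (intros; now rewrite conv_U).
  now apply is_derive_unique, (U_derive_x F B HB). }
assert (D2 : pd true (pd true (fun x t => conv F t x)) x t = U F 3 t x).
{ transitivity (Derive (U F 2 t) x).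
  - exact (Derive_ext _ _ x D1).
  - now apply is_derive_unique, (U_derive_x F B HB). }
assert (D3 : pd false (fun x t => conv F t x) x t = U F 3 t x).
{ simpl; rewrite (Derive_ext_loc _ (fun s => U F 1 s x)).
  - now apply is_derive_unique, (U_derive_t F B HB).
  - apply (filter_imp (fun s => 0 < s)); [intros s Hs; now rewrite conv_U |].
    now apply (open_gt 0 t). }
rewrite D2, D3; ring.
Qed.

(** Uniform convergence of [U F 0 t] to [F] suffices, because the Alexiewicz norm is at most twice
    the supremum norm of the primitive. *)
Lemma conv_initial_value :
  filterlim (fun t => alex (fun y => prim (conv F t) y - F y)) (at_right 0) (locally 0).
Proof.
destruct (InBc_bounded F HF) as [B HB].
assert (PB := bounded_continuous_pos F B HB).
apply filterlim_locally; intros [eps He].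
destruct (InBc_uniformly_continuous F (eps / 8) HF) as [d [Hd Hu]]; [lra |].
assert (Hd2 : 0 < d ^ 2) by now apply pow_lt.
set (K := 2 * B / d ^ 2).
assert (HK : 0 <= K) by (apply Rmult_le_pos; [lra | apply Rlt_le, Rinv_0_lt_compat, Hd2]).
(* For [t] below this value [K * (2 * t) <= eps / 8]; the [+ 1] covers the case [K = 0]. *)
assert (He' : 0 < eps / (16 * (K + 1))) by (apply Rdiv_lt_0_compat; lra).
exists (mkposreal _ He'); intros t Bt Ht; simpl in Bt.
unfold ball in Bt; simpl in Bt; unfold AbsRing_ball, abs, minus, plus, opp in Bt; simpl in Bt.
rewrite Ropp_0, Rplus_0_r in Bt; rewrite Rabs_right in Bt by lra.
assert (HKt : K * (2 * t) <= eps / 8).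
{ apply Rlt_div_r in Bt; [nra | lra]. }
rewrite prim_conv by exact Ht.
assert (Hx : forall x, Rabs (U F 0 t x - F x) <= eps / 4).
{ intros x; apply Rle_trans with (eps / 8 + K * (2 * t)); [| lra].
  apply (U0_approx F B HB); try lra; intros y Hy; apply Rlt_le, Hu.
  replace (x - y - x) with (- y) by ring; now rewrite Rabs_Ropp. }
set (D := fun y => U F 0 t y - F y).
assert (HD : bounded_continuous D (eps / 4)).
{ split; [| exact Hx]; intros x; apply @continuous_minus; [| apply HB].
  now apply (U_continuous_x F B HB). }
assert (A : alex D <= eps / 2).
{ apply alex_le; intros x y _; apply Rle_trans with (1 := Rabs_triang _ _); rewrite Rabs_Ropp.
  assert (A1 := Hx x); assert (A2 := Hx y); unfold D; lra. }
assert (A0 := alex_nonneg D _ HD).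
unfold ball; simpl; unfold AbsRing_ball, abs, minus, plus, opp; simpl.
rewrite Ropp_0, Rplus_0_r, Rabs_right; lra.
Qed.

Lemma conv_integral (t : R) : 0 < t -> int_fun (conv F t) (Finf F).
Proof.
intros Ht; exists (U F 0 t); split; [now apply prim_of_conv |].
symmetry; now apply Finf_lim, U0_lim.
Qed.

End Convolution.

(** The inverse times [1 / s] and [1 / t] add up in the exponent. The constant is [heat (s + t) 0],
    so integrating over [x] gives the semigroup law at the origin. *)
Lemma heat_mult (s t x : R) : 0 < s -> 0 < t ->
  heat s x * heat t x = heat (s + t) 0 * heat (s * t / (s + t)) x.
Proof.
intros Hs Ht; assert (HP := PI_RGT_0); rewrite heat_0 by lra; unfold heat.
assert (Hst : 0 < s * t / (s + t)) by (apply Rdiv_lt_0_compat; nra).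
rewrite !sqrt_4PIt by assumption.
assert (Q1 := sqrt_PIt_pos s Hs); assert (Q2 := sqrt_PIt_pos t Ht).
assert (Q3 := sqrt_PIt_pos (s + t) ltac:(lra)); assert (Q4 := sqrt_PIt_pos _ Hst).
assert (E : sqrt (PI * s) * sqrt (PI * t) = sqrt (PI * (s + t)) * sqrt (PI * (s * t / (s + t)))).
{ rewrite <- !sqrt_mult by nra; f_equal; field; lra. }
replace (/ (2 * sqrt (PI * s)) * exp (- x ^ 2 / (4 * s)) *
         (/ (2 * sqrt (PI * t)) * exp (- x ^ 2 / (4 * t))))
  with (/ (4 * (sqrt (PI * s) * sqrt (PI * t))) *
        (exp (- x ^ 2 / (4 * s)) * exp (- x ^ 2 / (4 * t)))) by (field; lra).
rewrite E, <- exp_plus.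
replace (- x ^ 2 / (4 * s) + - x ^ 2 / (4 * t)) with (- x ^ 2 / (4 * (s * t / (s + t))))
  by (field; lra).
field; lra.
Qed.

Lemma heat_primitive (s : R) : 0 < s -> exists G, InBc G /\
  (forall x, is_derive G x (heat s x)) /\ is_lim G p_infty 1 /\ alex G <= 1.
Proof.
intros Hs; destruct (lint_heat s Hs) as [G [dG [mG pG]]]; exists G.
assert (Hb := lint_primitive_bounds _ _ _ dG mG pG (fun x => Rlt_le _ _ (heat_pos s x Hs))).
split; [| split; [exact dG | split; [exact pG |]]].
- split; [| exact mG]; split; [| split; eexists; eassumption].
  intros x; apply @ex_derive_continuous; eexists; apply dG.
- apply alex_le; intros x y _; assert (A := Hb x); assert (A' := Hb y); apply Rabs_le; lra.
Qed.

(* The distribution [heat s] tends to the Dirac mass as [s] tends to 0, and the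
   Dirac mass attains the bound. *)
Lemma conv_heat_primitive_0 (s t : R) (G : R -> R) : 0 < s -> 0 < t -> InBc G ->
  (forall x, is_derive G x (heat s x)) -> is_lim G p_infty 1 ->
  conv G t 0 = / (2 * sqrt (PI * (s + t))).
Proof.
intros Hs Ht HG dG pG; destruct (InBc_bounded G HG) as [B HB].
assert (Hst : 0 < s * t / (s + t)) by (apply Rdiv_lt_0_compat; nra).
rewrite conv_U, <- heat_0 by (assumption || lra).
apply (U_eq G B HB); [exact Ht |].
assert (Q := lint_scal _ (heat (s + t) 0) _ (lint_heat _ Hst)).
rewrite Rmult_1_r in Q; destruct Q as [K [dK [mK pK]]].
assert (LG : forall y, is_lim G y (real (Lim G y)) -> is_lim (heat t) y 0 ->
  is_lim (fun x => G x * heat t x) y 0).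
{ intros y A1 A2; replace 0 with (real (Lim G y) * 0) by ring.
  apply (is_lim_mult G (heat t) y (real (Lim G y)) 0 A1 A2); exact I. }
destruct (hk_lim 0 t Ht) as [Hp Hm].
assert (mG := proj2 HG).
(* Integration by parts: [K] is the primitive of [heat s * heat t], and the product [G * heat t]
   vanishes at both ends. *)
exists (fun x => 1 * K x + (-1) * (G x * heat t x)); split; [| split].
- intros x; eapply is_derive_val.
  + apply is_derive_lin; [apply dK |].
    apply @is_derive_mult; [apply dG | apply (hk_derive_x 0), Ht | intros; apply Rmult_comm].
  + rewrite <- heat_mult by assumption; unfold plus, mult; simpl (hk 0).
    replace (0 - x) with (- x) by ring; rewrite hk1_odd.
    change (1 * (heat s x * heat t x) + -1 * (heat s x * heat t x + G x * hk 1 t x) =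
      G x * - hk 1 t x); ring.
- eapply is_lim_val.
  + apply is_lim_lin; [exact mK |]; apply LG; [| exact Hm].
    rewrite (is_lim_unique _ _ _ mG); exact mG.
  + ring.
- eapply is_lim_val.
  + apply is_lim_lin; [exact pK |]; apply LG; [| exact Hp].
    rewrite (is_lim_unique _ _ _ pG); exact pG.
  + ring.
Qed.

Lemma conv_bound_sharp (t c : R) : 0 < t -> c < / (2 * sqrt (PI * t)) ->
  exists G, InBc G /\ exists x, c * alex G < Rabs (conv G t x).
Proof.
intros Ht Hc; assert (HP := PI_RGT_0).
assert (Q := sqrt_PIt_pos t Ht).
assert (Hs : exists s, 0 < s /\ c < / (2 * sqrt (PI * (s + t)))).
{ destruct (Rle_dec c 0) as [Hc0 | Hc0].
  - exists 1; split; [lra |]; apply Rle_lt_trans with (1 := Hc0).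
    apply Rinv_0_lt_compat; assert (A := sqrt_PIt_pos (1 + t) ltac:(lra)); lra.
  - set (q := / (2 * c)).
    assert (Hq : sqrt (PI * t) < q).
    { unfold q; rewrite <- (Rinv_inv (sqrt (PI * t))).
      apply Rinv_lt_contravar; [apply Rmult_lt_0_compat; [lra | now apply Rinv_0_lt_compat] |].
      replace (/ sqrt (PI * t)) with (2 * / (2 * sqrt (PI * t))) by (field; lra); lra. }
    assert (Hq2 : PI * t < q * q).
    { rewrite <- (sqrt_sqrt (PI * t)) by nra; nra. }
    (* With this choice [PI * (s + t)] is the midpoint of [PI * t] and [q * q], so its square root
       stays below [q]. *)
    set (s := (q * q / PI - t) / 2).
    assert (Hs : 0 < s).
    { assert (t < q * q / PI) by (apply Rlt_div_r; lra); unfold s; lra. }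
    exists s; split; [exact Hs |].
    assert (Hsq : sqrt (PI * (s + t)) < q).
    { rewrite <- (sqrt_square q) by lra; apply sqrt_lt_1; [nra | nra |].
      replace (PI * (s + t)) with ((q * q + PI * t) / 2) by (unfold s; field; lra); lra. }
    assert (A := sqrt_PIt_pos (s + t) ltac:(lra)).
    replace c with (/ (2 * q)) by (unfold q; field; lra).
    apply Rinv_lt_contravar; nra. }
destruct Hs as [s [Hs Hcs]].
destruct (heat_primitive s Hs) as [G [HG [dG [pG aG]]]].
exists G; split; [exact HG |]; exists 0.
rewrite (conv_heat_primitive_0 s t G) by assumption.
destruct (InBc_bounded G HG) as [B HB]; assert (A0 := alex_nonneg G B HB).
assert (A := sqrt_PIt_pos (s + t) ltac:(lra)).
assert (A' : 0 < / (2 * sqrt (PI * (s + t)))) by (apply Rinv_0_lt_compat; lra).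
rewrite Rabs_right by (apply Rle_ge, Rlt_le, A').
destruct (Rle_dec c 0); nra.
Qed.

Lemma alex_ge_lim (H : R -> R) (l : R) : InBc H -> is_lim H p_infty l -> l <= alex H.
Proof.
intros HH Hl; destruct (InBc_bounded H HH) as [B HB].
apply le_epsilon; intros e He.
destruct (InBc_tails H (e / 2) HH ltac:(lra)) as [M [_ HT]].
rewrite (Finf_lim H l Hl) in HT.
assert (A1 := proj1 (HT (M + 1)) ltac:(lra)); assert (A2 := proj2 (HT (- M - 1)) ltac:(lra)).
assert (A3 := alex_ub H B HB (- M - 1) (M + 1)).
assert (A4 := Rle_abs (H (M + 1) - H (- M - 1))).
apply Rabs_def2 in A1; apply Rabs_def2 in A2; lra.
Qed.

(** The heat kernel at time 1 is a positive distribution: its norm is its total integral, which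
    smoothing preserves. The coefficient 1 is therefore attained. *)
Lemma alex_U0_sharp (t : R) : 0 < t ->
  exists G, InBc G /\ alex G = 1 /\ alex (U G 0 t) = 1.
Proof.
intros Ht; destruct (heat_primitive 1 Rlt_0_1) as [G [HG [dG [pG aG]]]].
exists G; split; [exact HG |].
assert (E : alex G = 1) by (apply Rle_antisym; [exact aG | now apply alex_ge_lim]).
split; [exact E |]; apply Rle_antisym.
- rewrite <- E; now apply alex_U0_le.
- apply alex_ge_lim; [apply (prim_of_conv G HG t Ht) |].
  rewrite <- (Finf_lim G 1 pG); now apply U0_lim.
Qed.

Lemma opnorm_Phi_eq (t : R) : 0 < t -> opnorm_Phi t = / (2 * sqrt (PI * t)).
Proof.
intros Ht; apply real_lub_eq.
- intros r [G [HG [Ha ->]]].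
  destruct (InBc_bounded G HG) as [B HB]; assert (A0 := alex_nonneg G B HB).
  apply Rle_div_l; [lra |].
  destruct (supnorm_le (conv G t) _ (fun x => conv_bound G HG t x Ht)) as [_ A].
  apply Rle_trans with (1 := A); right; unfold Rdiv; ring.
- intros c Hc; destruct (conv_bound_sharp t c Ht Hc) as [G [HG [x Hx]]].
  destruct (InBc_bounded G HG) as [B HB]; assert (A0 := alex_nonneg G B HB).
  assert (Ab := conv_bound G HG t x Ht).
  destruct (supnorm_le (conv G t) _ (fun x => conv_bound G HG t x Ht)) as [A _].
  specialize (A x).
  (* A zero norm would force [conv G t x = 0] by [conv_bound], against the strict inequality [Hx];
     hence the quotient is admissible. *)
  assert (Hn : alex G <> 0).
  { intros E; rewrite E in Hx, Ab; unfold Rdiv in Ab; rewrite Rmult_0_l in Ab; lra. }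
  exists (supnorm (conv G t) / alex G); split; [exists G; auto |].
  apply Rlt_div_r; lra.
Qed.

Lemma opnorm_Psi_eq (t : R) : 0 < t -> opnorm_Psi t = 1.
Proof.
intros Ht; apply real_lub_eq.
- intros r [G [HG [Ha ->]]]; rewrite prim_conv by assumption.
  destruct (InBc_bounded G HG) as [B HB]; assert (A0 := alex_nonneg G B HB).
  apply Rle_div_l; [lra |]; rewrite Rmult_1_l; now apply alex_U0_le.
- intros c Hc; destruct (alex_U0_sharp t Ht) as [G [HG [E1 E2]]].
  exists (alex (prim (conv G t)) / alex G); split; [exists G; repeat split; try apply HG; lra |].
  rewrite prim_conv, E1, E2 by assumption; lra.
Qed.

Lemma conv_lin (G1 G2 : R -> R) (a b t x : R) : 0 < t -> InBc G1 -> InBc G2 ->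
  conv (fun y => a * G1 y + b * G2 y) t x = a * conv G1 t x + b * conv G2 t x.
Proof.
intros Ht H1 H2; assert (H := InBc_lin G1 G2 a b H1 H2).
destruct (InBc_bounded _ H1) as [B1 HB1]; destruct (InBc_bounded _ H2) as [B2 HB2].
destruct (InBc_bounded _ H) as [B HB].
rewrite !conv_U by assumption; apply (U_eq _ B HB); [exact Ht |].
assert (L := lint_lin _ _ a b _ _ (U_spec G1 B1 HB1 1 t x Ht) (U_spec G2 B2 HB2 1 t x Ht)).
revert L; apply lint_ext; intros; ring.
Qed.

Lemma conv_analytic_x (F : R -> R) (t : R) : InBc F -> 0 < t ->
  analytic_on (conv F t) (fun _ => True).
Proof.
intros HF Ht x0 _; destruct (InBc_bounded F HF) as [B HB]; rewrite conv_U by assumption.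
destruct (U1_analytic_x F B t x0 HB Ht) as [a [r [Hr H]]].
exists a, r; split; [exact Hr |]; intros x _; apply H.
Qed.

Lemma conv_analytic_t (F : R -> R) (x : R) : InBc F ->
  analytic_on (fun t => conv F t x) (fun t => 0 < t).
Proof.
intros HF t0 Ht0; destruct (InBc_bounded F HF) as [B HB].
destruct (U1_analytic_t F B t0 x HB Ht0) as [a [r [Hr H]]].
exists a, r; split; [exact Hr |]; intros t Ht; rewrite conv_U by assumption; apply H.
Qed.

Theorem theorem3p1 (F : R -> R) (HF : InBc F) :
  (* (a) *)
  (forall t x, 0 < t ->
     int_fg F (fun xi => heat t (x - xi)) (conv F t x) /\
     int_fg (refl_prim F x) (heat t) (conv_rev F t x) /\
     int_fun (fun xi => F xi * Derive (heat t) (x - xi)) (conv F t x) /\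
     conv_rev F t x = conv F t x /\
     (forall y, int_fun (fun xi => F xi * heat t (y - xi)) (Fconv F t y)) /\
     is_derive (Fconv F t) x (conv F t x)) /\
  (* (b) *)
  smooth_on (fun x t => conv F t x) (fun _ t => 0 < t) /\
  (* (c) *)
  (forall t, 0 < t ->
     (forall x, Rabs (conv F t x) <= alex F / (2 * sqrt (PI * t))) /\
     (forall c, c < / (2 * sqrt (PI * t)) ->
        exists G, InBc G /\ exists x, c * alex G < Rabs (conv G t x))) /\
  (* (d) *)
  (forall t, 0 < t ->
     (forall G, InBc G -> in_Cbar (conv G t)) /\
     (forall G1 G2 a b, InBc G1 -> InBc G2 ->
        forall x, conv (fun y => a * G1 y + b * G2 y) t x = a * conv G1 t x + b * conv G2 t x) /\
     opnorm_Phi t = / (2 * sqrt (PI * t))) /\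
  (* (e) *)
  (forall t, 0 < t -> is_lim (conv F t) p_infty 0 /\ is_lim (conv F t) m_infty 0) /\
  (* (f) *)
  (forall t, 0 < t ->
     (exists H, prim_of (conv F t) H /\ alex H <= alex F) /\
     (forall c, c < 1 ->
        exists G H, InBc G /\ prim_of (conv G t) H /\ c * alex G < alex H) /\
     (forall G, InBc G -> fun_in_Ac (conv G t)) /\
     opnorm_Psi t = 1) /\
  (* (g) *)
  ((forall x t, 0 < t ->
      ex_pd true (fun x t => conv F t x) x t /\
      ex_pd true (pd true (fun x t => conv F t x)) x t /\
      ex_pd false (fun x t => conv F t x) x t /\
      cont2 (fun x t => conv F t x) x t /\
      cont2 (pd true (fun x t => conv F t x)) x t /\
      cont2 (pd true (pd true (fun x t => conv F t x))) x t /\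
      cont2 (pd false (fun x t => conv F t x)) x t /\
      pd false (fun x t => conv F t x) x t
        - pd true (pd true (fun x t => conv F t x)) x t = 0) /\
   filterlim (fun t => alex (fun y => prim (conv F t) y - F y))
     (at_right 0) (locally 0)) /\
  (* (h) *)
  (forall t, 0 < t -> int_fun (conv F t) (Finf F)) /\
  (* (i) *)
  (forall t, 0 < t -> exists G, InBc G /\
     forall p, 1 <= p -> ~ InLp p (conv G t)) /\
  (* (j) *)
  (forall t, 0 < t -> analytic_on (conv F t) (fun _ => True)) /\
  (forall x, analytic_on (fun t => conv F t x) (fun t => 0 < t)).
Proof.
destruct (InBc_bounded F HF) as [B HB].
assert (HV : forall t x, 0 < t -> int_fun (fun xi => F xi * Derive (heat t) (x - xi)) (conv F t x)).
{ intros t x Ht; rewrite conv_U by assumption.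
  replace (fun xi => F xi * Derive (heat t) (x - xi)) with (fun xi => F xi * hk 1 t (x - xi)).
  - now apply int_fun_U.
  - apply functional_extensionality; intros xi; f_equal; symmetry.
    apply is_derive_unique, (hk_derive_x 0), Ht. }
repeat match goal with |- _ /\ _ => split end.
- intros t x Ht; split; [rewrite conv_U by assumption; now apply conv_int_fg |].
  split; [rewrite conv_rev_U by assumption; now apply conv_rev_int_fg |].
  split; [now apply HV |].
  split; [now rewrite conv_rev_U, conv_U |].
  rewrite Fconv_U, conv_U by assumption.
  split; [intros y; now apply (int_fun_U F HF 0) | now apply (U_derive_x F B HB)].
- now apply conv_smooth.
- intros t Ht; split; [intros x; now apply conv_bound | intros c; now apply conv_bound_sharp].
- intros t Ht; split; [intros G HG; now apply conv_in_Cbar |].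
  split; [intros G1 G2 a b H1 H2 x; now apply conv_lin | now apply opnorm_Phi_eq].
- intros t Ht; rewrite conv_U by assumption; now apply U1_lim.
- intros t Ht; split; [| split; [| split]].
  + exists (U F 0 t); split; [now apply prim_of_conv | now apply alex_U0_le].
  + intros c Hc; destruct (alex_U0_sharp t Ht) as [G [HG [E1 E2]]].
    exists G, (U G 0 t); split; [exact HG |]; split; [now apply prim_of_conv |].
    rewrite E1, E2; lra.
  + intros G HG; exists (U G 0 t); now apply prim_of_conv.
  + now apply opnorm_Psi_eq.
- intros x t Ht; assert (S := conv_smooth F HF).
  destruct (S nil x t Ht) as [C0 X0]; destruct (S (cons true nil) x t Ht) as [C1 X1].
  destruct (S (cons true (cons true nil)) x t Ht) as [C2 _].
  destruct (S (cons false nil) x t Ht) as [C3 _].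
  exact (conj (X0 true) (conj (X1 true) (conj (X0 false) (conj C0 (conj C1 (conj C2
    (conj C3 (conv_heat_equation F HF x t Ht)))))))).
- now apply conv_initial_value.
- intros t Ht; now apply conv_integral.
- intros t Ht.
  (* The largest frequency allowed by the cosine estimate: [w * w * t] is exactly [1 / 2]. It
     depends on [t] only, so one [G] serves for every [p]. *)
  set (w := / sqrt (2 * t)).
  assert (Hs : 0 < sqrt (2 * t)) by (apply sqrt_lt_R0; lra).
  assert (Hw : 0 < w) by now apply Rinv_0_lt_compat.
  assert (Hwt : w * w * t <= / 2).
  { unfold w; rewrite <- Rinv_mult, sqrt_sqrt by lra; right; field; lra. }
  exists (slow_sin w); split; [apply slow_sin_InBc |]; intros p Hp.
  destruct (INR_unbounded p) as [n Hn].
  apply (LpBlocks.not_InLp_blocks _ p n); [lra |].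
  rewrite conv_U by (assumption || apply slow_sin_InBc).
  now apply U1_slow_sin_blocks.
- intros t Ht; now apply conv_analytic_x.
- intros x; now apply conv_analytic_t.
Qed.
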